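(* Every Eisenpint tangency packing is a primitive Eisenstein circle packing scaled by $\frac{1}{\sqrt3}$ (that is, its image under $z\mapsto\sqrt3\,z$ is a primitive Eisenstein circle packing). This association bijects equivalence classes of Eisenpint tangency packings with primitive Eisenstein circle packings (the latter taken up to translation, rotation and reflection of the plane).
   Context: Let $\omega=\frac{1+\sqrt{-3}}{2}$, $\widehat{\mathbb{R}}=\mathbb{R}\cup\{\infty\}$, $\widehat{\mathbb{C}}=\mathbb{C}\cup\{\infty\}$; circles include lines (with $\infty$). Let $\Gamma_{\mathrm{E}}$ be the group of $M\in\mathrm{PSL}(2,\mathbb{Z}[\omega])$ with $M\equiv\left(\begin{smallmatrix}1&0\\ *&1\end{smallmatrix}\right)\pmod2$, acting by Möbius transformations. The Eisenpint Schmidt arrangement is the set of unoriented circles $M(\widehat{\mathbb{R}})$, $M\in\Gamma_{\mathrm{E}}$; let $\widehat{\mathcal{P}}_{\mathrm{E}}$ denote the set of these circles taken with both orientations. For an oriented circle the interior is the region to the left. A collection $\mathcal{P}$ of circles straddles a circle $\mathcal{C}$ if it intersects both the interior and the exterior of $\mathcal{C}$; $\mathcal{P}$ is tangency-connected if its graph of tangencies is connected. An Eisenpint tangency packing is a maximal tangency-connected subset $\mathcal{P}$ of oriented circles from $\widehat{\mathcal{P}}_{\mathrm{E}}$ such that $\mathcal{P}$ does not straddle any circle in $\widehat{\mathcal{P}}_{\mathrm{E}}$ and the interiors of the circles of $\mathcal{P}$ are disjoint. Two Eisenpint tangency packings are equivalent if they are related by a sequence of translations by elements of $2\mathbb{Z}[\omega]$,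 rotations by $\pi$ about the origin, and reflections across the imaginary axis. Oriented circles in $\widehat{\mathbb{C}}$ are represented by vectors $(u,v,p,q)\in\mathbb{R}^4$ with $p^2+q^2-uv=1$, where $u$ is the curvature (signed reciprocal of the radius, negative iff $\infty$ is in the interior, $0$ for lines), $v$ the co-curvature (curvature after $z\mapsto1/z$), and $p+qi$ the curvature-centre ($u$ times the centre if $u\neq0$, the unit normal from exterior to interior if $u=0$). Put $\langle(u_1,v_1,p_1,q_1),(u_2,v_2,p_2,q_2)\rangle=-\frac12u_1v_2-\frac12u_2v_1+p_1p_2+q_1q_2$. A 4-wheel is a 4-tuple $(\mathcal{C}_1,\mathcal{C}_2,\mathcal{C}_3,\mathcal{C}_4)$ of oriented circles with positive curvature sum such that $\langle\mathcal{C}_i,\mathcal{C}_i\rangle=1$ for all $i$, $\langle\mathcal{C}_1,\mathcal{C}_3\rangle=\langle\mathcal{C}_2,\mathcal{C}_4\rangle=-2$, and all other products are $-1$. The $i$-th swap of a 4-wheel replaces $\mathcal{C}_i$ by its image under inversion in the circle orthogonal to the other three; the result is again a 4-wheel. An Eisenstein circle packing is the collection of all circles occurring in 4-wheels obtained from some starting 4-wheel by finite sequences of swaps. It is primitive if all curvatures are integers with no common factor. *)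

(* Defs.v *)
From Stdlib Require Import Relation_Operators.
From mathcomp Require Import all_boot all_order all_algebra complex.
From mathcomp Require Import mathcomp_extra boolp classical_sets functions reals.
From mathcomp Require Import ring lra.

Set Implicit Arguments.
Unset Strict Implicit.
Unset Printing Implicit Defensive.

Import Order.TTheory GRing.Theory Num.Theory.

Local Open Scope classical_set_scope.
Local Open Scope complex_scope.
Local Open Scope ring_scope.

(* The Riemann sphere; None is the point at infinity. *)
Definition sphere (R : realType) : Type := option R[i].

Definition real_line (R : realType) : set (sphere R) :=
  [set x | if x is Some z then complex.Im z = 0 else True].

Definition mobius (R : realType) (M : 'M[R[i]]_2) (x : sphere R) : sphere R :=
  match x with
  | None => if M 1 0 == 0 then None else Some (M 0 0 / M 1 0)
  | Some z =>
      if M 1 0 * z + M 1 1 == 0 then None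
      else Some ((M 0 0 * z + M 0 1) / (M 1 0 * z + M 1 1))
  end.

Record ocircle (R : realType) := OCircle {
  curv : R;
  cocurv : R;
  ccx : R;
  ccy : R;
  _ : ccx ^+ 2 + ccy ^+ 2 - curv * cocurv == 1 }.

Lemma ocircleP (R : realType) (C : ocircle R) :
  ccx C ^+ 2 + ccy C ^+ 2 - curv C * cocurv C = 1.
Proof. by case: C => u v p q h; apply/eqP. Qed.

Definition curv_centre (R : realType) (C : ocircle R) : R[i] :=
  ccx C +i* ccy C.

Definition oc_prod (R : realType) (C D : ocircle R) : R :=
  - (2^-1 * (curv C * cocurv D)) - 2^-1 * (curv D * cocurv C)
  + ccx C * ccx D + ccy C * ccy D.

(* If curv C != 0, this is curv C * (|z - c|^2 - r^2), with c the centre and r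
   the radius of C; if curv C = 0, it is the equation of the line, negative on
   the side to which the normal curv_centre C points. *)
Definition oc_form (R : realType) (C : ocircle R) (z : R[i]) : R :=
  curv C * (complex.Re z ^+ 2 + complex.Im z ^+ 2)
  - 2 * (ccx C * complex.Re z + ccy C * complex.Im z) + cocurv C.

Definition oc_points (R : realType) (C : ocircle R) : set (sphere R) :=
  [set x | if x is Some z then oc_form C z = 0 else curv C = 0].

Definition oc_interior (R : realType) (C : ocircle R) : set (sphere R) :=
  [set x | if x is Some z then oc_form C z < 0 else curv C < 0].

Definition oc_exterior (R : realType) (C : ocircle R) : set (sphere R) :=
  [set x | if x is Some z then 0 < oc_form C z else 0 < curv C].

Lemma oc_form_circle (R : realType) (C : ocircle R) (z : R[i]) :
  curv C != 0 ->
  oc_form C z = curv C * ((complex.Re z - ccx C / curv C) ^+ 2 +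
                          (complex.Im z - ccy C / curv C) ^+ 2 -
                          (curv C)^-1 ^+ 2).
Proof.
move=> u0; rewrite /oc_form.
have -> : cocurv C = (ccx C ^+ 2 + ccy C ^+ 2 - 1) / curv C.
  by rewrite -(ocircleP C) opprB addrC subrK mulrC mulKf.
by field.
Qed.

(* A map f of the sphere carries an oriented circle C to the oriented circle
   whose interior is the image under f of the interior of C. *)
Definition is_image (R : realType) (f : sphere R -> sphere R)
    (C D : ocircle R) : Prop :=
  oc_interior D = f @` oc_interior C.

Definition image_circles (R : realType) (f : sphere R -> sphere R)
    (P : set (ocircle R)) : set (ocircle R) :=
  [set D | exists2 C, P C & is_image f C D].

Definition omega (R : realType) : R[i] := 2^-1 +i* (Num.sqrt 3 / 2).

Definition eisenstein_int (R : realType) : set R[i] :=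
  [set z | exists a b : int, z = a%:~R + b%:~R * omega R].

Definition cong2 (R : realType) (x y : R[i]) : Prop :=
  exists2 t, eisenstein_int t & x - y = 2 * t.

(* Membership and action are unchanged under M |-> - M, so the elements of the
   projective group are given by their representatives of determinant 1. *)
Definition GammaE (R : realType) : set 'M[R[i]]_2 :=
  [set M : 'M[R[i]]_2 | [/\ forall i j, eisenstein_int (M i j), \det M = 1,
               cong2 (M 0 0) 1, cong2 (M 0 1) 0 & cong2 (M 1 1) 1]].

(* Both orientations of each circle M(R u {oo}) are included, as oc_points does
   not depend on the orientation. *)
Definition eisenpint_circle (R : realType) : set (ocircle R) :=
  [set C | exists2 M, GammaE M & oc_points C = mobius M @` @real_line R].

Definition straddles (R : realType) (P : set (ocircle R)) (C : ocircle R) :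
    Prop :=
  (exists2 D, P D & oc_points D `&` oc_interior C !=set0) /\
  (exists2 D, P D & oc_points D `&` oc_exterior C !=set0).

Definition tangent (R : realType) (C D : ocircle R) : Prop :=
  exists x, oc_points C `&` oc_points D = [set x].

Definition tangency_connected (R : realType) (P : set (ocircle R)) : Prop :=
  forall C D, P C -> P D ->
    clos_refl_trans _ (fun A B => [/\ P A, P B & tangent A B]) C D.

Definition eisenpint_admissible (R : realType) (P : set (ocircle R)) : Prop :=
  [/\ P `<=` @eisenpint_circle R,
      tangency_connected P,
      forall C, eisenpint_circle C -> ~ straddles P C
    & trivIset P (@oc_interior R)].

Definition eisenpint_packing (R : realType) : set (set (ocircle R)) :=
  [set P | eisenpint_admissible P /\
           forall Q, eisenpint_admissible Q -> P `<=` Q -> Q = P].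

Inductive eisenpint_move (R : realType) : (R[i] -> R[i]) -> Prop :=
  | Move_translation t :
      eisenstein_int t -> eisenpint_move (fun z => z + 2 * t)
  | Move_rotation : eisenpint_move (fun z => - z)
  | Move_reflection : eisenpint_move (fun z => - z^*).

Definition eisenpint_equiv (R : realType) :
    set (ocircle R) -> set (ocircle R) -> Prop :=
  clos_refl_trans _ (fun P Q =>
    exists2 f, eisenpint_move f & Q = image_circles (omap f) P).

Definition inversion (R : realType) (W : ocircle R) (x : sphere R) : sphere R :=
  let b := curv_centre W in
  mobius (\matrix_(i, j) if (i == 0) && (j == 0) then b
                         else if i == 0 then - (cocurv W)%:C
                         else if j == 0 then (curv W)%:C
                         else - b^*)
    (omap (fun z => z^*) x).

Lemma inversionE (R : realType) (W : ocircle R) (z : R[i]) :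
  inversion W (Some z) =
  if (curv W)%:C * z^* - (curv_centre W)^* == 0 then None
  else Some ((curv_centre W * z^* - (cocurv W)%:C) /
             ((curv W)%:C * z^* - (curv_centre W)^* )).
Proof. by rewrite /inversion /mobius !mxE. Qed.

Lemma curv_centre_norm (R : realType) (W : ocircle R) :
  curv_centre W * (curv_centre W)^* = 1 + (curv W)%:C * (cocurv W)%:C.
Proof.
have h := ocircleP W; apply/eqP; rewrite eq_complex /=.
by apply/andP; split; apply/eqP; lra.
Qed.

Lemma inversion_circle (R : realType) (W : ocircle R) (z : R[i]) :
  let c := curv_centre W / (curv W)%:C in
  let r := (curv W)%:C^-1 in
  curv W != 0 -> z != c ->
  inversion W (Some z) = Some (c + r ^+ 2 / (z - c)^*).
Proof.
move=> c r u0 zc; rewrite inversionE.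
have u0' : (curv W)%:C != 0 :> R[i] by rewrite eq_complex /= negb_and u0.
have uC : ((curv W)%:C)^* = (curv W)%:C :> R[i] by exact: conjc_real.
set b := curv_centre W; set w := z^*.
have hc : (z - c)^* = w - b^* / (curv W)%:C.
  by rewrite /c rmorphB rmorphM fmorphV; congr (_ - _ / _); exact: uC.
have d0 : w - b^* / (curv W)%:C != 0.
  by rewrite -hc fmorph_eq0 subr_eq0.
have e0 : (curv W)%:C * w - b^* != 0.
  have -> : (curv W)%:C * w - b^* = (curv W)%:C * (w - b^* / (curv W)%:C).
    by field.
  by rewrite mulf_neq0.
rewrite ifN; last exact: e0.
rewrite hc /c /r -/b; congr Some.
have -> : (cocurv W)%:C = (b * b^* - 1) / (curv W)%:C.
  by rewrite curv_centre_norm addrC addKr mulrC mulKf.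
by field; apply/andP; split; [exact: u0' | rewrite mulrC; exact: e0].
Qed.

Lemma inversion_line (R : realType) (W : ocircle R) (z : R[i]) :
  curv W = 0 ->
  inversion W (Some z) = Some (z + (oc_form W z)%:C * curv_centre W).
Proof.
move=> u0; rewrite inversionE u0 mul0r add0r.
have hb : curv_centre W * (curv_centre W)^* = 1.
  by rewrite curv_centre_norm u0 mul0r addr0.
have b0 : (curv_centre W)^* != 0.
  by apply: contra_eq_neq hb => ->; rewrite mulr0 eq_sym oner_eq0.
rewrite ifN ?oppr_eq0 //; congr Some.
apply: (mulIf (x := - (curv_centre W)^* )); first by rewrite oppr_eq0.
rewrite divfK ?oppr_eq0 // mulrDl [X in _ = _ + X]mulrN -mulrA hb mulr1.
rewrite /curv_centre /oc_form u0; case: z => x y.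
by apply/eqP; rewrite eq_complex /=; apply/andP; split; apply/eqP; ring.
Qed.

(* Indexing from 0, the opposite pairs (product -2) are {0, 2} and {1, 3}, the
   pairs of distinct indices of the same parity. *)
Definition wheel (R : realType) (W : 'I_4 -> ocircle R) : Prop :=
  0 < \sum_i curv (W i) /\
  forall i j, oc_prod (W i) (W j) =
    if i == j then 1 else if odd (i + j)%N then -1 else -2.

Definition swap (R : realType) (i : 'I_4) (W W' : 'I_4 -> ocircle R) : Prop :=
  (forall j, j != i -> W' j = W j) /\
  exists2 D, forall j, j != i -> oc_prod D (W j) = 0 &
             is_image (inversion D) (W i) (W' i).

Definition eisenstein_packing (R : realType) : set (set (ocircle R)) :=
  [set P | exists2 W0, wheel W0 &
     P = [set C | exists2 W,
            clos_refl_trans _ (fun A B => exists i, swap i A B) W0 W &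
            exists i, C = W i]].

Definition primitive (R : realType) (P : set (ocircle R)) : Prop :=
  (forall C, P C -> curv C \is a Num.int) /\
  (forall d : nat,
     (forall C, P C -> exists k : int, curv C = d%:R * k%:~R) -> d = 1%N).

Definition primitive_eisenstein_packing (R : realType) :
    set (set (ocircle R)) :=
  [set P | eisenstein_packing P /\ primitive P].

Definition isometric (R : realType) (P Q : set (ocircle R)) : Prop :=
  exists e t : R[i], `|e| = 1 /\
    (Q = image_circles (omap (fun z => e * z + t)) P \/
     Q = image_circles (omap (fun z => e * z^* + t)) P).

Definition scale_sqrt3 (R : realType) (P : set (ocircle R)) :
    set (ocircle R) :=
  image_circles (omap (fun z => (Num.sqrt 3)%:C * z)) P.

Definition eq_classes (T : Type) (A : set T) (e : T -> T -> Prop) :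
    set (set T) :=
  [set K | exists2 x, A x & K = [set y | A y /\ e x y]].

(* Main.v *)
(* Circles are vectors of the Lorentz space R^(3,1), points of the sphere are
   isotropic rays, and the circles of the Eisenpint arrangement are the vectors
   of norm 1 of the lattice L of the vectors
     (u, v, p, q) = (sqrt 3 m, 2 sqrt 3 n, sqrt 3 b, a),  m, n, b, a integers,
   by a Euclidean descent on |m| + |n|.  The products of such circles are
   integers not divisible by 3, so the circles never cross.  A swap replaces C_i
   by 2 (C_(i-1) + C_(i+1)) - C_i; hence the orbit of a wheel W of L stays in L,
   and W, having discriminant -27 like L, is a basis of L.  For E in the
   arrangement the product of E with the sum of W is therefore -3 times an odd
   integer, whose sign tells on which side of E all the circles of W lie; as
   this sign is constant along the orbit, E does not straddle the orbit.
   Conversely a circle of an admissible collection containing some C in W has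
   negative products with all circles of the orbit other than itself, and a
   descent along swaps shows that it belongs to the orbit: the Eisenpint tangency
   packings are exactly the orbits of the wheels of L.

   A similarity between two such packings preserves L, hence is one of the
   allowed moves up to composition.  Finally four integers a_i without common
   factor with sum (a_i)^2 = 2 (a_0 + a_2) (a_1 + a_3) are reduced to
   (0, 0, 1, 1), up to rotation, by swaps and by inversions in circles of the
   wheel; these operations lift to wheels of L, and two wheels with the same
   curvatures differ by a Euclidean isometry. *)
Require Import Defs.
From Stdlib Require Import Relation_Operators Operators_Properties.
From mathcomp Require Import all_boot all_order all_algebra complex.
From mathcomp Require Import mathcomp_extra boolp classical_sets functions reals.
From mathcomp Require Import ring lra zify.

Set Implicit Arguments.
Unset Strict Implicit.
Unset Printing Implicit Defensive.

Import Order.TTheory GRing.Theory Num.Theory.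

Local Open Scope classical_set_scope.
Local Open Scope complex_scope.
Local Open Scope ring_scope.

(** * Lorentz space *)

(** Interiors, straddling and tangency are decided by signs in the light cone. Two norm 1 vectors
    with product at most -1 or at least 1 have a causal sum or difference; its product with one
    time-like vector, the sum of a wheel, tells in which half of the cone it lies, and a vector of
    the future half has a nonnegative form at every point of the sphere. This needs two gaps: no
    lattice products strictly between -1 and 1, and no products with the sum of a wheel strictly
    between -3 and 3. The second gap is exactly wide enough, as each circle of a wheel has product
    -3 with that sum, so that adding or subtracting it does not spoil the sign. The first gap comes
    from residues: the product of two lattice vectors is a a' modulo 3, and norm 1 makes a prime to
    3. An obstacle is that a circle and its reverse have disjoint interiors; tangency-connectedness
    is what keeps both from lying in one packing. *)

Definition i0 : 'I_4 := @Ordinal 4 0 isT.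
Definition i1 : 'I_4 := @Ordinal 4 1 isT.
Definition i2 : 'I_4 := @Ordinal 4 2 isT.
Definition i3 : 'I_4 := @Ordinal 4 3 isT.

Lemma ord4_ind (P : 'I_4 -> Prop) :
  P i0 -> P i1 -> P i2 -> P i3 -> forall i, P i.
Proof.
move=> h0 h1 h2 h3 [[|[|[|[|//]]]] h].
- by rewrite (_ : Ordinal h = i0) //; apply: val_inj.
- by rewrite (_ : Ordinal h = i1) //; apply: val_inj.
- by rewrite (_ : Ordinal h = i2) //; apply: val_inj.
- by rewrite (_ : Ordinal h = i3) //; apply: val_inj.
Qed.

Lemma sum4 (V : nmodType) (F : 'I_4 -> V) :
  \sum_i F i = F i0 + F i1 + F i2 + F i3.
Proof.
rewrite !big_ord_recl big_ord0 addr0 !addrA.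
by congr (F _ + F _ + F _ + F _); apply: val_inj.
Qed.

Section Lorentz.
Context {R : realType}.
Implicit Types (x y z : 'rV[R]_4) (C D E : ocircle R).

Definition mkv (u v p q : R) : 'rV[R]_4 :=
  \row_(j < 4) nth 0 [:: u; v; p; q] j.

Definition vu x := x ord0 i0.
Definition vv x := x ord0 i1.
Definition vp x := x ord0 i2.
Definition vq x := x ord0 i3.

Lemma vecP x y :
  vu x = vu y -> vv x = vv y -> vp x = vp y -> vq x = vq y -> x = y.
Proof. by move=> h0 h1 h2 h3; apply/rowP; apply: ord4_ind. Qed.

Lemma vuE u v p q : vu (mkv u v p q) = u. Proof. by rewrite /vu mxE. Qed.
Lemma vvE u v p q : vv (mkv u v p q) = v. Proof. by rewrite /vv mxE. Qed.
Lemma vpE u v p q : vp (mkv u v p q) = p. Proof. by rewrite /vp mxE. Qed.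
Lemma vqE u v p q : vq (mkv u v p q) = q. Proof. by rewrite /vq mxE. Qed.
Definition mkvE := (vuE, vvE, vpE, vqE).

Lemma mkvK x : mkv (vu x) (vv x) (vp x) (vq x) = x.
Proof. by apply: vecP; rewrite mkvE. Qed.

Lemma vecDE x y :
  (vu (x + y) = vu x + vu y) * (vv (x + y) = vv x + vv y) *
  (vp (x + y) = vp x + vp y) * (vq (x + y) = vq x + vq y).
Proof. by rewrite /vu /vv /vp /vq !mxE. Qed.

Lemma vecNE x :
  (vu (- x) = - vu x) * (vv (- x) = - vv x) *
  (vp (- x) = - vp x) * (vq (- x) = - vq x).
Proof. by rewrite /vu /vv /vp /vq !mxE. Qed.

Lemma vecZE a x :
  (vu (a *: x) = a * vu x) * (vv (a *: x) = a * vv x) *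
  (vp (a *: x) = a * vp x) * (vq (a *: x) = a * vq x).
Proof. by rewrite /vu /vv /vp /vq !mxE. Qed.

Lemma vec0E :
  (vu (0 : 'rV[R]_4) = 0) * (vv (0 : 'rV[R]_4) = 0) *
  (vp (0 : 'rV[R]_4) = 0) * (vq (0 : 'rV[R]_4) = 0).
Proof. by rewrite /vu /vv /vp /vq !mxE. Qed.

Definition vecE := (mkvE, vecDE, vecNE, vecZE, vec0E).

Definition dot x y : R :=
  - (2^-1 * (vu x * vv y)) - 2^-1 * (vu y * vv x) + vp x * vp y + vq x * vq y.

Lemma dotC x y : dot x y = dot y x.
Proof. by rewrite /dot; ring. Qed.

Lemma dotDl x y z : dot (x + y) z = dot x z + dot y z.
Proof. by rewrite /dot !vecE; ring. Qed.

Lemma dotNl x z : dot (- x) z = - dot x z.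
Proof. by rewrite /dot !vecE; ring. Qed.

Lemma dotZl a x z : dot (a *: x) z = a * dot x z.
Proof. by rewrite /dot !vecE; ring. Qed.

Lemma dotDr x y z : dot z (x + y) = dot z x + dot z y.
Proof. by rewrite /dot !vecE; ring. Qed.

Lemma dotNr x z : dot z (- x) = - dot z x.
Proof. by rewrite /dot !vecE; ring. Qed.

Lemma dotZr a x z : dot z (a *: x) = a * dot z x.
Proof. by rewrite /dot !vecE; ring. Qed.

Lemma dot0l x : dot 0 x = 0.
Proof. by rewrite /dot !vecE; ring. Qed.

Definition dotE := (dotDl, dotNl, dotZl, dotDr, dotNr, dotZr).

Lemma dot_suml (I : Type) (r : seq I) (P : pred I) (F : I -> 'rV[R]_4) z :
  dot (\sum_(i <- r | P i) F i) z = \sum_(i <- r | P i) dot (F i) z.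
Proof. exact: (big_morph (fun x => dot x z) (fun x y => dotDl x y z)
  (dot0l z)). Qed.

Lemma dot_sumr (I : Type) (r : seq I) (P : pred I) (F : I -> 'rV[R]_4) z :
  dot z (\sum_(i <- r | P i) F i) = \sum_(i <- r | P i) dot z (F i).
Proof. by rewrite dotC dot_suml; apply: eq_bigr => i _; rewrite dotC. Qed.

Definition vec C : 'rV[R]_4 := mkv (curv C) (cocurv C) (ccx C) (ccy C).

Lemma oc_prodE C D : oc_prod C D = dot (vec C) (vec D).
Proof. by rewrite /oc_prod /dot !mkvE. Qed.

Lemma dot_vec C : dot (vec C) (vec C) = 1.
Proof. by rewrite -(ocircleP C) /dot !mkvE; field. Qed.

Lemma vec_inj : injective vec.
Proof.
move=> [u v p q h] [u' v' p' q' h'] e.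
have := congr1 vu e; have := congr1 vv e; have := congr1 vp e.
have := congr1 vq e; rewrite !mkvE /= => eq ep ev eu.
by subst; congr OCircle; apply: eq_irrelevance.
Qed.

Lemma vec_surj x : dot x x = 1 -> exists C, vec C = x.
Proof.
move=> h.
have h' : vp x ^+ 2 + vq x ^+ 2 - vu x * vv x == 1.
  by rewrite -h /dot; apply/eqP; field.
by exists (OCircle h'); apply: vecP; rewrite mkvE.
Qed.

(* The hermitian form of x, evaluated at the point (z : 1) or (1 : 0). *)
Definition hform x (s : sphere R) : R :=
  if s is Some z then
    vu x * (complex.Re z ^+ 2 + complex.Im z ^+ 2)
    - 2 * (vp x * complex.Re z + vq x * complex.Im z) + vv x
  else vu x.

Lemma oc_interiorE C s : oc_interior C s = (hform (vec C) s < 0) :> Prop.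
Proof. by case: s => [z|]; rewrite /oc_interior /= /hform /oc_form !mkvE. Qed.

Lemma oc_exteriorE C s : oc_exterior C s = (0 < hform (vec C) s) :> Prop.
Proof. by case: s => [z|]; rewrite /oc_exterior /= /hform /oc_form !mkvE. Qed.

Lemma oc_pointsE C s : oc_points C s = (hform (vec C) s = 0) :> Prop.
Proof. by case: s => [z|]; rewrite /oc_points /= /hform /oc_form !mkvE. Qed.

Lemma hformD x y s : hform (x + y) s = hform x s + hform y s.
Proof. by case: s => [z|]; rewrite /hform !vecE //; ring. Qed.

Lemma hformN x s : hform (- x) s = - hform x s.
Proof. by case: s => [z|]; rewrite /hform !vecE //; ring. Qed.

(** * Causal vectors and the light cone *)

Definition causal x := dot x x <= 0.

(** The closed forward light cone. Both coordinates are constrained because [vu] vanishes on the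
    isotropic ray of the point at infinity. *)
Definition future x := [/\ dot x x <= 0, 0 <= vu x & 0 <= vv x].

Definition tfuture x := dot x x < 0 /\ 0 < vu x.

Lemma dotxx x : dot x x = vp x ^+ 2 + vq x ^+ 2 - vu x * vv x.
Proof. by rewrite /dot; field. Qed.

Lemma tfutureP x : tfuture x <-> dot x x < 0 /\ 0 < vv x.
Proof.
rewrite /tfuture dotxx.
have := sqr_ge0 (vp x); have := sqr_ge0 (vq x).
split=> -[h1 h2]; split=> //.
  have : 0 < vu x * vv x by lra.
  by rewrite pmulr_rgt0.
have : 0 < vu x * vv x by lra.
by rewrite pmulr_lgt0.
Qed.

(** Reversed Cauchy-Schwarz: the square of the planar part [c] is at most the product of the two
    [vu * vv], which by the arithmetic-geometric mean is at most the square of half the mixed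
    sum. *)
Lemma future_dot x y : future x -> future y -> dot x y <= 0.
Proof.
move=> [hx ux vx] [hy uy vy].
rewrite dotxx in hx; rewrite dotxx in hy.
pose c := vp x * vp y + vq x * vq y.
have hc : c ^+ 2 <= (vu x * vv x) * (vu y * vv y).
  apply: (@le_trans _ _ ((vp x ^+ 2 + vq x ^+ 2) * (vp y ^+ 2 + vq y ^+ 2))).
    have := sqr_ge0 (vp x * vq y - vq x * vp y); rewrite /c; nra.
  have := sqr_ge0 (vp x); have := sqr_ge0 (vq x).
  have := sqr_ge0 (vp y); have := sqr_ge0 (vq y) => *.
  by apply: ler_pM; lra.
have hs : 0 <= vu x * vv y + vu y * vv x by rewrite addr_ge0 ?mulr_ge0.
have h4 : (2 * c) ^+ 2 <= (vu x * vv y + vu y * vv x) ^+ 2.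
  by have := sqr_ge0 (vu x * vv y - vu y * vv x); nra.
have : 2 * c <= vu x * vv y + vu y * vv x.
  rewrite leNgt; apply/negP => lt; move: h4; rewrite leNgt => /negP; apply.
  by rewrite ltrXn2r // ?nnegrE; lra.
by rewrite /dot -addrA -/c; lra.
Qed.

Lemma causal_futureN x : causal x -> future x \/ future (- x).
Proof.
rewrite /causal => h.
have hN : dot (- x) (- x) <= 0 by rewrite !dotE opprK.
move: (h); rewrite dotxx => h'.
have huv : 0 <= vu x * vv x.
  by have := sqr_ge0 (vp x); have := sqr_ge0 (vq x); lra.
case: (ltrP 0 (vu x)) => hu.
  by left; split=> //; [exact: ltW | rewrite -(pmulr_rge0 _ hu)].
case: (ltrP (vu x) 0) => hu'.
  right; split=> //; rewrite !vecE; first lra.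
  by rewrite oppr_ge0 -(nmulr_rge0 _ hu').
have e : vu x = 0 by lra.
case: (lerP 0 (vv x)) => hv; first by left; split=> //; lra.
by right; split=> //; rewrite !vecE; lra.
Qed.

Lemma tfuture_future x : tfuture x -> future x.
Proof.
by move=> h; have [h1 h2] := h; have [_ h3] := (tfutureP x).1 h; split; exact: ltW.
Qed.

(** The orthogonal complement of a time-like vector is positive definite. The proof is the equality
    case of the chain of inequalities behind [future_dot]. *)
Lemma causal_dot0 s x : tfuture s -> causal x -> dot x s = 0 -> x = 0.
Proof.
move=> hs; wlog hx : x / future x => [H hx e|].
  have [fx|fx] := causal_futureN hx; first exact: H.
  apply: oppr_inj; rewrite oppr0; apply: H => //; first by case: fx.
  by rewrite dotNl e oppr0.
have [h1 h2] := hs; have [_ h3] := (tfutureP s).1 hs.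
have [hx1 ux vx] := hx => _.
rewrite dotxx in hx1; rewrite dotxx in h1.
rewrite /dot => e.
set A := vp x ^+ 2 + vq x ^+ 2 in hx1.
set B := vp s ^+ 2 + vq s ^+ 2 in h1.
pose c := vp x * vp s + vq x * vq s.
have A0 : 0 <= A by rewrite addr_ge0 ?sqr_ge0.
have B0 : 0 <= B by rewrite addr_ge0 ?sqr_ge0.
have cS : c = 2^-1 * (vu x * vv s + vu s * vv x) by rewrite /c; lra.
have cAB : c ^+ 2 <= A * B.
  by have := sqr_ge0 (vp x * vq s - vq x * vp s); rewrite /c /A /B; nra.
have cU : (vu x * vv x) * (vu s * vv s) <= c ^+ 2.
  by have := sqr_ge0 (vu x * vv s - vu s * vv x); rewrite cS; nra.
have AB : A * B <= (vu x * vv x) * B by apply: ler_wpM2r => //; lra.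
have uv0 : vu x * vv x = 0.
  apply/eqP; rewrite eq_le mulr_ge0 // andbT.
  have : (vu x * vv x) * (vu s * vv s - B) <= 0 by nra.
  by rewrite pmulr_lle0 //; lra.
have A00 : A = 0 by lra.
have c0 : c = 0 by apply/eqP; rewrite -sqrf_eq0 eq_le sqr_ge0 andbT; nra.
have us : 0 <= vu x * vv s by rewrite mulr_ge0 // ltW.
have sv : 0 <= vu s * vv x by rewrite mulr_ge0 // ltW.
move/eqP: A00; rewrite paddr_eq0 ?sqr_ge0 // !sqrf_eq0 => /andP[/eqP hp /eqP hq].
apply: vecP; rewrite vec0E //.
  have /eqP : vu x * vv s = 0 by lra.
  by rewrite mulf_eq0 (gt_eqF h3) orbF => /eqP.
have /eqP : vu s * vv x = 0 by lra.
by rewrite mulf_eq0 (gt_eqF h2) => /eqP.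
Qed.

Lemma causal_future s x : tfuture s -> causal x -> dot x s < 0 -> future x.
Proof.
move=> hs hx hd; case: (causal_futureN hx) => // /future_dot.
by move/(_ s (tfuture_future hs)); rewrite dotNl; lra.
Qed.

(** [hform x s] is -2 times the product of [x] with the isotropic vector of [s], namely (1, |z|^2,
    Re z, Im z) or (0, 1, 0, 0), which is itself future. The direct proof completes the square after
    multiplying by [vu x]. *)
Lemma future_hform x s : future x -> 0 <= hform x s.
Proof.
move=> [h hu hv]; case: s => [z|//]; rewrite /hform.
move: h; rewrite dotxx; set a := complex.Re z; set b := complex.Im z => h.
have [u0|u0] := eqVneq (vu x) 0.
  have := sqr_ge0 (vp x); have := sqr_ge0 (vq x) => hq hp.
  rewrite u0 mul0r in h.
  have /eqP : vp x ^+ 2 = 0 by lra.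
  have /eqP : vq x ^+ 2 = 0 by lra.
  by rewrite !sqrf_eq0 => /eqP -> /eqP ->; rewrite u0; lra.
have up : 0 < vu x by rewrite lt_def u0.
rewrite -(pmulr_rge0 _ up).
have := sqr_ge0 (vu x * a - vp x); have := sqr_ge0 (vu x * b - vq x).
nra.
Qed.

(** After multiplication by [vu x] the form is a sum of two squares minus the norm of [x], so a
    finite zero can only be the centre; when [vu x] is 0, only infinity is left. *)
Lemma causal_hform_inj x s t :
  causal x -> x <> 0 -> hform x s = 0 -> hform x t = 0 -> s = t.
Proof.
rewrite /causal dotxx => h x0.
have vx : vu x = 0 -> [/\ vp x = 0, vq x = 0 & vv x <> 0].
  move=> u0; have := sqr_ge0 (vp x); have := sqr_ge0 (vq x) => hq hp.
  rewrite u0 mul0r in h.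
  have /eqP : vp x ^+ 2 = 0 by lra.
  have /eqP : vq x ^+ 2 = 0 by lra.
  rewrite !sqrf_eq0 => /eqP q0 /eqP p0; split=> // v0.
  by apply: x0; apply: vecP; rewrite vec0E.
have fin (z : R[i]) : hform x (Some z) = 0 ->
    vu x <> 0 /\ z = (vp x / vu x) +i* (vq x / vu x).
  rewrite /hform; set a := complex.Re z; set b := complex.Im z => e.
  have [u0|u0] := eqVneq (vu x) 0.
    by have [p0 q0 v0] := vx u0; case: v0; rewrite -e p0 q0 u0; ring.
  split; first exact/eqP.
  have := sqr_ge0 (vu x * a - vp x); have := sqr_ge0 (vu x * b - vq x) => h1 h2.
  have e' : (vu x * a - vp x) ^+ 2 + (vu x * b - vq x) ^+ 2 =
     vp x ^+ 2 + vq x ^+ 2 - vu x * vv x.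
    by rewrite -[RHS]addr0 -(mulr0 (vu x)) -e; ring.
  have /eqP : (vu x * a - vp x) ^+ 2 = 0 by lra.
  have /eqP : (vu x * b - vq x) ^+ 2 = 0 by lra.
  rewrite !sqrf_eq0 !subr_eq0 => /eqP hb /eqP ha.
  apply/eqP; rewrite -hb -ha eq_complex /= ![vu x * _]mulrC !mulfK //.
  by rewrite !eqxx.
case: s t => [z|] [w|] //=.
- by move=> /fin[_ ->] /fin[_ ->].
- by move=> /fin[u0 _] u0'.
- by move=> u0 /fin[u0' _].
Qed.

End Lorentz.

(** * Circles and their points *)

Section Circles.
Context {R : realType}.
Implicit Types (x c d : 'rV[R]_4) (C D E : ocircle R) (z : R[i]).

Lemma hform_circle_pt c (w : R[i]) : dot c c = 1 -> vu c != 0 ->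
  complex.Re w ^+ 2 + complex.Im w ^+ 2 = 1 ->
  hform c (Some (((vp c + complex.Re w) / vu c) +i* ((vq c
    + complex.Im w) / vu c))) = 0.
Proof.
rewrite dotxx => h u0 e; rewrite /hform /=.
have -> : vv c = (vp c ^+ 2 + vq c ^+ 2 -
   (complex.Re w ^+ 2 + complex.Im w ^+ 2)) / vu c.
  by rewrite e -h opprB addrC subrK mulrC mulKf.
by field.
Qed.

(** The foot of the perpendicular from the origin, moved by [t] along the line. *)
Lemma hform_line_pt c (t : R) : dot c c = 1 -> vu c = 0 ->
  hform c (Some ((vp c * vv c / 2 - vq c * t) +i* (vq c * vv c / 2
    + vp c * t))) = 0.
Proof.
rewrite dotxx /hform /= => h u0; rewrite u0 mul0r subr0 in h; rewrite u0.
rewrite (_ : _ + _ = vv c * (1 - (vp c ^+ 2 + vq c ^+ 2))); last by field.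
by rewrite h subrr mulr0.
Qed.

Lemma two_points c : dot c c = 1 ->
  exists z z', [/\ z != z', hform c (Some z) = 0 & hform c (Some z') = 0].
Proof.
move=> h; have [u0|u0] := eqVneq (vu c) 0.
  do 2 eexists; split; last 2 first.
  - exact: (hform_line_pt 0 h u0).
  - exact: (hform_line_pt 1 h u0).
  apply/negP => /eqP[e1 e2]; move: h; rewrite dotxx u0 mul0r subr0.
  have -> : vq c = 0 by lra.
  have -> : vp c = 0 by lra.
  by rewrite expr0n addr0 => /eqP; rewrite eq_sym oner_eq0.
do 2 eexists; split; last 2 first.
- by apply: (@hform_circle_pt c (1 +i* 0) h u0); rewrite /= expr0n addr0 expr1n.
- by apply: (@hform_circle_pt c (- 1 +i* 0) h u0);
  rewrite /= expr0n addr0 sqrrN expr1n.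
apply/negP => /eqP[/(mulIf (invr_neq0 u0))]; lra.
Qed.

Lemma points_eq c d : dot c c = 1 -> dot d d = 1 ->
  (forall z, hform c (Some z) = 0 -> hform d (Some z) = 0) -> d = c \/ d = - c.
Proof.
move=> hc hd h.
suff [k hk] : exists k, d = k *: c.
  move: hd; rewrite hk !dotE hc mulr1 -expr2 => /eqP.
  rewrite sqrf_eq1 => /orP[/eqP->|/eqP->]; first by left; rewrite scale1r.
  by right; rewrite scaleN1r.
have [u0|u0] := eqVneq (vu c) 0.
  have h0 := h _ (hform_line_pt 0 hc u0).
  have h1 := h _ (hform_line_pt 1 hc u0).
  have h2 := h _ (hform_line_pt (-1) hc u0).
  rewrite dotxx u0 mul0r subr0 in hc.
  rewrite /hform /= in h0 h1 h2.
  have ud0 : vu d = 0.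
    have : vu d * (vp c ^+ 2 + vq c ^+ 2) = 0 by nra.
    by rewrite hc mulr1.
  rewrite ud0 in h0 h1 h2.
  have e1 : vp d * vq c = vq d * vp c by lra.
  exists (vp d * vp c + vq d * vq c); apply: vecP; rewrite !vecE.
  - by rewrite ud0 u0 mulr0.
  - have -> : vv d = (vp d * vp c + vq d * vq c) * vv c by lra.
    by [].
  - by rewrite -[LHS]mulr1 -hc; ring: e1.
  - by rewrite -[LHS]mulr1 -hc; ring: e1.
(* The points of the circle in the directions 1, -1, i and -i: differences over opposite pairs
   isolate [vp d] and [vq d]. *)
pose f (w : R[i]) hw := h _ (@hform_circle_pt c w hc u0 hw).
have h1 : _ := f (1 +i* 0) _; have h2 : _ := f (-1 +i* 0) _.
have h3 : _ := f (0 +i* 1) _; have h4 : _ := f (0 +i* -1) _.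
have {}h1 := h1 ltac:(rewrite /=; ring).
have {}h2 := h2 ltac:(rewrite /=; ring).
have {}h3 := h3 ltac:(rewrite /=; ring).
have {}h4 := h4 ltac:(rewrite /=; ring).
rewrite /hform /= in h1 h2 h3 h4.
have e1 : vp d = vu d / vu c * vp c.
  have : 4 * (vu d / vu c * vp c - vp d) / vu c = 0.
    have := congr2 (fun r s => r - s) h1 h2; rewrite subrr => e.
    by apply: etrans e; field.
  move/eqP; rewrite mulf_eq0 invr_eq0 (negPf u0) orbF mulf_eq0 pnatr_eq0 /=.
  by rewrite subr_eq0 => /eqP.
have e2 : vq d = vu d / vu c * vq c.
  have : 4 * (vu d / vu c * vq c - vq d) / vu c = 0.
    have := congr2 (fun r s => r - s) h3 h4; rewrite subrr => e.
    by apply: etrans e; field.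
  move/eqP; rewrite mulf_eq0 invr_eq0 (negPf u0) orbF mulf_eq0 pnatr_eq0 /=.
  by rewrite subr_eq0 => /eqP.
exists (vu d / vu c); apply: vecP; rewrite !vecE //; first by rewrite divfK.
have hv : vv c = (vp c ^+ 2 + vq c ^+ 2 - 1) / vu c.
  by move: (hc); rewrite dotxx => <-; rewrite opprB addrC subrK mulrC mulKf.
rewrite hv; apply/eqP; rewrite -subr_eq0; apply/eqP.
by apply: etrans h1; rewrite e1 e2; field.
Qed.

(* Moving z along the gradient of c, of norm 2 on the circle, enters the
   interior of c. *)
Lemma interior_near c x z : dot c c = 1 -> hform c (Some z) = 0 ->
  hform x (Some z) < 0 ->
  exists z', hform c (Some z') < 0 /\ hform x (Some z') < 0.
Proof.
case: z => a b hc c0; rewrite dotxx in hc.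
pose wa := vu c * a - vp c; pose wb := vu c * b - vq c.
pose A y := - 2 * (vu y * (a * wa + b * wb) - (vp y * wa + vq y * wb)).
pose B y := vu y * (wa ^+ 2 + wb ^+ 2).
have ex y (t : R) : hform y (Some ((a - - t * wa) +i* (b - - t * wb))) =
   hform y (Some (a +i* b)) - t * A y + t ^+ 2 * B y.
  by rewrite /hform /= /A /B; ring.
have {}ex y (t : R) : hform y (Some ((a - t * wa) +i* (b - t * wb))) =
   hform y (Some (a +i* b)) + t * A y + t ^+ 2 * B y.
  by have := ex y (- t); rewrite opprK => ->; ring.
have ww : wa ^+ 2 + wb ^+ 2 = 1.
  transitivity (vp c ^+ 2 + vq c ^+ 2 - vu c * vv c
     + vu c * hform c (Some (a +i* b))); last by rewrite hc c0; ring.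
  by rewrite /hform /= /wa /wb; ring.
have Ac : A c = - 2.
  transitivity (- 2 * (wa ^+ 2 + wb ^+ 2)); last by rewrite ww mulr1.
  by rewrite /A /wa /wb; ring.
have Bc : B c = vu c by rewrite /B ww mulr1.
set k := hform x _ => k0.
(* The step is t = - k / m^2. As t m < 1, the linear term - 2 t dominates t^2 [vu c]; as t m < - k,
   the form of [x] stays negative. *)
pose m := 1 + `|vu c| + `|B x| + `|A x| - k.
have [A1 A2] : - `|A x| <= A x /\ A x <= `|A x| by apply/andP; rewrite -ler_norml.
have [B1 B2] : - `|B x| <= B x /\ B x <= `|B x| by apply/andP; rewrite -ler_norml.
have [C1 C2] : - `|vu c| <= vu c /\ vu c <= `|vu c| by apply/andP;
  rewrite -ler_norml.
have nA := normr_ge0 (A x); have nB := normr_ge0 (B x).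
have nC := normr_ge0 (vu c).
have m1 : 1 < m by rewrite /m; lra.
have m0 : 0 < m by lra.
pose s := - k / m; pose t := s / m.
have s0 : 0 < s by rewrite divr_gt0 // oppr_gt0.
have s1 : s < 1 by rewrite ltr_pdivrMr // mul1r /m; lra.
have sk : s < - k by rewrite ltr_pdivrMr // ltr_pMr // oppr_gt0.
have t0 : 0 < t by rewrite divr_gt0.
have tm : t * m = s by rewrite /t divfK // gt_eqF.
have t1 : t < 1 by nra.
exists ((a - t * wa) +i* (b - t * wb)); rewrite !ex Ac Bc c0; split.
  have : t * vu c <= t * m by rewrite ler_wpM2l /m; lra.
  move=> h; rewrite (_ : _ + _ = t * (t * vu c - 2)); last by ring.
  by rewrite pmulr_rlt0 //; lra.
rewrite -/k; apply: (@le_lt_trans _ _ (k + t * (`|A x| + `|B x|))).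
  have : t * A x <= t * `|A x| by apply: ler_wpM2l => //; lra.
  have : t ^+ 2 * B x <= t * `|B x|.
    apply: (@le_trans _ _ (t ^+ 2 * `|B x|)); first by rewrite ler_wpM2l ?sqr_ge0.
    by rewrite ler_wpM2r // expr2 ger_pMr; lra.
  by lra.
have : t * (`|A x| + `|B x|) <= t * m by rewrite ler_wpM2l /m; lra.
lra.
Qed.

Lemma interior_nonempty c : dot c c = 1 -> exists z, hform c (Some z) < 0.
Proof.
move=> hc; have [z [_ [_ hz _]]] := two_points hc.
(* The constant form -1 makes the second condition of [interior_near] vacuous. *)
have n1 : hform (mkv 0 (-1) 0 0) (Some z) < 0.
  by rewrite /hform !mkvE !mul0r; lra.
by have [z' []] := interior_near hc hz n1; exists z'.
Qed.

Lemma hform_inj c d : dot c c = 1 -> dot d d = 1 ->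
  (forall s, hform c s < 0 <-> hform d s < 0) -> c = d.
Proof.
move=> hc hd h.
have pts z : hform c (Some z) = 0 -> hform d (Some z) = 0.
  move=> hz; apply/eqP; rewrite eq_le !leNgt; apply/andP; split; apply/negP.
    move=> lt; have lt' : hform (- d) (Some z) < 0 by rewrite hformN; lra.
    have [z' [/h h1]] := interior_near hc hz lt'.
    by rewrite hformN; lra.
  by move/h; rewrite hz ltxx.
have [//|e] := points_eq hc hd pts.
have [z hz] := interior_nonempty hc.
by have := (h (Some z)).1 hz; rewrite e hformN oppr_lt0 ltNge (ltW hz).
Qed.

Lemma oc_interior_inj : injective (@oc_interior R).
Proof.
move=> C D e; apply: vec_inj; apply: hform_inj; rewrite ?dot_vec // => s.
by rewrite -!oc_interiorE e.
Qed.

Lemma points_sign C D : oc_points C = oc_points D -> vec D = vec C \/ vec D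
  = - vec C.
Proof.
move=> e; apply: points_eq; rewrite ?dot_vec // => z.
by rewrite -!oc_pointsE e.
Qed.

Lemma point_off c x : dot c c = 1 -> future x -> x <> 0 ->
  exists z, hform c (Some z) = 0 /\ 0 < hform x (Some z).
Proof.
move=> hc hx x0; have [z [z' [zz' hz hz']]] := two_points hc.
have [e|n0] := eqVneq (hform x (Some z)) 0; last first.
  by exists z; rewrite lt_def n0 future_hform.
have [e'|n0] := eqVneq (hform x (Some z')) 0; last first.
  by exists z'; rewrite lt_def n0 future_hform.
have [hc' _ _] := hx.
have [ezz'] := causal_hform_inj hc' x0 e e'.
by rewrite ezz' eqxx in zz'.
Qed.

(** A product at least 1 means nested interiors: [c - d] or [d - c] is future, and its form compares
    the two interiors pointwise. A nonzero past sum [c + d] is negative at some point of [c]; there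
    [d] is negative, and a nearby point lies in both interiors. *)
Lemma disjoint_dot c d : dot c c = 1 -> dot d d = 1 -> c <> d ->
  dot c d <= -1 \/ 1 <= dot c d ->
  (forall s, hform c s < 0 -> hform d s < 0 -> False) ->
  dot c d <= -1 /\ future (c + d).
Proof.
move=> hc hd ne h dis.
have sub x y : dot x x = 1 -> (forall s, hform x s < 0 -> hform y s < 0 -> False) ->
    ~ future (x - y).
  move=> hx dxy fxy; have [z hz] := interior_nonempty hx.
  by apply: dxy (hz) _; have := future_hform (Some z) fxy; rewrite hformD hformN;
    lra.
have ca : ~ 1 <= dot c d.
  move=> ge1; have : causal (c - d).
    by rewrite /causal !dotE hc hd (dotC d c); lra.
  case/causal_futureN; first exact: sub.
  by rewrite opprB; apply: sub => // s h1 h2; apply: dis h2 h1.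
case: h => // h; split=> //.
have : causal (c + d) by rewrite /causal !dotE hc hd (dotC d c); lra.
case/causal_futureN => // hf.
have [->|n0] := eqVneq (c + d) 0; first by split; rewrite ?dot0l ?vec0E.
have n0' : - (c + d) <> 0 by move/eqP; rewrite oppr_eq0 (negPf n0).
have [z [hz]] := point_off hc hf n0'.
rewrite hformN hformD hz add0r => hz'.
have hz'' : hform d (Some z) < 0 by lra.
by have [z' [h1 h2]] := interior_near hc hz hz''; case: (dis _ h1 h2).
Qed.

(** The sum of the two vectors is isotropic and orthogonal to both, so the point of the sphere that
    it represents lies on both circles. Any common point is a zero of the form of the sum, hence
    unique. *)
Lemma tangent_dot C D : dot (vec C) (vec D) = -1 -> future (vec C + vec D) ->
  vec C + vec D <> 0 -> tangent C D.
Proof.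
set c := vec C; set d := vec D => e hf n0.
have [ca hu hv] := hf.
have null : dot (c + d) (c + d) = 0.
  by rewrite !dotE !dot_vec (dotC d) e; lra.
have ex : exists s, hform c s = 0 /\ hform d s = 0.
  have dc : dot c (c + d) = 0 by rewrite dotDr dot_vec e; lra.
  have dd : dot d (c + d) = 0 by rewrite dotDr dot_vec (dotC d) e; lra.
  move: null dc dd n0; set x := c + d => null dc dd n0.
  rewrite dotxx in null.
  have [u0|u0] := eqVneq (vu x) 0.
    have hp : vp x = 0 /\ vq x = 0.
      have := sqr_ge0 (vp x); have := sqr_ge0 (vq x) => h1 h2.
      rewrite u0 mul0r in null.
      have /eqP : vp x ^+ 2 = 0 by lra.
      have /eqP : vq x ^+ 2 = 0 by lra.
      by rewrite !sqrf_eq0 => /eqP q0 /eqP p0.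
    have v0 : vv x != 0.
      by apply/eqP => v0; apply: n0; apply: vecP; rewrite vec0E //; case: hp.
    exists None; rewrite /hform.
    move: dc dd; rewrite /dot u0 hp.1 hp.2 => dc dd.
    split; apply: (mulIf v0); lra.
  exists (Some ((vp x / vu x) +i* (vq x / vu x))).
  have ev : vv x = (vp x ^+ 2 + vq x ^+ 2) / vu x.
    by apply: (mulIf u0); rewrite divfK //; lra.
  split.
    rewrite -(mulr0 (-2 / vu x)) -dc /hform /dot ev /=; field; exact: u0.
  rewrite -(mulr0 (-2 / vu x)) -dd /hform /dot ev /=; field; exact: u0.
have [s [hs1 hs2]] := ex; exists s; apply/seteqP; split=> [t [ ]|t /= ->];
  last first.
  by split; rewrite oc_pointsE.
rewrite !oc_pointsE => h1 h2 /=; apply: causal_hform_inj ca n0 _ _.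
  by rewrite hformD h1 h2 addr0.
by rewrite hformD hs1 hs2 addr0.
Qed.

Lemma tangent_neq C D : tangent C D -> vec D <> vec C /\ vec D <> - vec C.
Proof.
move=> [s hs].
have [z [z' [zz' hz hz']]] := two_points (dot_vec C).
have aux : ~ (oc_points D = oc_points C).
  move=> e; move: hs; rewrite e setIid => hs.
  have h1 : [set s] (Some z) by rewrite -hs oc_pointsE.
  have h2 : [set s] (Some z') by rewrite -hs oc_pointsE.
  by move: h2; rewrite -h1 /= => -[/esym e']; rewrite e' eqxx in zz'.
split=> e; apply: aux; apply/seteqP; split=> t; rewrite !oc_pointsE e ?hformN //.
  by move/eqP; rewrite oppr_eq0 => /eqP.
by move=> ->; rewrite oppr0.
Qed.

End Circles.

(** * Moebius transformations *)

Section Mobius.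
Context {R : realType}.
Implicit Types (x y c d : 'rV[R]_4) (C D E : ocircle R) (z : R[i]) (M N
  : 'M[R[i]]_2).

Definition vb x : R[i] := vp x +i* vq x.

Definition nsq z : R := complex.Re z ^+ 2 + complex.Im z ^+ 2.

Lemma nsqE z : (nsq z)%:C = z * z^*.
Proof.
by case: z => a b; apply/eqP; rewrite eq_complex /= /nsq /=; apply/andP; split;
  apply/eqP; ring.
Qed.

Lemma nsq_gt0 z : z != 0 -> 0 < nsq z.
Proof.
move=> z0; rewrite lt_def addr_ge0 ?sqr_ge0 // andbT.
apply: contra_neq z0 => h; have := nsqE z.
by rewrite h => /esym/eqP; rewrite mulf_eq0 fmorph_eq0 orbb => /eqP.
Qed.

Lemma det2 M : \det M = M 0 0 * M 1 1 - M 0 1 * M 1 0.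
Proof.
rewrite (expand_det_row _ ord0) !big_ord_recl big_ord0 addr0 /cofactor !det_mx11.
rewrite !mxE /= expr0 expr1 mul1r mulN1r mulrN.
by congr (M _ _ * M _ _ - M _ _ * M _ _); apply: val_inj.
Qed.

(** The hermitian form of [x] in homogeneous coordinates (n : d), where infinity needs no separate
    case. *)
Definition hq x (n d : R[i]) : R[i] :=
  (vu x)%:C * n * n^* - (vb x)^* * n * d^* - vb x * n^* * d + (vv x)%:C * d * d^*.

(* The action on circles of the map of matrix M, scaled by the norm of the
   determinant of M. *)
Definition mact M x : 'rV[R]_4 :=
  let u := (vu x)%:C in let v := (vv x)%:C in let b := vb x in
  let w := u * (M 1 1)^* * M 0 1 + b * (M 1 1)^* * M 0 0
           + b^* * M 0 1 * (M 1 0)^* + v * (M 1 0)^* * M 0 0 in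
  mkv (complex.Re (u * M 1 1 * (M 1 1)^* + b^* * M 1 1 * (M 1 0)^*
           + b * (M 1 1)^* * M 1 0 + v * M 1 0 * (M 1 0)^* ))
      (complex.Re (u * M 0 1 * (M 0 1)^* + b^* * M 0 1 * (M 0 0)^*
           + b * (M 0 1)^* * M 0 0 + v * M 0 0 * (M 0 0)^* ))
      (complex.Re w) (complex.Im w).

Lemma ReC_eq (w : R[i]) : w^* = w -> (complex.Re w)%:C = w.
Proof.
case: w => a b /eqP; rewrite eq_complex /= => /andP[_ /eqP e].
by apply/eqP; rewrite eq_complex /= eqxx /=; apply/eqP; lra.
Qed.

Lemma conjR (r : R) : (r%:C)^* = r%:C :> R[i].
Proof. exact: conjc_real. Qed.

Lemma conjD (z w : R[i]) : (z + w)^* = z^* + w^*.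
Proof. exact: rmorphD. Qed.

Lemma conjN (z : R[i]) : (- z)^* = - z^*.
Proof. exact: rmorphN. Qed.

Lemma conjM (z w : R[i]) : (z * w)^* = z^* * w^*.
Proof. exact: rmorphM. Qed.

Definition conjE := (conjD, conjN, conjM, @conjCK R[i], conjR).

Lemma vu_mact M x : (vu (mact M x))%:C =
  (vu x)%:C * M 1 1 * (M 1 1)^* + (vb x)^* * M 1 1 * (M 1 0)^*
           + (vb x) * (M 1 1)^* * M 1 0 + (vv x)%:C * M 1 0 * (M 1 0)^*.
Proof. rewrite mkvE ReC_eq // !conjE; ring. Qed.

Lemma vv_mact M x : (vv (mact M x))%:C =
  (vu x)%:C * M 0 1 * (M 0 1)^* + (vb x)^* * M 0 1 * (M 0 0)^*
           + (vb x) * (M 0 1)^* * M 0 0 + (vv x)%:C * M 0 0 * (M 0 0)^*.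
Proof. by rewrite mkvE ReC_eq // !conjE; ring. Qed.

Lemma vb_mact M x : vb (mact M x) =
  (vu x)%:C * (M 1 1)^* * M 0 1 + vb x * (M 1 1)^* * M 0 0
           + (vb x)^* * M 0 1 * (M 1 0)^* + (vv x)%:C * (M 1 0)^* * M 0 0.
Proof. by rewrite /vb !mkvE; case: (X in complex.Re X). Qed.

Lemma hq_mact M x (n d : R[i]) :
  hq (mact M x) (M 0 0 * n + M 0 1 * d) (M 1 0 * n + M 1 1 * d) =
  \det M * (\det M)^* * hq x n d.
Proof.
rewrite det2 /hq vu_mact vv_mact vb_mact !conjE; ring.
Qed.

Lemma hqE x (n d : R[i]) : d != 0 -> hq x n d = (nsq d * hform x (Some (n / d)))%:C.
Proof.
move=> d0; have hz z : (hform x (Some z))%:C = hq x z 1.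
  rewrite /hform /hq /vb; case: z => a b /=; apply/eqP.
  by rewrite eq_complex /=; apply/andP; split; apply/eqP; ring.
rewrite rmorphM /= nsqE hz /hq fmorph_div !rmorph1 /=; field.
by rewrite d0 fmorph_eq0 d0.
Qed.

Lemma hqE0 x (n : R[i]) : hq x n 0 = (nsq n * hform x None)%:C.
Proof. by rewrite rmorphM /= nsqE /hq rmorph0 /=; ring. Qed.

(* mact M x, up to a positive factor at each point, is the form x pulled back
   by the inverse of M. *)
Lemma hform_mobius M x s : \det M != 0 ->
  exists2 k, 0 < k & hform (mact M x) (mobius M s) = k * hform x s.
Proof.
move=> dM; have pdM := nsq_gt0 dM.
pose n := if s is Some z then z else 1.
pose d : R[i] := if s is Some _ then 1 else 0.
have [l l0 hl] : exists2 l, 0 < l & hq x n d = (l * hform x s)%:C.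
  rewrite /n /d; case: s {n d} => [z|].
    by exists (nsq 1); rewrite ?nsq_gt0 ?oner_neq0 // hqE ?oner_neq0 // divr1.
  by exists (nsq 1); rewrite ?nsq_gt0 ?oner_neq0 // hqE0.
pose n' := M 0 0 * n + M 0 1 * d; pose d' := M 1 0 * n + M 1 1 * d.
have hs : mobius M s = if d' == 0 then None else Some (n' / d').
  by rewrite /n' /d' /n /d; case: (s) => [z|] /=; rewrite !(mulr1, mulr0, addr0).
have := hq_mact M x n d; rewrite -/n' -/d' -nsqE hl -rmorphM /=.
have nd : d' = 0 -> n' != 0.
  move=> d0; apply: contraNneq dM => n0.
  have h1 : M 1 1 * n' - M 0 1 * d' = \det M * n by rewrite det2 /n' /d'; ring.
  have h2 : M 0 0 * d' - M 1 0 * n' = \det M * d by rewrite det2 /n' /d'; ring.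
  rewrite n0 d0 !mulr0 subrr in h1 h2.
  move/esym/eqP: h1; rewrite mulf_eq0 => /orP[//|].
  move/esym/eqP: h2; rewrite mulf_eq0 => /orP[//|].
  by rewrite /n /d; case: (s) => [z|]; rewrite ?oner_eq0.
rewrite hs; case: eqP => [d0|/eqP d0].
  rewrite d0 hqE0 => /complexI h; exists (nsq (\det M) * l / nsq n').
    by rewrite divr_gt0 ?mulr_gt0 ?nsq_gt0 // nd.
  apply: (mulfI (lt0r_neq0 (nsq_gt0 (nd d0)))); rewrite h.
  by field; rewrite gt_eqF // nsq_gt0 // nd.
rewrite hqE // => /complexI h; exists (nsq (\det M) * l / nsq d').
  by rewrite divr_gt0 ?mulr_gt0 ?nsq_gt0.
apply: (mulfI (lt0r_neq0 (nsq_gt0 d0))); rewrite h.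
by field; rewrite gt_eqF // nsq_gt0.
Qed.

Lemma mobius_comp M N s : \det M != 0 -> \det N != 0 ->
  mobius M (mobius N s) = mobius (M *m N) s.
Proof.
move=> dM dN.
have E i j : (M *m N) i j = M i 0 * N 0 j + M i 1 * N 1 j.
  rewrite mxE !big_ord_recl big_ord0 addr0.
  by congr (_ + M _ _ * N _ _); apply: val_inj.
pose n := if s is Some z then z else 1.
pose d : R[i] := if s is Some _ then 1 else 0.
(* The action in homogeneous coordinates (m : e); the hypothesis only excludes (0 : 0). *)
have mE (L : 'M[R[i]]_2) (m e : R[i]) : L 1 0 * m
  + L 1 1 * e != 0 \/ e != 0 \/ m != 0 ->
  mobius L (if e == 0 then None else Some (m / e)) = 
  if L 1 0 * m + L 1 1 * e == 0 then None else
   Some ((L 0 0 * m + L 0 1 * e) / (L 1 0 * m + L 1 1 * e)).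
  move=> h; case: eqP => [d0|/eqP d0].
    rewrite d0 in h *; rewrite !mulr0 !addr0 /mobius.
    have n0 : m != 0.
      case: h => [|[]] //; last by rewrite eqxx.
      by apply: contraNneq => ->; rewrite !mulr0 addr0.
    rewrite mulf_eq0 (negPf n0) orbF; case: eqP => // /eqP L0.
    by congr Some; field; rewrite L0 n0.
  rewrite /mobius; have -> : L 1 0 * (m / e) + L 1 1 = (L 1 0 * m + L 1 1 * e) / e.
    by field.
  rewrite mulf_eq0 invr_eq0 (negPf d0) orbF; case: eqP => // /eqP L0.
  by congr Some; field; rewrite L0 d0.
have hs : s = if d == 0 then None else Some (n / d).
  by rewrite /n /d; case: s {n d} => [z|]; rewrite ?eqxx // oner_eq0 divr1.
have nd : d != 0 \/ n != 0.
  by rewrite /n /d; case: s {n d hs} => [z|]; rewrite oner_eq0; [left|right].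
have nM : M 1 0 * (N 0 0 * n + N 0 1 * d) + M 1 1 * (N 1 0 * n + N 1 1 * d) != 0
    \/ N 1 0 * n + N 1 1 * d != 0 \/ N 0 0 * n + N 0 1 * d != 0.
  right; have [d0|] := eqVneq (N 1 0 * n + N 1 1 * d) 0; last by left.
  right; apply: contraNneq dN => n0.
  have h1 : N 1 1 * (N 0 0 * n + N 0 1 * d) - N 0 1 * (N 1 0 * n + N 1 1 * d)
     = \det N * n by rewrite det2; ring.
  have h2 : N 0 0 * (N 1 0 * n + N 1 1 * d) - N 1 0 * (N 0 0 * n + N 0 1 * d)
     = \det N * d by rewrite det2; ring.
  rewrite n0 d0 !mulr0 subrr in h1 h2.
  move/esym/eqP: h1; rewrite mulf_eq0 => /orP[//|]; move/esym/eqP: h2.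
  by rewrite mulf_eq0 => /orP[//|]; case: nd => /negPf ->.
have nE L := mE L n d (or_intror nd).
have := nE (M *m N); have := nE N; rewrite -hs => -> ->.
rewrite (mE M _ _ nM) !E.
by congr (if _ == 0 then _ else Some (_ / _)); ring.
Qed.

Lemma mobius1 s : mobius (1%:M : 'M[R[i]]_2) s = s.
Proof.
by case: s => [z|]; rewrite /mobius !mxE /= ?eqxx // mul0r add0r oner_eq0 mul1r addr0 divr1.
Qed.

Lemma mobius_inv M s : \det M != 0 -> mobius M (mobius (invmx M) s) = s.
Proof.
move=> dM; have uM : M \in unitmx by rewrite unitmxE unitfE.
rewrite mobius_comp //; first by rewrite mulmxV // mobius1.
by rewrite det_inv invr_eq0.
Qed.

(** Up to sign, [dot] is the polarised determinant of hermitian matrices, on which [mact M] acts by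
    congruence with the adjugate of [M]. *)
Lemma dot_mact M x y : dot (mact M x) (mact M y) = nsq (\det M) * dot x y.
Proof.
have E x' y' : (dot x' y')%:C = - (2^-1 * ((vu x')%:C * (vv y')%:C)) - 2^-1 *
  ((vu y')%:C * (vv x')%:C) + 2^-1 * (vb x' * (vb y')^* + (vb x')^* * vb y').
  apply/eqP; rewrite -!rmorphM /= /dot /vb.
  have -> : 2^-1 = (2^-1)%:C :> R[i] by rewrite fmorphV /= rmorph_nat.
  by rewrite eq_complex /=; apply/andP; split; apply/eqP; field.
apply: complexI; rewrite rmorphM /= nsqE !E !vu_mact !vv_mact !vb_mact det2 !conjE.
by field.
Qed.

End Mobius.

(** * Maps acting on circles *)

Section CircleMaps.
Context {R : realType}.
Implicit Types (x y c d : 'rV[R]_4) (C D E : ocircle R) (z e t : R[i]).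

(* A induces the action of f on circles: it pulls the sign of hermitian forms
   back along f. *)
Definition circle_map (f : sphere R -> sphere R) (A : 'rV[R]_4 -> 'rV[R]_4) :=
  [/\ forall s', exists s, f s = s',
      forall x s, exists2 k, 0 < k & hform (A x) (f s) = k * hform x s &
      forall x y, dot (A x) (A y) = dot x y].

Lemma circle_map_comp f g A B : circle_map f A -> circle_map g B ->
  circle_map (g \o f) (B \o A).
Proof.
move=> [fs fk fd] [gs gk gd]; split=> [s'|x s|x y] /=.
- by have [s1 h1] := gs s'; have [s h] := fs s1; exists s; rewrite /= h h1.
- have [k k0 hk] := fk x s; have [l l0 hl] := gk (A x) (f s).
  by exists (l * k); rewrite ?mulr_gt0 // hl hk mulrA.
- by rewrite gd fd.
Qed.

Lemma circle_map_interior f A C D : circle_map f A -> vec D = A (vec C) ->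
  is_image f C D.
Proof.
move=> [fs fk fd] h; rewrite /is_image; apply/seteqP; split=> s.
  rewrite oc_interiorE h => hs; have [s1 h1] := fs s; exists s1 => //.
  have [k k0 hk] := fk (vec C) s1.
  by rewrite oc_interiorE -(pmulr_rlt0 _ k0) -hk h1.
move=> [s1 + <-]; rewrite !oc_interiorE h; have [k k0 ->] := fk (vec C) s1.
by rewrite pmulr_rlt0.
Qed.

Lemma circle_map_points f A C D : circle_map f A -> vec D = A (vec C) ->
  oc_points D = f @` oc_points C.
Proof.
move=> [fs fk fd] h; apply/seteqP; split=> s.
  rewrite oc_pointsE h => hs; have [s1 h1] := fs s; exists s1 => //.
  have [k k0 hk] := fk (vec C) s1.
  by rewrite oc_pointsE; apply: (mulfI (lt0r_neq0 k0)); rewrite -hk h1 mulr0.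
move=> [s1 + <-]; rewrite !oc_pointsE h; have [k k0 ->] := fk (vec C) s1.
by move=> ->; rewrite mulr0.
Qed.

Lemma circle_map_vec f A C : circle_map f A -> exists D, vec D = A (vec C).
Proof. by move=> [_ _ fd]; apply: vec_surj; rewrite fd dot_vec. Qed.

Lemma is_imageP f A C D : circle_map f A ->
  is_image f C D <-> vec D = A (vec C).
Proof.
move=> hf; split=> [h|]; last exact: circle_map_interior.
have [D' hD'] := circle_map_vec C hf.
rewrite -hD'; congr vec; apply: oc_interior_inj; rewrite h.
by apply/esym; apply: circle_map_interior hf hD'.
Qed.

Lemma image_circlesP f A (P : set (ocircle R)) : circle_map f A ->
  image_circles f P = [set D | exists2 C, P C & vec D = A (vec C)].
Proof.
move=> hf; apply/seteqP; split=> D [C PC h]; exists C => //.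
  exact/(is_imageP _ _ hf).
exact/(is_imageP _ _ hf).
Qed.

Lemma image_circles_comp f g A B (P : set (ocircle R)) :
  circle_map f A -> circle_map g B ->
  image_circles g (image_circles f P) = image_circles (g \o f) P.
Proof.
move=> hf hg; have hgf := circle_map_comp hf hg.
rewrite (image_circlesP _ hf) (image_circlesP _ hg) (image_circlesP _ hgf).
apply/seteqP; split=> D [C].
  by move=> [C' PC' h] h'; exists C' => //=; rewrite h' h.
move=> PC h; have [C' hC'] := circle_map_vec C hf.
by exists C'; [exists C | rewrite hC'].
Qed.

Lemma circle_map_mobius (M : 'M[R[i]]_2) : nsq (\det M) = 1 ->
  circle_map (mobius M) (mact M).
Proof.
move=> h; have d0 : \det M != 0.
  by apply: contra_eq_neq h => ->; rewrite /nsq /= expr0n addr0 eq_sym oner_neq0.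
split=> [s'|x s|x y]; last by rewrite dot_mact h mul1r.
  by exists (mobius (invmx M) s'); rewrite mobius_inv.
exact: hform_mobius.
Qed.

(** The action on circles of z |-> e z + t, for e of modulus 1. *)
Definition simil e t x : 'rV[R]_4 :=
  let p := complex.Re e * vp x - complex.Im e * vq x in
  let q := complex.Im e * vp x + complex.Re e * vq x in
  mkv (vu x)
      (vv x + 2 * (complex.Re t * p + complex.Im t * q) + nsq t * vu x)
      (p + complex.Re t * vu x) (q + complex.Im t * vu x).

Definition conjv x : 'rV[R]_4 := mkv (vu x) (vv x) (vp x) (- vq x).

Definition scalev (r : R) x : 'rV[R]_4 := mkv (vu x / r) (r * vv x) (vp x) (vq x).

Lemma similD e t x y : simil e t (x + y) = simil e t x + simil e t y.
Proof. by apply: vecP; rewrite !vecE; ring. Qed.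

Lemma similZ e t r x : simil e t (r *: x) = r *: simil e t x.
Proof. by apply: vecP; rewrite !vecE; ring. Qed.

Lemma conjvD x y : conjv (x + y) = conjv x + conjv y.
Proof. by apply: vecP; rewrite !vecE; ring. Qed.

Lemma conjvZ r x : conjv (r *: x) = r *: conjv x.
Proof. by apply: vecP; rewrite !vecE; ring. Qed.

Lemma scalevD r x y : scalev r (x + y) = scalev r x + scalev r y.
Proof. by apply: vecP; rewrite !vecE; ring. Qed.

Lemma nsq_norm e : `|e| = 1 <-> nsq e = 1.
Proof.
have h : `|e| ^+ 2 = (nsq e)%:C by rewrite nsqE normCK.
split=> he; first by apply: complexI; rewrite -h he expr1n.
by apply/eqP; rewrite -(eqrXn2 (n := 2)) // h he expr1n.
Qed.

Lemma circle_map_simil e t : nsq e = 1 ->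
  circle_map (omap (fun z => e * z + t)) (simil e t).
Proof.
move=> he; have e0 : e != 0.
  by apply: contra_eq_neq he => ->; rewrite /nsq /= expr0n addr0 eq_sym oner_neq0.
split=> [[z|]|x s|x y].
- exists (Some ((z - t) / e)) => /=; congr Some; field; exact: e0.
- by exists None.
- exists 1 => //; rewrite mul1r; case: s => [[a b]|];
  rewrite /hform /= /simil ?mkvE //.
  move: he; rewrite /nsq; case: e {e0} => e1 e2; case: t => t1 t2 /= he.
  set lhs := LHS.
  transitivity (lhs + (1 - (e1 ^+ 2 + e2 ^+ 2)) * (vu x * (a ^+ 2
    + b ^+ 2) - 2 * (vp x * a + vq x * b))).
    by rewrite he subrr mul0r addr0.
  by rewrite /lhs; ring.
- rewrite /dot /simil !mkvE; move: he; rewrite /nsq; case: e {e0} => e1 e2;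
  case: t => t1 t2 /= he.
  set lhs := LHS.
  transitivity (lhs + (1 - (e1 ^+ 2 + e2 ^+ 2)) * (vp x * vp y + vq x * vq y)).
    by rewrite he subrr mul0r addr0.
  by rewrite /lhs; field.
Qed.

Lemma circle_map_conj : circle_map (omap (fun z => z^*)) conjv.
Proof.
split=> [[z|]|x s|x y].
- by exists (Some (z^*)); rewrite /= conjCK.
- by exists None.
- exists 1 => //; rewrite mul1r; case: s => [[a b]|];
  rewrite /hform /= /conjv ?mkvE //.
  by ring.
- by rewrite /dot /conjv !mkvE; ring.
Qed.

Lemma circle_map_scale (r : R) : 0 < r ->
  circle_map (omap (fun z => r%:C * z)) (scalev r).
Proof.
move=> r0; have rn := lt0r_neq0 r0.
have rC : r%:C != 0 :> R[i] by rewrite fmorph_eq0.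
split=> [[z|]|x s|x y].
- exists (Some (z / r%:C)) => /=; congr Some; field; exact: rC.
- by exists None.
- case: s => [[a b]|]; rewrite /hform /= /scalev !mkvE.
    by exists r => //; field.
  by exists r^-1; rewrite ?invr_gt0 // mulrC.
- by rewrite /dot /scalev !mkvE; field.
Qed.

Lemma circle_map_ext f g A B : f =1 g -> (forall x, A x = B x) ->
  circle_map f A -> circle_map g B.
Proof. by move=> /funext -> /funext ->. Qed.

(** Inversion is the Lorentz reflection in the vector of [D]; it is conjugation followed by a
    Moebius map of determinant -1. *)
Lemma circle_map_inversion D :
  circle_map (inversion D) (fun x => x - (2 * dot x (vec D)) *: vec D).
Proof.
set M : 'M[R[i]]_2 := \matrix_(i, j) (if (i == 0) && (j == 0) then curv_centre D
                         else if i == 0 then - (cocurv D)%:C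
                         else if j == 0 then (curv D)%:C
                         else - (curv_centre D)^* ).
have hD := ocircleP D.
have dM : \det M = -1.
  by rewrite det2 !mxE /= mulrN curv_centre_norm; ring.
have hM : nsq (\det M) = 1 by rewrite dM /nsq /=; ring.
apply: circle_map_ext (circle_map_comp circle_map_conj
  (circle_map_mobius hM)) => //= x.
rewrite {dM hM}/M.
case: D hD => u v p q hh /=; rewrite /curv_centre /= => hD.
have {}hD : p ^+ 2 = 1 - q ^+ 2 + u * v by lra.
apply: vecP; rewrite !vecE /dot /mact /conjv /vb /vec !mxE /= !mkvE /=;
  by field: hD.
Qed.

End CircleMaps.

(** * Wheels and swaps *)

Definition nb (V : zmodType) (w : 'I_4 -> V) (i : 'I_4) : V :=
  \sum_(k : 'I_4 | odd (i + k)%N) w k.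

(** Stated over any additive group, so that the same operation serves for vectors, for their
    products with a fixed vector, and for integer curvatures. [nb] sums the two neighbours in the
    cycle 0, 1, 2, 3. *)
Definition gswap (V : zmodType) (i : 'I_4) (w : 'I_4 -> V) (j : 'I_4) : V :=
  if j == i then nb w i *+ 2 - w i else w j.

Definition opp4 (i : 'I_4) : 'I_4 := inord ((i + 2) %% 4).

Lemma opp4E : (opp4 i0 = i2) * (opp4 i1 = i3) * (opp4 i2 = i0) * (opp4 i3 = i1).
Proof. by do !split; apply: val_inj; rewrite /opp4 /= inordK. Qed.

Lemma nbE (V : zmodType) (w : 'I_4 -> V) :
  (nb w i0 = w i1 + w i3) * (nb w i1 = w i0 + w i2) *
  (nb w i2 = w i1 + w i3) * (nb w i3 = w i0 + w i2).
Proof.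
by do !split; rewrite /nb big_mkcond sum4 /= ?add0r ?addr0.
Qed.

Lemma gswapK (V : zmodType) (i : 'I_4) (w : 'I_4 -> V) : gswap i (gswap i w) = w.
Proof.
apply/funext => j; rewrite /gswap; case: eqP => [->|//].
rewrite eqxx opprB addrCA.
rewrite [nb (fun j => _) i](_ : _ = nb w i); first by rewrite subrr addr0.
apply: eq_bigr => k; case: eqP => // ->; by rewrite addnn odd_double.
Qed.

Lemma gswapC (V : zmodType) (i : 'I_4) (w : 'I_4 -> V) :
  gswap i (gswap (opp4 i) w) = gswap (opp4 i) (gswap i w).
Proof.
apply/funext; apply: ord4_ind; move: i; apply: ord4_ind;
  by rewrite /gswap !opp4E /= ?nbE /= ?nbE.
Qed.

Lemma odd_opp4 (i : 'I_4) : odd (opp4 i) = odd i.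
Proof. by move: i; apply: ord4_ind; rewrite !opp4E. Qed.

Lemma odd_eq4 (i j : 'I_4) : odd i = odd j -> j = i \/ j = opp4 i.
Proof. by move: i j; apply: ord4_ind; apply: ord4_ind; rewrite ?opp4E //=;
  auto. Qed.

Section Wheels.
Context {R : realType}.
Implicit Types (x y c d : 'rV[R]_4) (C D E : ocircle R) (w : 'I_4 -> 'rV[R]_4).
Implicit Types (W : 'I_4 -> ocircle R).

Definition gram_coef (i j : 'I_4) : R :=
  if i == j then 1 else if odd (i + j)%N then -1 else -2.

Definition gram w := forall i j, dot (w i) (w j) = gram_coef i j.

Definition sgm w := \sum_i w i.

Definition gwheel w := gram w /\ 0 < vu (sgm w).

Lemma vu_sum w : vu (sgm w) = \sum_i vu (w i).
Proof. by rewrite /sgm /vu summxE. Qed.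

Lemma wheelP W : wheel W <-> gwheel (vec \o W).
Proof.
rewrite /wheel /gwheel vu_sum.
have -> : \sum_i vu ((vec \o W) i) = \sum_i curv (W i).
  by apply: eq_bigr => i _; rewrite /= mkvE.
split=> -[h1 h2]; split=> // i j; first by rewrite /= -oc_prodE; exact: h2.
by rewrite oc_prodE; exact: h1.
Qed.

(** The Gram matrix of a wheel has inverse (I - N) / 3, with N the adjacency matrix of the 4-cycle;
    hence the dual basis is (w i - nb w i) / 3. *)
Definition coef w x i : R := 3^-1 * (dot x (w i) - nb (fun k => dot x (w k)) i).

Lemma expand w x : gram w -> x = \sum_i coef w x i *: w i.
Proof.
move=> gw.
pose A := \matrix_(i, j) w i ord0 j : 'M[R]_4.
pose J := \matrix_(i, j) (if (i == i0) && (j == i1) then - 2^-1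
   else if (i == i1) && (j == i0) then - 2^-1
   else if (i == i2) && (j == i2) then 1
   else if (i == i3) && (j == i3) then 1 else 0) : 'M[R]_4.
pose K := \matrix_(i, j) (if i == j then 3^-1
   else if odd (i + j)%N then - 3^-1 else 0) : 'M[R]_4.
have JA y i : (y *m (J *m A^T)) ord0 i = dot y (w i).
  rewrite mulmxA mxE sum4 !mxE !sum4 !mxE /= /dot /vu /vv /vp /vq; ring.
have AJA i j : (A *m (J *m A^T)) i j = gram_coef i j.
  rewrite -gw -JA !mxE; apply: eq_bigr => k _; rewrite !mxE; congr (_ * _).
have one : A *m (J *m A^T *m K) = 1%:M.
  rewrite mulmxA; apply/matrixP => i j; rewrite mxE sum4 !AJA !mxE.
  by move: i j; apply: ord4_ind; apply: ord4_ind; rewrite /gram_coef /=; field.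
(* A right inverse of a square matrix is a left inverse: this is where the four vectors become a
   basis. *)
have := mulmx1C one => one'.
have ck k : (x *m (J *m A^T *m K)) ord0 k = coef w x k.
  rewrite mulmxA mxE sum4 !JA /coef.
  by move: k; apply: ord4_ind; rewrite nbE !mxE /=; field.
rewrite -[LHS]mulmx1 -one' mulmxA; apply/rowP => j.
rewrite mxE summxE; apply: eq_bigr => k _.
by rewrite ck !mxE.
Qed.

Lemma sum_coef w x : gram w -> dot x (sgm w) = -3 * \sum_i coef w x i.
Proof.
move=> gw; rewrite {1}(expand x gw) dot_suml mulr_sumr; apply: eq_bigr => i _.
rewrite dotZl dot_sumr sum4 !gw mulrC.
by move: i; apply: ord4_ind; rewrite /gram_coef /=; congr (_ * _); ring.
Qed.

(** With [x] the isotropic vector of infinity this is the Descartes-type relation between the four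
    curvatures; with [x] of norm 1 it ends the descent of [orbit_not_neg]. *)
Lemma dot_expand w x : gram w ->
  3 * dot x x = dot x (w i0) ^+ 2 + dot x (w i1) ^+ 2 + dot x (w i2) ^+ 2
    + dot x (w i3) ^+ 2
    - 2 * (dot x (w i0) + dot x (w i2)) * (dot x (w i1) + dot x (w i3)).
Proof.
by move=> gw; rewrite {2}(expand x gw) dot_sumr sum4 !dotZr /coef !nbE; field.
Qed.

Lemma dot_inj w x y : gram w -> (forall i, dot x (w i) = dot y (w i)) -> x = y.
Proof.
move=> gw h; rewrite (expand x gw) (expand y gw); apply: eq_bigr => i _.
congr (_ *: _); rewrite /coef h; congr (_ * (_ - _)).
by apply: eq_bigr => j _; rewrite h.
Qed.

Lemma gram_gswap i w : gram w -> gram (gswap i w).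
Proof.
move=> gw; suff h (j k : 'I_4) : (j <= k)%N -> dot (gswap i w j)
  (gswap i w k) = gram_coef j k.
  move=> j k; have [/h//|/ltnW/h] := leqP j k.
  by rewrite dotC => ->; rewrite /gram_coef eq_sym addnC.
move: i j k; do 3 apply: ord4_ind => //; move=> _;
  rewrite /gswap /= ?nbE ?mulr2n ?dotE ?gw /gram_coef //=; ring.
Qed.

Lemma sgm_gram w : gram w -> dot (sgm w) (sgm w) = -12.
Proof.
move=> gw; rewrite /sgm dot_suml sum4 !dot_sumr !sum4 !gw /gram_coef /=; ring.
Qed.

Lemma dot_sgm w i : gram w -> dot (w i) (sgm w) = -3.
Proof.
move=> gw; rewrite /sgm dot_sumr sum4 !gw; move: i.
by apply: ord4_ind; rewrite /gram_coef /=; ring.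
Qed.

Lemma gwheel_tfuture w : gwheel w -> tfuture (sgm w).
Proof. by move=> [gw h]; split=> //; rewrite sgm_gram //; lra. Qed.

Lemma sgm_gswap i w : sgm (gswap i w) = sgm w + (nb w i - w i) *+ 2.
Proof.
rewrite /sgm !sum4; move: i.
apply: ord4_ind; rewrite /gswap /= nbE; apply: vecP; rewrite ?mulr2n !vecE; ring.
Qed.

Lemma dot_sgm_gswap i w : gram w -> dot (sgm (gswap i w)) (sgm w) = -18.
Proof.
move=> gw; rewrite sgm_gswap mulr2n !dotE sgm_gram // dot_sgm //.
have -> : dot (nb w i) (sgm w) = -6.
  by move: i; apply: ord4_ind; rewrite nbE dotE !dot_sgm //; ring.
ring.
Qed.

(** The sums of the two wheels are time-like with product -18, so they lie in the same half of the
    cone and the curvature sum stays positive. *)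
Lemma gwheel_gswap i w : gwheel w -> gwheel (gswap i w).
Proof.
move=> hw; have [gw _] := hw; split; first exact: gram_gswap.
have gw' := gram_gswap i gw.
have : dot (sgm (gswap i w)) (sgm w) < 0 by rewrite dot_sgm_gswap //; lra.
have ca : causal (sgm (gswap i w)) by rewrite /causal sgm_gram //; lra.
move/(causal_future (gwheel_tfuture hw) ca) => [h1 h2 h3].
rewrite lt_def h2 andbT; apply/eqP => u0.
move: (sgm_gram gw'); rewrite dotxx u0 mul0r subr0.
by have := sqr_ge0 (vp (sgm (gswap i w)));
  have := sqr_ge0 (vq (sgm (gswap i w))); lra.
Qed.

Lemma oc_choice w : gram w -> exists W, vec \o W = w.
Proof.
move=> gw.
have h i : exists C, vec C = w i.
  by apply: vec_surj; rewrite gw /gram_coef eqxx.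
have [W hW] := choice h; exists W; exact/funext.
Qed.

(* A vector orthogonal to all w j but w i is a multiple of w i - nb w i, as
   this is the i-th vector of the dual basis up to a factor 3. *)
Lemma swapP i W W' : gram (vec \o W) ->
  swap i W W' <-> vec \o W' = gswap i (vec \o W).
Proof.
set w := vec \o W => gw; split.
  move=> [h [D hD /(is_imageP _ _ (circle_map_inversion D)) h']].
  apply/funext => j; rewrite /gswap /=; case: eqP => [->|/eqP/h -> //].
  rewrite h'; set d := vec D.
  have hd j' : j' != i -> dot d (w j') = 0 by move/hD; rewrite oc_prodE.
  pose k := 3^-1 * dot d (w i).
  have ed : d = k *: (w i - nb w i).
    suff ex i' : (forall j', j' != i' -> dot d (w j') = 0) ->
      d = (3^-1 * dot d (w i')) *: (w i' - nb w i') by exact: ex.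
    move=> {}hd; rewrite {1}(expand d gw) sum4 /coef.
    move: i' hd; apply: ord4_ind => hd; rewrite !nbE;
      [rewrite (hd i1 isT) (hd i2 isT) (hd i3 isT)
      |rewrite (hd i0 isT) (hd i2 isT) (hd i3 isT)
      |rewrite (hd i0 isT) (hd i1 isT) (hd i3 isT)
      |rewrite (hd i0 isT) (hd i1 isT) (hd i2 isT)];
      apply: vecP; rewrite !vecE; ring.
  (* As [nb w i] is orthogonal to [d], the norm of [d] is k times its product with [w i], that is 3
     k^2. *)
  have kk : k ^+ 2 = 3^-1.
    have := dot_vec D; rewrite -/d {1}ed dotZl dotDl dotNl.
    have -> : dot (nb w i) d = 0.
      by rewrite dot_suml big1 // => m hm; rewrite dotC hd //;
        apply: contraL hm => /eqP ->; rewrite addnn odd_double.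
    rewrite (dotC (w i)) subr0 /k => h1; lra.
  rewrite (_ : 2 * dot _ d = 6 * k); last by rewrite (dotC _ d) /k; field.
  rewrite ed scalerA -mulrA -expr2 kk -[vec (W i)]/(w i).
  by apply: vecP; rewrite ?mulr2n !vecE; field.
move=> h; split=> [j /negPf ji|].
  by apply: vec_inj; have := congr1 (@^~ j) h; rewrite /= => ->; rewrite /gswap ji.
have s3 : Num.sqrt 3 != 0 :> R by rewrite sqrtr_eq0 -ltNge ltr0n.
have s33 : Num.sqrt 3 * Num.sqrt 3 = 3 :> R by rewrite -expr2 sqr_sqrtr ?ler0n.
(* The vector [w i - nb w i] has norm 3. *)
pose d := (Num.sqrt 3)^-1 *: (w i - nb w i).
have dw j : dot (w i - nb w i) (w j) = if j == i then 3 else 0.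
  by move: i j {d h}; apply: ord4_ind; apply: ord4_ind;
     rewrite nbE !dotE !gw /gram_coef /=; ring.
have dn : dot (w i - nb w i) (nb w i) = 0.
  rewrite dot_sumr big1 // => m hm; rewrite dw ifN //.
  by apply: contraL hm => /eqP ->; rewrite addnn odd_double.
have hd : dot d d = 1.
  by rewrite /d dotZl dotZr dotDr dotNr dn dw eqxx mulrA -invfM s33; field.
have [D hD] := vec_surj hd; exists D => [j ji|].
  by rewrite oc_prodE hD /d dotZl dw (negPf ji) mulr0.
apply/(is_imageP _ _ (circle_map_inversion D)).
have := congr1 (@^~ i) h; rewrite /= => ->; rewrite hD /gswap eqxx.
rewrite (dotC _ d) {1}/d dotZl dw eqxx /d scalerA.
rewrite (_ : _ * _ = 2); last first.
  by transitivity (6 / (Num.sqrt 3 * Num.sqrt 3) : R); [field | rewrite s33; field].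
by apply: vecP; rewrite ?mulr2n !vecE /=; ring.
Qed.

(** * Orbits of wheels under swaps *)

Inductive worbit w : ('I_4 -> 'rV[R]_4) -> Prop :=
| worbit0 : worbit w w
| worbitS i w' : worbit w w' -> worbit w (gswap i w').

Lemma orbit_gwheel w w' : gwheel w -> worbit w w' -> gwheel w'.
Proof. by move=> hw; elim=> // i w1 _; exact: gwheel_gswap. Qed.

Lemma orbit_trans w1 w2 w3 : worbit w1 w2 -> worbit w2 w3 -> worbit w1 w3.
Proof. by move=> h; elim=> // i w' _; exact: worbitS. Qed.

Lemma orbit_sym w1 w2 : worbit w1 w2 -> worbit w2 w1.
Proof.
elim=> [|i w' _ h]; first exact: worbit0.
by apply: orbit_trans h; rewrite -{2}(gswapK i w'); apply: worbitS; exact: worbit0.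
Qed.

Definition packing w : set (ocircle R) :=
  [set C | exists2 w', worbit w w' & exists i, vec C = w' i].

Lemma eisenstein_packingP (P : set (ocircle R)) :
  eisenstein_packing P <-> exists2 w, gwheel w & P = packing w.
Proof.
have key W0 : wheel W0 ->
    [set C | exists2 W, clos_refl_trans _ (fun A B => exists i, swap i A B) W0 W &
            exists i, C = W i] = packing (vec \o W0).
  move=> /wheelP h0; have [g0 _] := h0.
  have fwd W : clos_refl_trans _ (fun A B => exists i, swap i A B) W0 W ->
      worbit (vec \o W0) (vec \o W).
    move/(clos_rt_rtn1 _ _ _ _); elim=> [|W1 W2 [i hs] _ ih]; first exact: worbit0.
    have [g1 _] := orbit_gwheel h0 ih.
    by move/(swapP _ _ g1): hs => ->; exact: worbitS.
  have bwd w : worbit (vec \o W0) w -> exists2 W, vec \o W = w &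
      clos_refl_trans _ (fun A B => exists i, swap i A B) W0 W.
    elim=> [|i w1 h1 [W1 e1 c1]]; first by exists W0 => //; exact: rt_refl.
    have [g1 _] := orbit_gwheel h0 h1.
    have [W2 e2] := oc_choice (gram_gswap i g1).
    exists W2 => //; apply: rt_trans c1 _; apply: rt_step; exists i.
    by apply/swapP; rewrite e1.
  apply/seteqP; split=> C.
    by move=> [W /fwd h [i ->]]; exists (vec \o W) => //; exists i.
  move=> [w /bwd [W <- h] [i hi]]; exists W => //; exists i.
  exact: vec_inj.
split=> [[W0 h0 ->]|[w hw ->]].
  by exists (vec \o W0); [exact/wheelP | exact: key].
have [gw _] := hw; have [W0 e] := oc_choice gw.
have h0 : wheel W0 by apply/wheelP; rewrite e.
by exists W0 => //; rewrite key // e.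
Qed.

End Wheels.

(** * Circles of an orbit of swaps are disjoint *)

Section Reduced.
Context {R : realType}.
Implicit Types (x y c d : 'rV[R]_4) (C D E : ocircle R) (w : 'I_4 -> 'rV[R]_4).

(* Swaps at opposite indices commute, so every element of the group generated by
   the swaps is an alternating product of nontrivial elements of the Klein groups
   of even and of odd swaps; [reach w b] holds at the wheels obtained from w by
   such products that may be continued by swaps of parity b. *)
Inductive reach w : bool -> ('I_4 -> 'rV[R]_4) -> Prop :=
| reach0 b : reach w b w
| reach1 (i : 'I_4) w' : reach w (odd i) w' -> reach w (~~ odd i) (gswap i w')
| reach2 (i : 'I_4) w' : reach w (odd i) w' ->
    reach w (~~ odd i) (gswap i (gswap (opp4 i) w')).

(** A swap whose parity is not allowed next cancels against the last factor of the product or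
    completes it to a double swap. *)
Lemma orbit_reach w w' : worbit w w' -> exists b, reach w b w'.
Proof.
elim=> [|i w1 _ [b h]]; first by exists true; exact: reach0.
have [e|e] := eqVneq b (odd i); first by exists (~~ odd i); apply: reach1;
  rewrite -e.
case: h e => [b' _|k w2 h e|k w2 h e].
- by exists (~~ odd i); apply: reach1; exact: reach0.
- have /odd_eq4[->|->] : odd k = odd i by case: (odd k) (odd i) e => -[].
    by exists (odd k); rewrite gswapK.
  rewrite -gswapC; exists (~~ odd k); exact: reach2.
- have /odd_eq4[->|->] : odd k = odd i by case: (odd k) (odd i) e => -[].
    by exists (~~ odd (opp4 k)); rewrite gswapK; apply: reach1; rewrite odd_opp4.
  by rewrite gswapC gswapK; exists (~~ odd k); apply: reach1.
Qed.

(** Here [f] stands for the negated products of a fixed circle with the current wheel. The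
    inequality at parity [b] makes the swaps of that parity increase [f]. The last alternative
    covers the wheels that contain the fixed circle, where one value is -1. *)
Definition inv_state (b : bool) (f : 'I_4 -> R) : Prop :=
  (forall j : 'I_4, odd j = b -> f j <= nb f j) /\
  ((forall j, 1 <= f j) \/ exists i, f = (fun j => - gram_coef i j)).

Lemma inv_state0 b i : inv_state b (fun j => - gram_coef i j).
Proof.
split; last by right; exists i.
by move: i; apply: ord4_ind; apply: ord4_ind => _; rewrite nbE /gram_coef /=; lra.
Qed.

(** From [f i <= nb f i] the new value [2 * nb f i - f i] is at least [nb f i], so it dominates both
    neighbours, which are the entries of the next parity. While the fixed circle is in the wheel,
    swaps at other indices leave the products unchanged, and the swap that removes it turns -1 into
    5. *)
Lemma inv_state1 (i : 'I_4) f : inv_state (odd i) f -> inv_state (~~ odd i)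
  (gswap i f).
Proof.
move=> [h1 [h2|[k e]]].
  have h3 := h2 i0; have h4 := h2 i1; have h5 := h2 i2; have h6 := h2 i3.
  move: i h1; apply: ord4_ind => h1;
  (do [have := h1 i0 erefl | have := h1 i1 erefl]);
  (do [have := h1 i2 erefl | have := h1 i3 erefl]);
  rewrite !nbE => a1 a2; (split;
    [ by apply: ord4_ind => //= _; rewrite nbE /gswap /= nbE; lra
    | left; apply: ord4_ind; rewrite /gswap /= ?nbE; lra]).
have [->|ki] := eqVneq i k; last first.
  suff -> : gswap i f = f by rewrite e; exact: inv_state0.
  rewrite e; apply/funext; move: i k ki {h1 e}.
  apply: ord4_ind; apply: ord4_ind => // _; apply: ord4_ind => //;
    rewrite /gswap /= ?nbE /gram_coef /=; ring.
rewrite e; move: k {e h1}; apply: ord4_ind; (split;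
  [ by apply: ord4_ind => //= _; rewrite nbE /gswap /= nbE /gram_coef /=; lra
  | left; apply: ord4_ind; rewrite /gswap /= ?nbE /gram_coef /=; lra]).
Qed.

Lemma inv_state2 (i : 'I_4) f : inv_state (odd i) f ->
  inv_state (~~ odd i) (gswap i (gswap (opp4 i) f)).
Proof.
move=> hf; have [h1 [h2|[k e]]] := hf.
  have h3 := h2 i0; have h4 := h2 i1; have h5 := h2 i2; have h6 := h2 i3.
  move: i h1 {hf}; apply: ord4_ind => h1;
  (do [have := h1 i0 erefl | have := h1 i1 erefl]);
  (do [have := h1 i2 erefl | have := h1 i3 erefl]);
  rewrite !nbE !opp4E => a1 a2; (split;
    [ by apply: ord4_ind => //= _; rewrite nbE /gswap /= !nbE /= ?nbE; lra
    | left; apply: ord4_ind; rewrite /gswap /= ?nbE /= ?nbE; lra]).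
have [ik|ik] := eqVneq i k.
  suff -> : gswap (opp4 i) f = f by exact: inv_state1.
  rewrite e -ik; apply/funext; move: i {h1 hf ik}.
  apply: ord4_ind; rewrite !opp4E; apply: ord4_ind => //;
    rewrite /gswap /= ?nbE /gram_coef /=; ring.
rewrite gswapC; have -> : gswap i f = f.
  rewrite e; apply/funext; move: i k ik {h1 e hf}.
  apply: ord4_ind; apply: ord4_ind => // _; apply: ord4_ind => //;
    rewrite /gswap /= ?nbE /gram_coef /=; ring.
by rewrite -odd_opp4; apply: inv_state1; rewrite odd_opp4.
Qed.

Lemma dot_gswap x i w :
  (fun k => dot x (gswap i w k)) = gswap i (fun k => dot x (w k)).
Proof.
apply/funext => k; rewrite /gswap; case: ifP => // _.
by rewrite mulr2n dotDr dotNr dotDr dot_sumr mulr2n.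
Qed.

Lemma Ndot_gswap x i w :
  (fun k => - dot x (gswap i w k)) = gswap i (fun k => - dot x (w k)).
Proof.
have := dot_gswap (- x) i w; rewrite -[LHS]/(fun k => dot (- x) (gswap i w k)).
by move=> e; apply/funext => k; have := congr1 (@^~ k) e; rewrite dotNl => ->;
  rewrite /gswap; case: ifP => _; rewrite ?dotNl //; congr (_ *+ _ - _);
  apply: eq_bigr => j _; rewrite dotNl.
Qed.

Lemma reach_inv w b w' (i : 'I_4) : gram w -> reach w b w' ->
  inv_state b (fun k => - dot (w i) (w' k)).
Proof.
move=> gw; elim=> [b'|j w1 _ ih|j w1 _ ih].
- rewrite (_ : (fun k => _) = fun k => - gram_coef i k); first exact: inv_state0.
  by apply/funext => k; rewrite gw.
- by rewrite Ndot_gswap; exact: inv_state1.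
- by rewrite !Ndot_gswap; exact: inv_state2.
Qed.

Lemma orbit_dot w w' i j : gram w -> gram w' -> worbit w w' ->
  w i = w' j \/ dot (w i) (w' j) <= -1.
Proof.
move=> gw gw' /orbit_reach[b /(reach_inv i gw)[_ [h|[k e]]]].
  by right; have := h j; lra.
have -> : w i = w' k.
  apply: (dot_inj gw') => l; rewrite gw'; apply: oppr_inj.
  exact: (congr1 (@^~ l) e).
have [->|kj] := eqVneq k j; first by left.
by right; rewrite gw' /gram_coef (negPf kj); case: ifP => _; lra.
Qed.

Lemma packing_dot w C D : gwheel w -> packing w C -> packing w D ->
  C <> D -> [/\ dot (vec C) (vec D) <= -1, future (vec C + vec D)
    & vec C + vec D <> 0].
Proof.
move=> hw [w1 o1 [i e1]] [w2 o2 [j e2]] CD.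
have h1 := orbit_gwheel hw o1; have h2 := orbit_gwheel hw o2.
have [g1 _] := h1; have [g2 _] := h2.
have o12 := orbit_trans (orbit_sym o1) o2.
rewrite e1 e2.
have n12 k : vec D = w2 k -> w1 i <> w2 k.
  by move=> ek e; apply: CD; apply: vec_inj; rewrite e1 e ek.
have hd : dot (w1 i) (w2 j) <= -1.
  by case: (orbit_dot i j g1 g2 o12) => // /(n12 _ e2).
(* Either [w1 i] occurs among the first three circles of [w2] and has product -3 with the sum, or
   three products are at most -1 and the fourth at most 1. *)
suff ds : dot (w1 i + w2 j) (sgm w2) < 0.
  split=> // [|e]; last by move: ds; rewrite e dot0l ltxx.
  apply: (causal_future (gwheel_tfuture h2)) => //.
  by rewrite /causal !dotE (dotC (w2 j)) g1 g2 /gram_coef !eqxx; lra.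
rewrite dotDl dot_sgm // dot_sumr sum4.
have hk k : dot (w1 i) (w2 k) <= 1.
  case: (orbit_dot i k g1 g2 o12) => [->|]; last lra.
  by rewrite g2 /gram_coef eqxx.
case: (orbit_dot i i0 g1 g2 o12) => [e|a0].
  by rewrite e !g2 /gram_coef /=; lra.
case: (orbit_dot i i1 g1 g2 o12) => [e|a1].
  by rewrite e !g2 /gram_coef /=; lra.
case: (orbit_dot i i2 g1 g2 o12) => [e|a2].
  by rewrite e !g2 /gram_coef /=; lra.
by have := hk i3; lra.
Qed.

End Reduced.

(** * The lattice of the arrangement *)

Section Lattice.
Context {R : realType}.
Implicit Types (x y c d : 'rV[R]_4) (C D E : ocircle R) (w : 'I_4 -> 'rV[R]_4).

Definition s3 : R := Num.sqrt 3.

Lemma s3_gt0 : 0 < s3. Proof. by rewrite sqrtr_gt0 ltr0n. Qed.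

Lemma s3_neq0 : s3 != 0. Proof. exact: lt0r_neq0 s3_gt0. Qed.

Lemma sqr_s3 : s3 ^+ 2 = 3. Proof. by rewrite sqr_sqrtr ?ler0n. Qed.

Definition lat (m n b a : int) : 'rV[R]_4 :=
  mkv (s3 * m%:~R) (2 * s3 * n%:~R) (s3 * b%:~R) a%:~R.

Definition Lat x := exists m n b a, x = lat m n b a.

Lemma latD m n b a m' n' b' a' :
  lat m n b a + lat m' n' b' a' = lat (m + m') (n + n') (b + b') (a + a').
Proof. by apply: vecP; rewrite !vecE !rmorphD /=; ring. Qed.

Lemma latN m n b a : - lat m n b a = lat (- m) (- n) (- b) (- a).
Proof. by apply: vecP; rewrite !vecE !rmorphN /=; ring. Qed.

Lemma latZ (k : int) m n b a :
  k%:~R *: lat m n b a = lat (k * m) (k * n) (k * b) (k * a).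
Proof. by apply: vecP; rewrite !vecE !rmorphM /=; ring. Qed.

Lemma LatD x y : Lat x -> Lat y -> Lat (x + y).
Proof.
by move=> [m [n [b [a ->]]]] [m' [n' [b' [a' ->]]]]; rewrite latD; do 4 eexists.
Qed.

Lemma LatN x : Lat x -> Lat (- x).
Proof. by move=> [m [n [b [a ->]]]]; rewrite latN; do 4 eexists. Qed.

Lemma LatZ (k : int) x : Lat x -> Lat (k%:~R *: x).
Proof. by move=> [m [n [b [a ->]]]]; rewrite latZ; do 4 eexists. Qed.

Lemma dot_lat m n b a m' n' b' a' :
  dot (lat m n b a) (lat m' n' b' a') =
  (a * a' + 3 * (b * b' - m * n' - m' * n))%:~R.
Proof.
rewrite /dot !mkvE !(rmorphD, rmorphM, rmorphN) /=.
by field: sqr_s3.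
Qed.

Lemma dvd3_mul (a b : int) : (3 %| a * b)%Z = (3 %| a)%Z || (3 %| b)%Z.
Proof. by rewrite !dvdzE abszM Euclid_dvdM. Qed.

Lemma dvd3_opp1 (a b : int) : (3 %| a * b + 1)%Z -> (3 %| a + b)%Z.
Proof.
have [q [r [-> hr]]] : exists q r, a = 3 * q + r /\ [|| r == 0, r == 1 | r == 2].
  by exists (a %/ 3)%Z, (a %% 3)%Z; split; lia.
have [p [s [-> hs]]] : exists q r, b = 3 * q + r /\ [|| r == 0, r == 1 | r == 2].
  by exists (b %/ 3)%Z, (b %% 3)%Z; split; lia.
have -> : (3 * q + r) * (3 * p + s) + 1 = 3 * (3 * q * p + q * s + p * r)
  + (r * s + 1).
  by ring.
set X := _ + p * r.
by case/or3P: hr => /eqP ->; case/or3P: hs => /eqP ->; lia.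
Qed.

Lemma int_gap (k : int) : k != 0 -> (k%:~R <= -1 :> R) \/ (1 <= k%:~R :> R).
Proof.
move=> k0; have : (k <= -1) || (1 <= k) by lia.
case/orP; [left; rewrite -[-1](rmorphN1 (intr : int -> R))|right;
  rewrite -[1](rmorph1 (intr : int -> R))]; by rewrite ler_int.
Qed.

(* The product is an integer not divisible by 3. *)
Lemma Lat_dot x y : Lat x -> Lat y -> dot x x = 1 -> dot y y = 1 ->
  dot x y <= -1 \/ 1 <= dot x y.
Proof.
have na m n b a : dot (lat m n b a) (lat m n b a) = 1 -> ~~ (3 %| a)%Z.
  rewrite dot_lat -(rmorph1 (intr : int -> R)) => /intr_inj h.
  apply/negP => /dvdzP[k e]; have : (3 %| 1)%Z by rewrite -h e; lia.
  by [].
move=> [m [n [b [a ->]]]] [m' [n' [b' [a' ->]]]] /na h /na h'.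
rewrite dot_lat; apply: int_gap; apply/negP => /eqP e.
have : (3 %| a * a')%Z by lia.
by rewrite dvd3_mul (negPf h) (negPf h').
Qed.

Definition lwheel w := gwheel w /\ forall i, Lat (w i).

Lemma lwheel_gswap i w : lwheel w -> lwheel (gswap i w).
Proof.
move=> [h1 h2]; split=> [|j]; first exact: gwheel_gswap.
move: i j; apply: ord4_ind; apply: ord4_ind; rewrite /gswap /= ?nbE ?mulr2n //;
  do ?[apply: LatD | apply: LatN]; exact: h2.
Qed.

Lemma lwheel_orbit w w' : lwheel w -> worbit w w' -> lwheel w'.
Proof. by move=> h; elim=> // i w1 _; exact: lwheel_gswap. Qed.

(* A wheel in the lattice is a basis of it: both have discriminant 27. *)
Lemma Lat_coef w x i : lwheel w -> Lat x -> exists k : int, coef w x i = k%:~R.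
Proof.
move=> [[gw _] lw] [m [n [b [a ->]]]].
have H j : exists t : int * int * int * int, w j = lat t.1.1.1 t.1.1.2 t.1.2 t.2.
  by have [m' [n' [b' [a' ->]]]] := lw j; exists (m', n', b', a').
have [t ht] := choice H.
(* Adjacent circles have product -1, so their last coordinates cancel modulo 3; this makes the
   numerator of each coefficient divisible by 3. *)
have adj (j k : 'I_4) : odd (j + k)%N -> exists r, (t j).2 + (t k).2 = 3 * r.
  move=> jk; have /dvdzP[r hr] : (3 %| (t j).2 + (t k).2)%Z.
    apply: dvd3_opp1; have := gw j k; rewrite /gram_coef jk.
    rewrite ifN; last by apply: contraL jk => /eqP ->; rewrite addnn odd_double.
    by rewrite !ht dot_lat -(rmorphN1 (intr : int -> R)) => /intr_inj; lia.
  by exists r; rewrite hr mulrC.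
set y := lat m n b a.
have key (i' j k : 'I_4) : odd (i' + j)%N -> odd (i' + k)%N -> exists r : int,
    3^-1 * (dot y (w i') - (dot y (w j) + dot y (w k))) = r%:~R.
  move=> /adj[r hr] /adj[r' hr']; rewrite /y !ht !dot_lat.
  set zi := _ * _ - _ - _; set zj := _ * _ - _ - _; set zk := _ * _ - _ - _.
  exists (a * (t i').2 + zi - zj - zk - a * r - a * r').
  have hj : (t j).2 = 3 * r - (t i').2 by lia.
  have hk : (t k).2 = 3 * r' - (t i').2 by lia.
  by rewrite hj hk !(rmorphD, rmorphM, rmorphN) /=; field.
by rewrite /coef; move: i; apply: ord4_ind; rewrite nbE; exact: key.
Qed.

Lemma Lat_lin w x (P : 'rV[R]_4 -> Prop) : lwheel w -> Lat x ->
  P 0 -> (forall k : int, forall i y, P y -> P (k%:~R *: w i + y)) -> P x.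
Proof.
move=> lw lx P0 PS; have [[gw _] _] := lw; rewrite (expand x gw) sum4.
have [k0 ->] := Lat_coef i0 lw lx; have [k1 ->] := Lat_coef i1 lw lx.
have [k2 ->] := Lat_coef i2 lw lx; have [k3 ->] := Lat_coef i3 lw lx.
by rewrite -!addrA -[X in _ + (_ + (_ + X))]addr0; do 4 apply: (PS).
Qed.

(* The coefficients of x in the basis w have an odd sum as x has norm 1. *)
Lemma Lat_sgm w x : lwheel w -> Lat x -> dot x x = 1 ->
  dot x (sgm w) <= -3 \/ 3 <= dot x (sgm w).
Proof.
move=> lw lx; have [[gw _] _] := lw; rewrite sum_coef //.
rewrite {1 2}(expand x gw) !sum4.
have [k0 ->] := Lat_coef i0 lw lx; have [k1 ->] := Lat_coef i1 lw lx.
have [k2 ->] := Lat_coef i2 lw lx; have [k3 ->] := Lat_coef i3 lw lx.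
rewrite !dotE !gw /gram_coef /= => e.
(* The norm is the square of the sum of the coefficients minus an even integer. *)
have e' : (k0 + k1 + k2 + k3) * (k0 + k1 + k2 + k3)
   - 4 * (k0 * k1 + k1 * k2 + k2 * k3 + k3 * k0) - 6 * (k0 * k2 + k1 * k3) = 1.
  apply: (@intr_inj R); rewrite [RHS]rmorph1; apply: etrans e.
  by rewrite !(rmorphD, rmorphM, rmorphN) /=; ring.
have : k0 + k1 + k2 + k3 != 0.
  by apply/eqP => s0; move: e'; rewrite s0; lia.
rewrite -!rmorphD => /int_gap[] /= h; [right|left]; lra.
Qed.

End Lattice.

(** * Euclidean descent for norm 1 vectors *)

Lemma round_div (a k : int) : k != 0 -> exists y : int, `|2 * (a + k * y)| <= `|k|.
Proof.
move=> k0; have e := divz_eq a k; have r0 := modz_ge0 a k0.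
have r1 := ltz_mod a k0.
set q := (a %/ k)%Z in e; set r := (a %% k)%Z in e r0 r1.
have [h|h] := lerP (2 * r) `|k|.
  by exists (- q); rewrite (_ : a + _ = r) //; [lia | rewrite e; ring].
have [kp|kn] := ltrP 0 k.
  exists (- q - 1); rewrite (_ : a + _ = r - k); last by rewrite {1}e; ring.
  by lia.
exists (- q + 1); rewrite (_ : a + _ = r + k); last by rewrite {1}e; ring.
by lia.
Qed.

Lemma sqr_le_norm (x y : int) : `|x| <= `|y| -> x * x <= y * y.
Proof.
by move=> h; rewrite -!expr2 -[x ^+ 2]real_normK ?num_real // -[y ^+ 2]real_normK ?num_real // lerXn2r ?nnegrE.
Qed.

Definition qnorm (m n b a : int) : int := a * a + 3 * (b * b) - 6 * (m * n).

(** The coordinate n of a lattice circle after translation by 2 (x + y omega). *)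
Definition qshift (x y m n b a : int) : int :=
  n + m * (2 * x * x + 2 * x * y + 2 * y * y) + b * (2 * x + y) + a * y.

(* Euclidean descent on |m| + |n|: translations make (a, b) small with respect
   to m, and then |n| < |m| by the norm condition; the inversion exchanges the
   roles of m and n. *)
Lemma qnorm1_ind_le (P : int -> int -> int -> int -> Prop) :
  P 0 0 0 1 -> P 0 0 0 (-1) ->
  (forall x y m n b a, P m n b a ->
     P m (qshift x y m n b a) (b + m * (2 * x + y)) (a + 3 * (m * y))) ->
  forall m n b a, qnorm m n b a = 1 -> `|m| <= `|n| ->
  (forall n' b' a', qnorm m n' b' a' = 1 -> `|n'| < `|n| -> P m n' b' a') ->
  P m n b a.
Proof.
move=> P1 PN PT m n b a; rewrite /qnorm => e le ih.
have PT' x y : P m (qshift x y m n b a) (b + m * (2 * x + y)) (a + 3 * (m * y)) ->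
    P m n b a.
  move/(PT (- x) (- y)); rewrite /qshift.
  set n' := (X in P m X); set b' := (X in P m _ X); set a' := (X in P m _ _ X).
  have -> : n' = n by rewrite /n'; ring.
  have -> : b' = b by rewrite /b'; ring.
  by have -> : a' = a by rewrite /a'; ring.
have [m0|m0] := eqVneq m 0.
  rewrite m0 in e PT' *.
  have sa : 0 <= a * a by rewrite -expr2 sqr_ge0.
  have sb : 0 <= b * b by rewrite -expr2 sqr_ge0.
  have b0 : b = 0.
    have /eqP : b * b = 0 by lia.
    by rewrite mulf_eq0 orbb => /eqP.
  have a1 : a = 1 \/ a = -1.
    have /eqP : a ^+ 2 = 1 by rewrite expr2; rewrite b0 in e; lia.
    by rewrite sqrf_eq1 => /orP[]/eqP; [left|right].
  (* As a^2 = 1, this translation changes n to n - a^2 n = 0. *)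
  apply: (PT' 0 (- a * n)); rewrite b0 /qshift.
  set n' := (X in P _ X); set b' := (X in P _ _ X); set a' := (X in P _ _ _ X).
  have -> : n' = 0 by rewrite /n'; case: a1 => ->; ring.
  have -> : b' = 0 by rewrite /b'; ring.
  have -> : a' = a by rewrite /a'; ring.
  by case: a1 => ->.
(* The shift [y] is chosen first, as it also moves b. Then |2 a'| <= 3 |m| and |b'| <= |m|, so that
   6 m n' <= (9/4 + 3) m^2 - 1 < 6 m^2. *)
have [y hy] := @round_div a (3 * m) ltac:(lia).
have [x hx] := @round_div (b + m * y) (2 * m) ltac:(lia).
apply: (PT' x y).
set n' := qshift _ _ _ _ _ _; set b' := b + _; set a' := a + _.
have hb' : `|b'| <= `|m|.
  by move: hx; rewrite (_ : b + m * y + 2 * m * x = b'); [lia | rewrite /b'; ring].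
have ha' : `|2 * a'| <= 3 * `|m|.
  by move: hy; rewrite (_ : a + 3 * m * y = a'); [lia | rewrite /a'; ring].
have e' : a' * a' + 3 * (b' * b') - 6 * (m * n') = 1.
  by apply: etrans e; rewrite /a' /b' /n' /qshift; ring.
apply: ih => //.
suff : `|n'| < `|m| by lia.
have hb2 : b' * b' <= m * m by exact: sqr_le_norm.
have ha2 : (2 * a') * (2 * a') <= (3 * m) * (3 * m).
  by apply: sqr_le_norm; lia.
have sa : 0 <= a' * a' by rewrite -expr2 sqr_ge0.
have sb : 0 <= b' * b' by rewrite -expr2 sqr_ge0.
have mn : 0 <= m * n' by lia.
have mm : 0 < m * m by rewrite -expr2 exprn_even_gt0.
rewrite ltNge; apply/negP => hn.
have : m * m <= m * n'.
  by rewrite -(ger0_norm (ltW mm)) -(ger0_norm mn) !normrM ler_wpM2l.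
lia.
Qed.

Lemma qnorm1_ind (P : int -> int -> int -> int -> Prop) :
  P 0 0 0 1 -> P 0 0 0 (-1) ->
  (forall x y m n b a, P m n b a ->
     P m (qshift x y m n b a) (b + m * (2 * x + y)) (a + 3 * (m * y))) ->
  (forall x y m n b a, P m n b a ->
     P (qshift x y n m b (- a)) n (b + n * (2 * x + y)) (a - 3 * (n * y))) ->
  forall m n b a, qnorm m n b a = 1 -> P m n b a.
Proof.
move=> P1 PN PT PL m n b a.
have [k hk] : exists k : nat, `|m| + `|n| < k%:Z.
  by exists (absz m + absz n).+1; lia.
elim: k m n b a hk => [|k ih] m n b a hk e; first by lia.
have [le|/ltW le] := lerP `|m| `|n|.
  by apply: (qnorm1_ind_le P1 PN PT e le) => n' b' a' e' lt; apply: ih => //; lia.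
pose P' (m n b a : int) := P n m b (- a).
have P'T x y m' n' b' a' : P' m' n' b' a' ->
     P' m' (qshift x y m' n' b' a') (b' + m' * (2 * x + y)) (a' + 3 * (m' * y)).
  move=> /(PL x y); rewrite /P' opprK.
  by rewrite (_ : - (a' + 3 * (m' * y)) = - a' - 3 * (m' * y)) //; ring.
have e' : qnorm n m b (- a) = 1 by apply: etrans e; rewrite /qnorm; ring.
rewrite -[a]opprK; apply: (qnorm1_ind_le (P := P')) e' le _ => //.
move=> m' b' a' h lt; apply: ih; first lia.
by apply: etrans h; rewrite /qnorm; ring.
Qed.

(** * The Eisenpint arrangement *)

Section Arrangement.
Context {R : realType}.
Implicit Types (x y c d : 'rV[R]_4) (C D E : ocircle R) (w : 'I_4 -> 'rV[R]_4).
Implicit Types (z t : R[i]).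

Lemma eisenstein_intP z : eisenstein_int z <->
  exists a b : int, z = (a%:~R + b%:~R / 2) +i* (s3 * b%:~R / 2).
Proof.
have e a b : (a%:~R + b%:~R * omega R : R[i]) =
    (a%:~R + b%:~R / 2) +i* (s3 * b%:~R / 2).
  rewrite -!(rmorph_int (real_complex R)) /omega -/s3.
  by apply/eqP; rewrite eq_complex /=; apply/andP; split; apply/eqP; field.
by split=> -[a [b ->]]; exists a, b; rewrite e.
Qed.

Lemma eisenstein_int2 z : (exists2 t, eisenstein_int t & z = 2 * t) <->
  exists a b : int, z = (2 * a%:~R + b%:~R) +i* (s3 * b%:~R).
Proof.
have e2 : 2 = 2%:C :> R[i] by rewrite rmorph_nat.
split=> [[t /eisenstein_intP[a [b ->]] ->]|[a [b ->]]].
  exists a, b; rewrite e2; apply/eqP; rewrite eq_complex /=.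
  by apply/andP; split; apply/eqP; field.
eexists; first by apply/eisenstein_intP; exists a, b; reflexivity.
rewrite e2; apply/eqP; rewrite eq_complex /=.
by apply/andP; split; apply/eqP; field.
Qed.

Lemma omega2 : omega R * omega R = omega R - 1.
Proof.
apply/eqP; rewrite eq_complex /= -/s3; apply/andP.
by split; apply/eqP; field: (@sqr_s3 R).
Qed.

Lemma eisD z t : eisenstein_int z -> eisenstein_int t -> eisenstein_int (z + t).
Proof.
move=> [a [b ->]] [a' [b' ->]]; exists (a + a'), (b + b').
by rewrite !rmorphD /=; ring.
Qed.

Lemma eisM z t : eisenstein_int z -> eisenstein_int t -> eisenstein_int (z * t).
Proof.
move=> [a [b ->]] [a' [b' ->]].
exists (a * a' - b * b'), (a * b' + b * a' + b * b').
rewrite !(rmorphD, rmorphM, rmorphN) /=.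
by ring: omega2.
Qed.

Lemma eis_int (a : int) : eisenstein_int (a%:~R : R[i]).
Proof. by exists a, 0; rewrite mul0r addr0. Qed.

Lemma eisN z : eisenstein_int z -> eisenstein_int (- z).
Proof.
by move=> [a [b ->]]; exists (- a), (- b); rewrite !rmorphN /=; ring.
Qed.

Lemma GammaE_mul (M N : 'M[R[i]]_2) : GammaE M -> GammaE N -> GammaE (M *m N).
Proof.
move=> [hM dM [a ha ea] [b hb eb] [d hd ed]] [hN dN [a' ha' ea'] [b' hb' eb'] [d' hd' ed']].
have E i j : (M *m N) i j = M i 0 * N 0 j + M i 1 * N 1 j.
  rewrite mxE !big_ord_recl big_ord0 addr0.
  by congr (_ + M _ _ * N _ _); apply: val_inj.
have e1 := eis_int 1; have e2 := eis_int 2.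
rewrite -[1%:~R]/(1 : R[i]) in e1; rewrite -[2%:~R]/(2 : R[i]) in e2.
split.
- by move=> i j; rewrite E; apply: eisD; apply: eisM; auto.
- by rewrite det_mulmx dM dN mulr1.
- exists (a + a' + 2 * a * a' + b * N 1 0).
    by do ?[apply: eisD | apply: eisM] => //.
  rewrite E; have -> : M 0 0 = 1 + 2 * a by rewrite -ea; ring.
  have -> : N 0 0 = 1 + 2 * a' by rewrite -ea'; ring.
  have -> : M 0 1 = 2 * b by rewrite -eb; ring.
  by ring.
- exists (M 0 0 * b' + b * N 1 1).
    by do ?[apply: eisD | apply: eisM] => //.
  rewrite E; have -> : N 0 1 = 2 * b' by rewrite -eb'; ring.
  have -> : M 0 1 = 2 * b by rewrite -eb; ring.
  by ring.
- exists (d + d' + 2 * d * d' + M 1 0 * b').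
    by do ?[apply: eisD | apply: eisM] => //.
  rewrite E; have -> : M 1 1 = 1 + 2 * d by rewrite -ed; ring.
  have -> : N 1 1 = 1 + 2 * d' by rewrite -ed'; ring.
  have -> : N 0 1 = 2 * b' by rewrite -eb'; ring.
  by ring.
Qed.

Definition mx2 (a b c d : R[i]) : 'M[R[i]]_2 :=
  \matrix_(i, j) if i == 0 then if j == 0 then a else b else if j == 0 then c else d.

Lemma GammaE_mx2 (b c : R[i]) : (exists2 t, eisenstein_int t & b = 2 * t) ->
  eisenstein_int c -> b * c = 0 -> GammaE (mx2 1 b c 1).
Proof.
move=> [t ht eb] hc bc.
have e0 := eis_int 0; have e1 := eis_int 1; have e2 := eis_int 2.
rewrite -[1%:~R]/(1 : R[i]) in e1; rewrite -[2%:~R]/(2 : R[i]) in e2.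
split; rewrite ?det2 ?mxE /=.
- by move=> i j; rewrite mxE; case: ifP => _; case: ifP => _ //; rewrite eb;
  exact: eisM.
- by rewrite bc; ring.
- by exists 0 => //; ring.
- by exists t => //; rewrite eb; ring.
- by exists 0 => //; ring.
Qed.

Lemma eisenpint_mobius N C D : GammaE N -> vec D = mact N (vec C) ->
  eisenpint_circle C -> eisenpint_circle D.
Proof.
move=> gN h [M gM e]; exists (N *m M); first exact: GammaE_mul.
have [_ dN _ _ _] := gN; have [_ dM _ _ _] := gM.
have cN : circle_map (mobius N) (mact N).
  by apply: circle_map_mobius; rewrite dN /nsq /=; ring.
rewrite (circle_map_points cN h) e image_comp; congr (_ @` _).
by apply/funext => s; rewrite /= mobius_comp // ?dN ?dM oner_eq0.
Qed.

Lemma real_line_circle C : vec C = lat 0 0 0 1 \/ vec C = lat 0 0 0 (-1) ->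
  oc_points C = @real_line R.
Proof.
move=> h; apply/seteqP; split; (case=> [z|];
  rewrite oc_pointsE /hform /real_line /=; case: h => ->;
  rewrite !mkvE ?mulr0 //= => e); lra.
Qed.

Lemma GammaE1 : GammaE (1%:M : 'M[R[i]]_2).
Proof.
have -> : 1%:M = mx2 1 0 0 1.
  apply/matrixP => i j; rewrite !mxE.
  by case: i j => [[|[|//]] ?] [[|[|//]] ?].
apply: GammaE_mx2; last by rewrite mulr0.
  by exists 0; [exact: (eis_int 0) | rewrite mulr0].
exact: (eis_int 0).
Qed.

Lemma mact_upper (p q m n b a : int) :
  mact (mx2 1 ((2 * p%:~R + q%:~R) +i* (s3 * q%:~R)) 0 1) (lat m n b a) =
  lat m (qshift p q m n b a) (b + m * (2 * p + q)) (a + 3 * (m * q)).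
Proof.
rewrite /mact /vb !mxE /= !mkvE /qshift.
apply: vecP; rewrite !mkvE /= ?(rmorphD, rmorphM, rmorphN) /=; ring: (@sqr_s3 R).
Qed.

Lemma mact_lower (p q m n b a : int) :
  mact (mx2 1 0 ((p%:~R + q%:~R / 2) +i* (s3 * q%:~R / 2)) 1) (lat m n b a) =
  lat (qshift p q n m b (- a)) n (b + n * (2 * p + q)) (a - 3 * (n * q)).
Proof.
rewrite /mact /vb !mxE /= !mkvE /qshift.
apply: vecP; rewrite !mkvE /= ?(rmorphD, rmorphM, rmorphN) /=; 
  by field: (@sqr_s3 R).
Qed.

Lemma qnorm_lat m n b a : (dot (lat m n b a) (lat m n b a) = 1 :> R) <->
  qnorm m n b a = 1.
Proof.
rewrite dot_lat -(rmorph1 (intr : int -> R)) /qnorm; split=> [/intr_inj h|h].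
  by apply: etrans h; ring.
by congr (_%:~R); apply: etrans h; ring.
Qed.

(** Each step of the descent is the action of an upper or lower unipotent matrix of [GammaE]. *)
Lemma eisenpint_of_Lat C : Lat (vec C) -> eisenpint_circle C.
Proof.
move=> [m [n [b [a e]]]].
have hN : qnorm m n b a = 1 by apply/qnorm_lat; rewrite -e dot_vec.
move: m n b a hN C e; apply: qnorm1_ind.
- move=> C h; exists 1%:M; first exact: GammaE1.
  by rewrite (real_line_circle (or_introl h));
    rewrite (_ : mobius _ = id) ?image_id //;
    apply/funext => s; rewrite mobius1.
- move=> C h; exists 1%:M; first exact: GammaE1.
  by rewrite (real_line_circle (or_intror h));
    rewrite (_ : mobius _ = id) ?image_id //;
    apply/funext => s; rewrite mobius1.
- move=> p q m n b a ih D; rewrite -mact_upper; set N := mx2 _ _ _ _ => h.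
  have gN : GammaE N.
    apply: GammaE_mx2; last by rewrite mulr0.
      by apply/eisenstein_int2; exists p, q.
    exact: (eis_int 0).
  have [_ dN _ _ _] := gN.
  have hC : dot (lat m n b a) (lat m n b a) = 1 :> R.
    have := dot_vec D; rewrite h dot_mact dN => <-.
    by rewrite (_ : nsq 1 = 1) ?mul1r // /nsq /=; ring.
  by have [C eC] := vec_surj hC; apply: (eisenpint_mobius gN (C := C));
    rewrite ?eC //; exact: ih.
- move=> p q m n b a ih D; rewrite -mact_lower; set N := mx2 _ _ _ _ => h.
  have gN : GammaE N.
    apply: GammaE_mx2; last by rewrite mul0r.
      by exists 0; [exact: (eis_int 0) | rewrite mulr0].
    by apply/eisenstein_intP; exists p, q.
  have [_ dN _ _ _] := gN.
  have hC : dot (lat m n b a) (lat m n b a) = 1 :> R.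
    have := dot_vec D; rewrite h dot_mact dN => <-.
    by rewrite (_ : nsq 1 = 1) ?mul1r // /nsq /=; ring.
  by have [C eC] := vec_surj hC; apply: (eisenpint_mobius gN (C := C));
    rewrite ?eC //; exact: ih.
Qed.

Lemma Lat_mact (M : 'M[R[i]]_2) : GammaE M -> Lat (mact M (lat 0 0 0 1)).
Proof.
move=> [hM dM].
move=> [a' /eisenstein_intP[a1 [a2 ea']] ea] [b' /eisenstein_intP[b1 [b2 eb']] eb].
move=> [d' /eisenstein_intP[d1 [d2 ed']] ed].
have /eisenstein_intP[c1 [c2 ec]] := hM 1 0.
have e2 : 2 = 2%:C :> R[i] by rewrite rmorph_nat.
have {}ea : M 0 0 = (1 + 2 * a1%:~R + a2%:~R) +i* (s3 * a2%:~R).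
  rewrite -[M 0 0](subrK 1) ea ea' e2; apply/eqP; rewrite eq_complex /=.
  by apply/andP; split; apply/eqP; field.
have {}ed : M 1 1 = (1 + 2 * d1%:~R + d2%:~R) +i* (s3 * d2%:~R).
  rewrite -[M 1 1](subrK 1) ed ed' e2; apply/eqP; rewrite eq_complex /=.
  by apply/andP; split; apply/eqP; field.
have {}eb : M 0 1 = (2 * b1%:~R + b2%:~R) +i* (s3 * b2%:~R).
  rewrite -[M 0 1](subrK 0) eb eb' e2; apply/eqP; rewrite eq_complex /=.
  by apply/andP; split; apply/eqP; field.
rewrite /mact /vb !mkvE ea ed eb ec /=.
exists (2 * c1 * d2 - c2 - 2 * c2 * d1).
exists (b2 + 2 * b2 * a1 - 2 * b1 * a2).
exists (d2 + 2 * d2 * a1 - a2 - 2 * d1 * a2 + b2 * c1 - b1 * c2).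
exists (3 * d2 * a2 + (1 + 2 * d1 + d2) * (1 + 2 * a1 + a2)
        - 2 * b2 * c2 - 2 * b1 * c1 - b1 * c2 - b2 * c1).
by apply: vecP; rewrite !mkvE !(rmorphD, rmorphM, rmorphN) /=;
  field: (@sqr_s3 R).
Qed.

Lemma eisenpint_circleP C : eisenpint_circle C <-> Lat (vec C).
Proof.
split=> [[M gM e]|]; last exact: eisenpint_of_Lat.
have h0 : dot (lat 0 0 0 1) (lat 0 0 0 1) = 1 :> R by apply/qnorm_lat.
have [C0 e0] := vec_surj h0.
have [_ dM _ _ _] := gM.
have cM : circle_map (mobius M) (mact M).
  by apply: circle_map_mobius; rewrite dM /nsq /=; ring.
have [C1 e1] := circle_map_vec C0 cM.
have /points_sign h : oc_points C1 = oc_points C.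
  by rewrite (circle_map_points cM e1) e (real_line_circle (or_introl e0)).
have l1 : Lat (vec C1) by rewrite e1 e0; exact: Lat_mact.
by case: h => ->; [|exact: LatN].
Qed.

(** The two boundary lines of the strip between heights 0 and sqrt 3, and two tangent circles of
    radius 1 / sqrt 3 inside it, each touching one of the lines. *)
Definition base_wheel (j : 'I_4) : 'rV[R]_4 :=
  nth 0 [:: lat 0 0 0 (-1); lat 0 1 0 1; lat 1 1 1 2; lat 1 0 0 1] j.

Lemma lwheel_base : lwheel base_wheel.
Proof.
split; last by apply: ord4_ind; rewrite /base_wheel /=; do 4 eexists.
split.
  by apply: ord4_ind; apply: ord4_ind; rewrite /base_wheel /= dot_lat /gram_coef /=.
by rewrite vu_sum sum4 /base_wheel /= !mkvE; have := @s3_gt0 R; lra.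
Qed.

Lemma lwheel_map w (A : 'rV[R]_4 -> 'rV[R]_4) :
  (forall x y, dot (A x) (A y) = dot x y) -> (forall x y, A (x + y) = A x + A y) ->
  (forall x, tfuture x -> 0 < vu (A x)) -> (forall x, Lat x -> Lat (A x)) ->
  lwheel w -> lwheel (A \o w).
Proof.
move=> Ad AD Au AL [[gw uw] lw]; split; last by move=> i; exact: AL.
split; first by move=> i j; rewrite Ad gw.
have -> : sgm (A \o w) = A (sgm w) by rewrite /sgm !sum4 !AD.
by apply: Au; exact: gwheel_tfuture.
Qed.

Lemma simil_lat (p q m n b a : int) :
  simil (1 : R[i]) ((2 * p%:~R + q%:~R) +i* (s3 * q%:~R)) (lat m n b a) =
  lat m (qshift p q m n b a) (b + m * (2 * p + q)) (a + 3 * (m * q)).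
Proof.
by rewrite /simil /qshift; apply: vecP; rewrite !mkvE /nsq /= ?(rmorphD, rmorphM, rmorphN) /=;
  ring: (@sqr_s3 R).
Qed.

Lemma nsq1 : nsq (1 : R[i]) = 1.
Proof. by rewrite /nsq /=; ring. Qed.

(** The action of z |-> 2 / z. It is not in the group, but it conjugates translations by 2 t into
    the lower unipotent maps with entry t. *)
Definition exch x : 'rV[R]_4 := mkv (vv x / 2) (2 * vu x) (vp x) (- vq x).

Lemma exch_lat m n b a : exch (lat m n b a) = lat n m b (- a).
Proof. by rewrite /exch !mkvE /lat rmorphN; apply: vecP; rewrite !mkvE //;
  field. Qed.

(** Wheels are carried along the descent by lattice isometries. It starts from the real line: one
    orientation is in [base_wheel], the other in its image under the half-turn. *)
Lemma Lat_wheel x : Lat x -> dot x x = 1 -> exists2 w, lwheel w & exists i, x = w i.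
Proof.
move=> [m [n [b [a ->]]]] /qnorm_lat hN.
pose K m n b a := exists2 w, lwheel w & exists i, lat m n b a = w i :> 'rV[R]_4.
have KE m' n' b' a' : K m' n' b' a' -> K n' m' b' (- a').
  move=> [w lw [i e]]; exists (exch \o w); last first.
    by exists i; rewrite -exch_lat e.
  apply: lwheel_map lw => //.
  - by move=> y z; rewrite /exch /dot !mkvE; field.
  - by move=> y z; rewrite /exch; apply: vecP; rewrite !vecE; ring.
  - by move=> y /tfutureP[_ h]; rewrite mkvE divr_gt0.
  - by move=> _ [m1 [n1 [b1 [a1 ->]]]]; rewrite exch_lat; do 4 eexists.
have KT p q m' n' b' a' : K m' n' b' a' ->
    K m' (qshift p q m' n' b' a') (b' + m' * (2 * p + q)) (a' + 3 * (m' * q)).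
  move=> [w lw [i e]].
  pose A := simil (1 : R[i]) ((2 * p%:~R + q%:~R) +i* (s3 * q%:~R)).
  exists (A \o w); last by exists i; rewrite -simil_lat e.
  have [_ _ Ad] := circle_map_simil ((2 * p%:~R + q%:~R) +i* (s3 * q%:~R)) nsq1.
  apply: lwheel_map lw => //.
  - exact: similD.
  - by move=> y [_ h]; rewrite mkvE.
  - by move=> _ [m1 [n1 [b1 [a1 ->]]]]; rewrite /A simil_lat; do 4 eexists.
move: m n b a hN; apply: (qnorm1_ind (P := K)) => //.
- exists (simil (-1) 0 \o base_wheel); last first.
    exists i0; rewrite /= /base_wheel /= /simil.
    by apply: vecP; rewrite !mkvE /= ?rmorphN /=; ring.
  have n1 : nsq (-1 : R[i]) = 1 by rewrite /nsq /=; ring.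
  have [_ _ Ad] := circle_map_simil (0 : R[i]) n1.
  apply: lwheel_map lwheel_base => //.
  - exact: similD.
  - by move=> y [_ h]; rewrite mkvE.
  - move=> _ [m1 [n1' [b1 [a1 ->]]]]; exists m1, n1', (- b1), (- a1).
    by rewrite /simil /nsq; apply: vecP; rewrite !mkvE /= ?rmorphN /=; ring.
- by exists base_wheel; [exact: lwheel_base | exists i0].
- move=> p q m n b a /KE /(KT p q) /KE.
  by rewrite opprD opprK.
Qed.

End Arrangement.

(** * Eisenpint tangency packings are orbits of wheels *)

Section Admissible.
Context {R : realType}.
Implicit Types (x y c d e : 'rV[R]_4) (C D E F : ocircle R) (w : 'I_4 -> 'rV[R]_4).
Implicit Types (P Q : set (ocircle R)).

Lemma causalD x y : dot x x = 1 -> dot y y = 1 -> dot x y <= -1 -> causal (x + y).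
Proof. by rewrite /causal !dotE (dotC y) => -> -> h; lra. Qed.

Lemma causalB x y : dot x x = 1 -> dot y y = 1 -> 1 <= dot x y -> causal (x - y).
Proof. by rewrite /causal !dotE (dotC y) => -> -> h; lra. Qed.

Lemma gwheel_dot1 w i : gwheel w -> dot (w i) (w i) = 1.
Proof. by move=> [gw _]; rewrite gw /gram_coef eqxx. Qed.

(** One of [e + w i], [e - w i] is causal, and since [w i] has product -3 with [sgm w], the bound on
    [e] puts it in the future or makes it 0. On the circle [w i] its form is that of [e]. *)
Lemma wheel_side w e i s : lwheel w -> Lat e -> dot e e = 1 ->
  dot e (sgm w) <= -3 -> hform (w i) s = 0 -> 0 <= hform e s.
Proof.
move=> [hw lw] le ne se h0; have [gw _] := hw.
have ft := gwheel_tfuture hw; have ni := gwheel_dot1 i hw.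
have [h|h] := Lat_dot le (lw i) ne ni.
  have : future (e + w i).
    by apply: (causal_future ft (causalD ne ni h)); rewrite dotDl dot_sgm //; lra.
  by move/(future_hform s); rewrite hformD h0 addr0.
have ca := causalB ne ni h.
have : dot (e - w i) (sgm w) <= 0 by rewrite dotDl dotNl dot_sgm //; lra.
rewrite le_eqVlt => /orP[/eqP/(causal_dot0 ft ca) /eqP|].
  by rewrite subr_eq0 => /eqP ->; rewrite h0.
by move/(causal_future ft ca)/(future_hform s); rewrite hformD hformN h0 subr0.
Qed.

(** Take a circle [w j] with j other than i, common to both wheels. The causal one of [e + w j],
    [e - w j] cannot be in different halves of the cone for the two sums, so [e] cannot jump from
    one side of the gap to the other. *)
Lemma gswap_side w e i : lwheel w -> Lat e -> dot e e = 1 ->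
  dot e (sgm w) <= -3 -> dot e (sgm (gswap i w)) <= -3.
Proof.
move=> lw le ne se; have lw' := lwheel_gswap i lw.
have [//|se'] := Lat_sgm lw' le ne.
have [j ji] : exists j, j != i by exists (opp4 i); move: i {lw' se'};
  apply: ord4_ind; rewrite opp4E.
have [hw lj] := lw; have [gw _] := hw; have [hw' _] := lw'; have [gw' _] := hw'.
have ft := gwheel_tfuture hw; have ft' := gwheel_tfuture hw'.
have ej : gswap i w j = w j by rewrite /gswap (negPf ji).
have dj : dot (w j) (sgm (gswap i w)) = -3 by rewrite -ej dot_sgm.
have nj := gwheel_dot1 j hw.
have [h|h] := Lat_dot le (lj j) ne nj.
  have ca := causalD ne nj h.
  have hd : dot (e + w j) (sgm w) < 0 by rewrite dotDl dot_sgm //; lra.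
  have fx := causal_future ft ca hd.
  have := future_dot fx (tfuture_future ft'); rewrite dotDl dj => h0.
  have : dot (e + w j) (sgm (gswap i w)) = 0 by rewrite dotDl dj; lra.
  by move/(causal_dot0 ft' ca) => x0; move: hd; rewrite x0 dot0l ltxx.
have ca := causalB ne nj h.
have : dot (e - w j) (sgm w) <= 0 by rewrite dotDl dotNl dot_sgm //; lra.
have hd : 0 < dot (e - w j) (sgm (gswap i w)) by rewrite dotDl dotNl dj; lra.
rewrite le_eqVlt => /orP[/eqP/(causal_dot0 ft ca) x0|].
  by move: hd; rewrite x0 dot0l ltxx.
move/(causal_future ft ca) => fx.
by have := future_dot fx (tfuture_future ft'); lra.
Qed.

Lemma orbit_side w w' e : lwheel w -> worbit w w' -> Lat e -> dot e e = 1 ->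
  dot e (sgm w) <= -3 -> dot e (sgm w') <= -3.
Proof.
move=> lw h le ne se; elim: h => // i w1 h1 ih.
by apply: gswap_side => //; exact: lwheel_orbit h1.
Qed.

Lemma packing_nstraddle w E : lwheel w -> Lat (vec E) -> ~ straddles (packing w) E.
Proof.
move=> lw lE [[D [w1 o1 [i ei]] [s [s1 s2]]] [D' [w2 o2 [j ej]] [t [t1 t2]]]].
rewrite oc_pointsE in s1; rewrite oc_interiorE in s2.
rewrite oc_pointsE in t1; rewrite oc_exteriorE in t2.
have nE := dot_vec E.
have [h|h] := Lat_sgm lw lE nE.
  have := wheel_side (lwheel_orbit lw o1) lE nE (orbit_side lw o1 lE nE h).
  by move/(_ i s); rewrite -ei s1 => /(_ erefl); rewrite leNgt s2.
have lN := LatN lE; have nN : dot (- vec E) (- vec E) = 1 by rewrite !dotE opprK.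
have hN : dot (- vec E) (sgm w) <= -3 by rewrite dotNl; lra.
have := wheel_side (lwheel_orbit lw o2) lN nN (orbit_side lw o2 lN nN hN).
by move/(_ j t); rewrite -ej t1 hformN oppr_ge0 => /(_ erefl); rewrite leNgt t2.
Qed.

Lemma packing_Lat w C : lwheel w -> packing w C -> Lat (vec C).
Proof. by move=> lw [w1 /(lwheel_orbit lw)[_ h] [i ->]]. Qed.

Lemma packing_tangent w w' i j C D : gwheel w -> worbit w w' ->
  vec C = w' i -> vec D = w' j -> odd (i + j)%N -> tangent C D.
Proof.
move=> hw o1 eC eD ij.
have PC : packing w C by exists w' => //; exists i.
have PD : packing w D by exists w' => //; exists j.
have [g1 _] := orbit_gwheel hw o1.
have d1 : dot (vec C) (vec D) = -1.
  rewrite eC eD g1 /gram_coef ij ifN //.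
  by apply: contraL ij => /eqP ->; rewrite addnn odd_double.
have CD : C <> D by move=> CD; move: d1; rewrite CD dot_vec; lra.
by have [_ h1 h2] := packing_dot hw PC PD CD; exact: tangent_dot.
Qed.

Lemma tangentC C D : tangent C D -> tangent D C.
Proof. by move=> [s h]; exists s; rewrite setIC. Qed.

Lemma packing_connected w : gwheel w -> tangency_connected (packing w).
Proof.
move=> hw; set rel := fun A B => [/\ packing w A, packing w B & tangent A B].
have relC A B : rel A B -> rel B A by move=> [? ? ?]; split=> //; exact: tangentC.
have cC A B : clos_refl_trans _ rel A B -> clos_refl_trans _ rel B A.
  elim=> [x y h|x|x y z _ h1 _ h2].
  - exact/rt_step/relC.
  - exact: rt_refl.
  - exact: rt_trans h2 h1.
have inw w' i j C D : worbit w w' -> vec C = w' i -> vec D = w' j ->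
    clos_refl_trans _ rel C D.
  move=> o1 eC eD; have m A k : vec A = w' k -> packing w A.
    by move=> e; exists w' => //; exists k.
  have [ij|ij] := boolP (odd (i + j)%N).
    apply: rt_step; split; [exact: m eC|exact: m eD|].
    exact: packing_tangent hw o1 eC eD ij.
  (* Circles at indices of equal parity are linked through a common neighbour. *)
  have [k ik kj] : exists2 k : 'I_4, odd (i + k)%N & odd (k + j)%N.
    move: i j ij {eC eD}; apply: ord4_ind; apply: ord4_ind => // _;
      by [exists i0 | exists i1].
  have [E eE] : exists E, vec E = w' k.
    by apply: vec_surj; apply: gwheel_dot1; exact: orbit_gwheel o1.
  apply: (@rt_trans _ _ _ E); apply: rt_step; split;
    try by [exact: m eC|exact: m eD|exact: m eE].
    exact: packing_tangent hw o1 eC eE ik.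
  exact: packing_tangent hw o1 eE eD kj.
have [C0 e0] : exists C0, vec C0 = w i0 by apply: vec_surj; exact: gwheel_dot1.
suff h C : packing w C -> clos_refl_trans _ rel C0 C.
  by move=> C D /h/cC h1 /h; exact: rt_trans.
move=> [w' o1 [i eC]]; elim: o1 i C eC => [|k w1 o1 ih] i C eC.
  by apply: inw e0 eC; exact: worbit0.
have [ik|ik] := eqVneq i k; last by apply: (ih i); rewrite eC /gswap (negPf ik).
(* The new circle is linked to the opposite one, which the swap leaves in place. *)
have [E eE] : exists E, vec E = w1 (opp4 i).
  by apply: vec_surj; apply: gwheel_dot1; exact: orbit_gwheel o1.
apply: rt_trans (ih _ _ eE) _; apply: (inw (gswap k w1) (opp4 i) i) => //.
  exact: worbitS.
by rewrite eE /gswap -ik ifN //; move: i {ik eC eE}; apply: ord4_ind; rewrite opp4E.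
Qed.

Lemma packing_admissible w : lwheel w -> eisenpint_admissible (packing w).
Proof.
move=> lw; have [hw _] := lw; split.
- by move=> C PC; apply/eisenpint_circleP; exact: packing_Lat PC.
- exact: packing_connected.
- by move=> C /eisenpint_circleP; exact: packing_nstraddle.
- move=> C D PC PD [s []]; rewrite !oc_interiorE => h1 h2.
  apply: contrapT => CD; have [_ /(future_hform s) + _] := packing_dot hw PC PD CD.
  by rewrite hformD; lra.
Qed.

Lemma admissible_dot Q C D : eisenpint_admissible Q -> Q C -> Q D -> C <> D ->
  dot (vec C) (vec D) <= -1 /\ future (vec C + vec D).
Proof.
move=> [QX _ _ Qd] QC QD CD.
have /eisenpint_circleP lC := QX _ QC; have /eisenpint_circleP lD := QX _ QD.
apply: disjoint_dot; rewrite ?dot_vec //.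
- by move/vec_inj.
- by apply: Lat_dot; rewrite ?dot_vec.
- by move=> s h1 h2; apply: CD; apply: Qd => //; exists s; split;
  rewrite oc_interiorE.
Qed.

(** Disjointness of interiors allows a circle together with its reverse. By connectedness C would
    have a tangent circle in Q, whose products with C and with its reverse would both be at most -1,
    although they are opposite. *)
Lemma admissible_opp Q C D : eisenpint_admissible Q -> Q C -> Q D ->
  vec D <> - vec C.
Proof.
move=> aQ QC QD e; have [_ Qc _ _] := aQ.
have CD : C <> D by move=> CD; have := dot_vec D; rewrite {1}e dotNl CD dot_vec;
  lra.
have ch := clos_rt_rt1n _ _ _ _ (Qc _ _ QC QD).
case: ch CD e QD => // G F [_ QG tG] _ _ e QF.
have [n1 n2] := tangent_neq tG.
have CG : C <> G by move=> h; apply: n1; rewrite h.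
have FG : F <> G by move=> h; apply: n2; rewrite -h e.
have [h1 _] := admissible_dot aQ QC QG CG.
by have [] := admissible_dot aQ QF QG FG; rewrite e dotNl; lra.
Qed.

(* Swaps decrease the sum of positive f j := - <x, w j> until f j <= nb f j for
   all j; then sum (f j)^2 <= 2 (f 0 + f 2) (f 1 + f 3), whereas the norm of x
   makes the difference of the two sides equal to 3. *)
Lemma orbit_not_neg w x : lwheel w -> Lat x -> dot x x = 1 ->
  (forall w', worbit w w' -> forall j, dot x (w' j) <= -1) -> False.
Proof.
move=> lw lx nx neg.
have [k hk] : exists k : nat, - dot x (sgm w) < k%:R.
  by exists (Num.truncn `|- dot x (sgm w)|).+1;
    apply: le_lt_trans (ler_norm _) _; exact: truncnS_gt.
elim: k w lw neg hk => [|k ih] w lw neg hk.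
  have h j := neg _ (worbit0 w) j.
  move: hk; rewrite /sgm dot_sumr sum4.
  by have := h i0; have := h i1; have := h i2; have := h i3; lra.
have [[j hj]|H] := pselect (exists j, dot x (w j) < nb (fun k => dot x (w k)) j).
  apply: (ih (gswap j w)); first exact: lwheel_gswap.
    move=> w' hw'; apply: neg; apply: orbit_trans hw'; apply: worbitS;
      exact: worbit0.
  (* The coefficient is a negative integer, so the swap lowers the sum by at least 6, more than the
     1 that the induction needs. *)
  have [c hc] := Lat_coef j lw lx.
  have c0 : c < 0.
    by rewrite -(ltrz0 R) -hc /coef pmulr_rlt0 ?invr_gt0 ?ltr0n // subr_lt0.
  have c1 : c%:~R <= -1 :> R by rewrite -(rmorphN1 (intr : int -> R)) ler_int; lia.
  rewrite sgm_gswap mulr2n !dotDr !dotNr.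
  have -> : dot x (nb w j) = nb (fun k => dot x (w k)) j by rewrite dot_sumr.
  move: hc hk c1; rewrite /coef -(natr1 k); lra.
have h j : nb (fun k => dot x (w k)) j <= dot x (w j).
  by rewrite leNgt; apply/negP => lt; apply: H; exists j.
have g j := neg _ (worbit0 w) j.
have [[gw _] _] := lw; have := dot_expand x gw; rewrite nx.
have := h i0; have := h i1; have := h i2; have := h i3; rewrite !nbE.
have := g i0; have := g i1; have := g i2; have := g i3; clear.
move: (dot x (w i0)) (dot x (w i1)) (dot x (w i2)) (dot x (w i3)) => a b c d.
move=> ha hb hc hd ka kb kc kd e.
have pa : a * (a - (b + d)) <= 0 by rewrite mulr_le0_ge0 //; lra.
have pb : b * (b - (a + c)) <= 0 by rewrite mulr_le0_ge0 //; lra.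
have pc : c * (c - (b + d)) <= 0 by rewrite mulr_le0_ge0 //; lra.
have pd : d * (d - (a + c)) <= 0 by rewrite mulr_le0_ge0 //; lra.
lra.
Qed.

(** Suppose F in Q is outside the orbit. If F had product at least 1 with an orbit circle D, then F
    would meet the interior of D and C its exterior, so Q would straddle D. Hence all products of F
    with the orbit are at most -1, against [orbit_not_neg]. *)
Lemma admissible_packing Q C w : eisenpint_admissible Q -> Q C -> lwheel w ->
  (exists i, vec C = w i) -> Q `<=` packing w.
Proof.
move=> aQ QC lw [i ei] F QF; apply: contrapT => nF.
have [hw _] := lw; have [QX _ Qs _] := aQ.
have /eisenpint_circleP lF := QX _ QF; have nrF := dot_vec F.
have PC : packing w C by exists w; [exact: worbit0 | exists i].
have FC : F <> C by move=> e; apply: nF; rewrite e.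
have [dFC fFC] := admissible_dot aQ QF QC FC.
have ft := gwheel_tfuture hw; have [gw _] := hw.
(* On the other side of the gap, the future vector [vec F + vec C] would be orthogonal to [sgm w],
   hence 0, and F would be the reverse of C. *)
have sF : dot (vec F) (sgm w) <= -3.
  have [//|h] := Lat_sgm lw lF nrF.
  have := future_dot fFC (tfuture_future ft); rewrite dotDl {1}ei dot_sgm // => h1.
  have h2 : dot (vec F + vec C) (sgm w) = 0 by rewrite dotDl ei dot_sgm //; lra.
  have [ca _ _] := fFC; have /eqP := causal_dot0 ft ca h2.
  by rewrite addr_eq0 => /eqP /(admissible_opp aQ QC QF).
apply: (orbit_not_neg lw lF nrF) => w' o1 j.
have lw' := lwheel_orbit lw o1; have [hw' lj] := lw'; have [gw' _] := hw'.
have ft' := gwheel_tfuture hw'.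
have sF' := orbit_side lw o1 lF nrF sF.
have nj := gwheel_dot1 j hw'.
have [//|h] := Lat_dot lF (lj j) nrF nj; exfalso.
have ca := causalB nrF nj h.
have [D eD] := vec_surj nj.
have PD : packing w D by exists w' => //; exists j.
have x0 : vec F - w' j <> 0.
  by move/eqP; rewrite subr_eq0 -eD => /eqP/vec_inj FD; apply: nF; rewrite FD.
have fx : future (vec F - w' j).
  have : dot (vec F - w' j) (sgm w') <= 0 by rewrite dotDl dotNl dot_sgm //; lra.
  rewrite le_eqVlt => /orP[/eqP h0|]; last exact: (causal_future ft' ca).
  by case: x0; exact: causal_dot0 ft' ca h0.
have CD : C <> D by move=> CD; move: h; rewrite -eD -CD; lra.
have [_ fCD nCD] := packing_dot hw PC PD CD.
have /Qs : eisenpint_circle D by apply/eisenpint_circleP; exact: packing_Lat PD.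
apply; split.
  have [z [z1 z2]] := point_off nrF fx x0; exists F => //; exists (Some z); split.
    by rewrite oc_pointsE.
  by rewrite oc_interiorE eD; move: z2; rewrite hformD hformN z1; lra.
have [z [z1 z2]] := point_off (dot_vec C) fCD nCD; exists C => //;
  exists (Some z); split.
  by rewrite oc_pointsE.
by rewrite oc_exteriorE; move: z2; rewrite hformD z1; lra.
Qed.

Lemma eisenpint_packingP P :
  eisenpint_packing P <-> exists2 w, lwheel w & P = packing w.
Proof.
split=> [[aP mP]|[w lw ->]].
  have [[C PC]|P0] := pselect (exists C, P C).
    have [PX _ _ _] := aP; have /eisenpint_circleP lC := PX _ PC.
    have [w lw e] := Lat_wheel lC (dot_vec C); exists w => //; apply/esym.
    by apply: mP (packing_admissible lw) _; exact: admissible_packing PC _ _.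
  (* The empty collection is admissible but not maximal: it would have to equal the packing of the
     base wheel. *)
  exists base_wheel; first exact: lwheel_base.
  apply/esym; apply: mP (packing_admissible lwheel_base) _ => C PC.
  by case: P0; exists C.
split; first exact: packing_admissible.
move=> Q aQ PQ; apply/seteqP; split=> //.
have [C eC] : exists C, vec C = w i0.
  by apply: vec_surj; have [hw _] := lw; exact: gwheel_dot1.
apply: (admissible_packing (C := C)) => //; last by exists i0.
by apply: PQ; exists w; [exact: worbit0 | exists i0].
Qed.

End Admissible.

(** * Descent on the curvatures of a wheel *)

(** Inversion of a wheel in its own circle [w i]: the reflection w j - 2 <w j, w i> w i, with
    products 1, -1 and -2. *)
Definition ginv (V : zmodType) (i : 'I_4) (w : 'I_4 -> V) (j : 'I_4) : V :=
  if j == i then - w i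
  else if odd (i + j)%N then w j + (w i + w i)
  else w j + (w i + w i + (w i + w i)).

Lemma ginvK (V : zmodType) (i : 'I_4) (w : 'I_4 -> V) : ginv i (ginv i w) = w.
Proof.
apply/funext => j; rewrite /ginv eqxx; case: eqP => [->|_]; first by rewrite opprK.
by case: (odd _); rewrite -!opprD addrK.
Qed.

Definition quad (a : 'I_4 -> int) : Prop :=
  a i0 * a i0 + a i1 * a i1 + a i2 * a i2 + a i3 * a i3 =
  2 * ((a i0 + a i2) * (a i1 + a i3)).

Lemma quad_ginv i a : quad a -> quad (ginv i a).
Proof.
rewrite /quad => /eqP; rewrite -subr_eq0 => /eqP e.
apply/eqP; rewrite -subr_eq0; apply/eqP; apply: etrans e.
move: i; apply: ord4_ind; rewrite /ginv /=; ring.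
Qed.

Lemma quad_gswap i a : quad a -> quad (gswap i a).
Proof.
rewrite /quad => /eqP; rewrite -subr_eq0 => /eqP e.
apply/eqP; rewrite -subr_eq0; apply/eqP; apply: etrans e.
move: i; apply: ord4_ind; rewrite /gswap /= nbE mulr2n; ring.
Qed.

Lemma sum_ginv i (a : 'I_4 -> int) : \sum_j ginv i a j = \sum_j a j + 6 * a i.
Proof. by rewrite !sum4; move: i; apply: ord4_ind; rewrite /ginv /=; ring. Qed.

Lemma sum_gswap i (a : 'I_4 -> int) :
  \sum_j gswap i a j = \sum_j a j + 2 * (nb a i - a i).
Proof. by rewrite !sum4; move: i; apply: ord4_ind; rewrite /gswap /= nbE mulr2n;
  ring. Qed.

Lemma dvd_ginv (d : nat) i (a : 'I_4 -> int) :
  (forall j, d %| a j)%Z -> (forall j, d %| ginv i a j)%Z.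
Proof.
move=> h j; rewrite /ginv; case: ifP => _; first by rewrite rpredN.
by case: ifP => _; rewrite !rpredD.
Qed.

Lemma dvd_gswap (d : nat) i (a : 'I_4 -> int) :
  (forall j, d %| a j)%Z -> (forall j, d %| gswap i a j)%Z.
Proof.
move=> h j; rewrite /gswap; case: ifP => _ //.
rewrite rpredB // mulr2n rpredD //;
by move: i; apply: ord4_ind; rewrite nbE rpredD.
Qed.

(** This keeps the sum positive under [ginv] at a negative entry. With S = a + c and T = b + d,
    failure means S + T <= - 6 a, and the relation then yields 25 S^2 - 28 S T + 10 T^2 <= 0. Times
    25, the left side is (25 S - 14 T)^2 + 54 T^2, which is positive. *)
Lemma quad_neg_pos (a b c d : int) :
  a * a + b * b + c * c + d * d = 2 * ((a + c) * (b + d)) ->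
  a < 0 -> 0 < a + b + c + d -> 0 < 7 * a + b + c + d.
Proof.
move=> e an sp; rewrite ltNge; apply/negP => hX.
pose S := a + c; pose T := b + d.
have a2 : 0 < a * a by rewrite nmulr_lgt0.
have b2 : 0 <= b * b by rewrite -expr2 sqr_ge0.
have c2 : 0 <= c * c by rewrite -expr2 sqr_ge0.
have d2 : 0 <= d * d by rewrite -expr2 sqr_ge0.
have ST : 0 < S * T by rewrite /S /T; lia.
have Sp : 0 < S.
  rewrite ltNge; apply/negP => S0; have Tp : 0 < T by rewrite /T;
    rewrite /S in S0; lia.
  by move: ST; rewrite pmulr_lgt0 // ltNge S0.
have Tp : 0 < T by rewrite -(pmulr_rgt0 _ Sp).
have h1 : (S + T) * (S + T) <= (- 6 * a) * (- 6 * a).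
  by apply: sqr_le_norm; rewrite /S /T in Sp Tp *; lia.
have h2 : (S + T) * S <= (- 6 * a) * S.
  by apply: ler_wpM2r; rewrite /S /T in Sp Tp *; lia.
have h3 : 0 <= (b - d) * (b - d) by rewrite -expr2 sqr_ge0.
have h4 : 0 <= (25 * S - 14 * T) * (25 * S - 14 * T) by rewrite -expr2 sqr_ge0.
have h5 : 0 < T * T by rewrite pmulr_rgt0.
rewrite /S /T in h1 h2 h4 h5 *; lia.
Qed.

(** With T = b + d the relation reads (a - T)^2 + (c - T)^2 + b^2 + d^2 = 2 T^2, while failure
    forces a - T >= 2 T. *)
Lemma quad_big_pos (a b c d : int) :
  a * a + b * b + c * c + d * d = 2 * ((a + c) * (b + d)) ->
  0 <= b -> 0 <= c -> 0 <= d -> b + d < a ->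
  0 < a + b + c + d + 2 * (b + d - a).
Proof.
move=> e b0 c0 d0 ha; rewrite ltNge; apply/negP => hX.
have h1 : 0 < (a - (b + d)) * (a - (b + d)) by rewrite pmulr_rgt0; lia.
have h2 : 0 <= (c - (b + d)) * (c - (b + d)) by rewrite -expr2 sqr_ge0.
have h3 : 0 <= (b - d) * (b - d) by rewrite -expr2 sqr_ge0.
have h4 : (2 * (b + d)) * (2 * (b + d)) <= (a - (b + d)) * (a - (b + d)).
  by apply: sqr_le_norm; lia.
lia.
Qed.

(** The relation says that the nonnegative numbers [a i * (nb a i - a i)] have sum 0. *)
Lemma quad_terminal a : quad a -> (forall i, 0 <= a i) ->
  (forall i, a i <= nb a i) ->
  forall i, a i = 0 \/ a i = nb a i.
Proof.
rewrite /quad => e p h.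
have t i : 0 <= a i * (nb a i - a i) by rewrite mulr_ge0 // subr_ge0.
have s : \sum_i a i * (nb a i - a i) = 0.
  rewrite sum4 !nbE -(subrr (2 * ((a i0 + a i2) * (a i1
    + a i3)))) -[X in _ = _ - X]e; ring.
move=> i; have : a i * (nb a i - a i) == 0.
  move: s; rewrite sum4 => s; rewrite eq_le t andbT.
  have := t i0; have := t i1; have := t i2; have := t i3.
  by move: i; apply: ord4_ind; lia.
by rewrite mulf_eq0 subr_eq0 => /orP[]/eqP; [left|right].
Qed.

Section CurvatureDescent.
Context {R : realType}.
Implicit Types (w : 'I_4 -> 'rV[R]_4).

Lemma gram_ginv i w : gram w -> gram (ginv i w).
Proof.
move=> gw; suff h (j k : 'I_4) : (j <= k)%N -> dot (ginv i w j)
  (ginv i w k) = gram_coef j k.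
  move=> j k; have [/h//|/ltnW/h] := leqP j k.
  by rewrite dotC => ->; rewrite /gram_coef eq_sym addnC.
move: i j k; do 3 apply: ord4_ind => //; move=> _;
  rewrite /ginv /= ?dotE ?gw /gram_coef //=; ring.
Qed.

Lemma Lat_ginv i w : (forall j, Lat (w j)) -> forall j, Lat (ginv i w j).
Proof.
move=> h j; rewrite /ginv; case: ifP => _; first exact: LatN.
by case: ifP => _; do !apply: LatD.
Qed.

Lemma lwheel_of w (a : 'I_4 -> int) : gram w -> (forall i, Lat (w i)) ->
  (forall i, vu (w i) = s3 * (a i)%:~R) -> 0 < \sum_i a i -> lwheel w.
Proof.
move=> gw lw hw sa; split=> //; split=> //.
rewrite vu_sum; under eq_bigr do rewrite hw.
by rewrite -mulr_sumr -rmorph_sum mulr_gt0 ?s3_gt0 // ltr0z.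
Qed.

(** Induction on the sum, lowered by [ginv] at a negative entry or by [gswap] at an entry exceeding
    its neighbours. Both are involutions, so they carry the wheel found for the reduced quadruple
    back to one for [a]. *)
Lemma curv_wheel_exists (a : 'I_4 -> int) : quad a -> 0 < \sum_i a i ->
  (forall d : nat, (forall i, d %| a i)%Z -> d = 1%N) ->
  exists2 w : 'I_4 -> 'rV[R]_4, lwheel w & forall i, vu (w i) = s3 * (a i)%:~R.
Proof.
have [k hk] : exists k : nat, \sum_i a i < k%:Z by exists (absz (\sum_i a i)).+1;
  lia.
elim: k a hk => [|k ih] a hk qa sa ga; first by lia.
have [[i hi]|H] := pselect (exists i, a i < 0).
  have [||||w [[gw _] lw] hw] := ih (ginv i a).
  - by rewrite sum_ginv; lia.
  - exact: quad_ginv.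
  - rewrite sum_ginv sum4; move: qa sa; rewrite /quad sum4 => qa sa.
    move: i hi; apply: ord4_ind => hi.
    + have h := @quad_neg_pos (a i0) (a i1) (a i2) (a i3); have := h _ hi _; lia.
    + have h := @quad_neg_pos (a i1) (a i2) (a i3) (a i0); have := h _ hi _; lia.
    + have h := @quad_neg_pos (a i2) (a i3) (a i0) (a i1); have := h _ hi _; lia.
    + have h := @quad_neg_pos (a i3) (a i0) (a i1) (a i2); have := h _ hi _; lia.
  - by move=> d hd; apply: ga => j; rewrite -(ginvK i a); exact: dvd_ginv.
  have hw' j : vu (ginv i w j) = s3 * (a j)%:~R.
    have -> : a j = ginv i (ginv i a) j by rewrite ginvK.
    move: (ginv i a) hw => b hw; rewrite /ginv; case: ifP => _.
      by rewrite vecNE hw rmorphN mulrN.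
    by case: ifP => _; rewrite !vecE !hw !rmorphD /=; ring.
  exists (ginv i w) => //; apply: lwheel_of hw' sa;
    [exact: gram_ginv | exact: Lat_ginv].
have p i : 0 <= a i by rewrite leNgt; apply/negP => h; apply: H; exists i.
have [[i hi]|H'] := pselect (exists i, nb a i < a i).
  have [||||w lw hw] := ih (gswap i a).
  - by rewrite sum_gswap; lia.
  - exact: quad_gswap.
  - rewrite sum_gswap sum4; move: qa sa; rewrite /quad sum4 => qa sa.
    have p0 := p i0; have p1 := p i1; have p2 := p i2; have p3 := p i3.
    move: i hi; apply: ord4_ind; rewrite nbE => hi.
    + have h := @quad_big_pos (a i0) (a i1) (a i2) (a i3);
      have := h _ p1 p2 p3 _; lia.
    + have h := @quad_big_pos (a i1) (a i2) (a i3) (a i0);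
      have := h _ p2 p3 p0 _; lia.
    + have h := @quad_big_pos (a i2) (a i3) (a i0) (a i1);
      have := h _ p3 p0 p1 _; lia.
    + have h := @quad_big_pos (a i3) (a i0) (a i1) (a i2);
      have := h _ p0 p1 p2 _; lia.
  - by move=> d hd; apply: ga => j; rewrite -(gswapK i a); exact: dvd_gswap.
  exists (gswap i w); first exact: lwheel_gswap.
  move=> j; have -> : a j = gswap i (gswap i a) j by rewrite gswapK.
  move: (gswap i a) hw => b hw; rewrite /gswap; case: ifP => _ //.
  rewrite !mulr2n !vecE hw !rmorphD rmorphN /=.
  suff -> : vu (nb w i) = s3 * (nb b i)%:~R by ring.
  by move: i {lw hi}; apply: ord4_ind; rewrite !nbE !vecE !hw rmorphD mulrDr.
have h i : a i <= nb a i by rewrite leNgt; apply/negP => lt; apply: H'; exists i.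
have t := quad_terminal qa p h.
(* A terminal quadruple is matched with the base wheel through a rotation or reflection [s] of the
   4-cycle, which preserves the Gram matrix. *)
have base (s : seq 'I_4) :
    (forall i j : 'I_4, gram_coef (nth i0 s i) (nth i0 s j) = gram_coef i j :> R) ->
    (forall i : 'I_4, a i = nth 0 [:: 0; 0; 1; 1] (nth i0 s i)) ->
    exists2 w : 'I_4 -> 'rV[R]_4, lwheel w & forall i, vu (w i) = s3 * (a i)%:~R.
  move=> gs as_; have [[gb _] lb] := @lwheel_base R.
  have hw (j : 'I_4) : vu (base_wheel (nth i0 s j)) = s3 * (a j)%:~R :> R.
    rewrite as_; move: (nth i0 s j); apply: ord4_ind;
      by rewrite /base_wheel /= mkvE.
  exists (fun j : 'I_4 => base_wheel (nth i0 s j)) => //.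
  by apply: lwheel_of hw sa => // j l; rewrite gb gs.
have one i j : a i = a j -> 0 < a i -> (forall k, k != i -> k != j -> a k = 0) ->
    a i = 1.
  move=> aij ai ak; have : `|a i|%N = 1%N; last by lia.
  apply: ga => m; have [->|mi] := eqVneq m i; first by rewrite dvdzE.
  have [->|mj] := eqVneq m j; first by rewrite -aij dvdzE.
  by rewrite ak.
(* Each entry is 0 or the sum of its neighbours; with a positive sum, this leaves two equal adjacent
   entries and zeros. *)
have : [|| [&& a i0 == a i1, a i2 == 0, a i3 == 0 & 0 < a i0],
  [&& a i1 == a i2, a i3 == 0, a i0 == 0 & 0 < a i1],
  [&& a i2 == a i3, a i0 == 0, a i1 == 0 & 0 < a i2] |
  [&& a i3 == a i0, a i1 == 0, a i2 == 0 & 0 < a i3]].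
  move: sa; rewrite sum4.
  have := p i0; have := p i1; have := p i2; have := p i3.
  have := t i0; have := t i1; have := t i2; have := t i3; rewrite !nbE; clear; lia.
case/or4P => /and4P[/eqP e1 /eqP e2 /eqP e3 e4].
- have e5 : a i0 = 1 by apply: one e1 e4 _; apply: ord4_ind.
  apply: (base [:: i2; i3; i0; i1]).
    by apply: ord4_ind; apply: ord4_ind.
  by apply: ord4_ind; rewrite /= -?e1.
- have e5 : a i1 = 1 by apply: one e1 e4 _; apply: ord4_ind.
  apply: (base [:: i1; i2; i3; i0]).
    by apply: ord4_ind; apply: ord4_ind.
  by apply: ord4_ind; rewrite /= -?e1.
- have e5 : a i2 = 1 by apply: one e1 e4 _; apply: ord4_ind.
  apply: (base [:: i0; i1; i2; i3]).
    by apply: ord4_ind; apply: ord4_ind.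
  by apply: ord4_ind; rewrite /= -?e1.
- have e5 : a i3 = 1 by apply: one e1 e4 _; apply: ord4_ind.
  apply: (base [:: i3; i0; i1; i2]).
    by apply: ord4_ind; apply: ord4_ind.
  by apply: ord4_ind; rewrite /= -?e1.
Qed.

End CurvatureDescent.

(** * Isometries between packings *)

Section Isometries.
Context {R : realType}.
Implicit Types (x y : 'rV[R]_4) (C D : ocircle R) (w v : 'I_4 -> 'rV[R]_4).
Implicit Types (P Q : set (ocircle R)) (e t : R[i]).

Lemma map_gswap (A : 'rV[R]_4 -> 'rV[R]_4) i w :
  (forall x y, A (x + y) = A x + A y) -> A \o gswap i w = gswap i (A \o w).
Proof.
move=> AD; have A0 : A 0 = 0 by apply: (addrI (A 0)); rewrite -AD !addr0.
have AN x : A (- x) = - A x by apply: (addrI (A x)); rewrite -AD !subrr.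
apply/funext; apply: ord4_ind; move: i; apply: ord4_ind;
  by rewrite /gswap /= ?nbE ?mulr2n ?AD ?AN ?AD.
Qed.

Lemma packing_image f (A : 'rV[R]_4 -> 'rV[R]_4) w : circle_map f A ->
  (forall x y, A (x + y) = A x + A y) -> gwheel w ->
  image_circles f (packing w) = packing (A \o w).
Proof.
move=> fA AD gw; rewrite (image_circlesP _ fA); apply/seteqP; split=> D.
  move=> [C [w' o1 [i eC]] eD]; exists (A \o w'); last by exists i; rewrite eD eC.
  elim: o1 {i eC} => [|i w1 _ ih]; first exact: worbit0.
  by rewrite map_gswap //; exact: worbitS.
move=> [v o1 [i eD]].
have [w' o2 ev] : exists2 w', worbit w w' & v = A \o w'.
  elim: o1 {i eD} => [|i v1 _ [w1 o2 ->]]; first by exists w; first exact: worbit0.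
  by exists (gswap i w1); [exact: worbitS | rewrite map_gswap].
have [C eC] : exists C, vec C = w' i.
  by apply: vec_surj; apply: gwheel_dot1; exact: orbit_gwheel o2.
exists C; last by rewrite eD ev /= eC.
by exists w' => //; exists i.
Qed.

Lemma image_circles_id P : image_circles id P = P.
Proof.
have h : circle_map (@id (sphere R)) id.
  by split=> [s|x s|//]; [exists s | exists 1; rewrite ?mul1r].
rewrite (image_circlesP _ h); apply/seteqP; split=> D; last by move=> PD; exists D.
by move=> [C PC /vec_inj ->].
Qed.

Lemma simil_conj_map e t : nsq e = 1 ->
  circle_map (omap (fun z => e * z^* + t)) (simil e t \o conjv).
Proof.
move=> he; apply: circle_map_ext (circle_map_comp circle_map_conj
  (circle_map_simil t he)) => //.
by case.
Qed.

Lemma isometric_refl P : isometric P P.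
Proof.
exists 1, 0; rewrite normr1; split=> //; left.
rewrite -[LHS]image_circles_id; congr image_circles.
by apply/funext => -[z|] //=; rewrite mul1r addr0.
Qed.

Lemma isometric_trans P Q S : isometric P Q -> isometric Q S -> isometric P S.
Proof.
move=> [e [t [/nsq_norm he hP]]] [e' [t' [/nsq_norm he' hQ]]].
have ne : `|e| = 1 by apply/nsq_norm.
have ne' : `|e'| = 1 by apply/nsq_norm.
have m1 := circle_map_simil t he; have m2 := simil_conj_map t he.
have m1' := circle_map_simil t' he'; have m2' := simil_conj_map t' he'.
case: hP => eQ; case: hQ => ->; rewrite {}eQ.
- exists (e' * e), (e' * t + t'); rewrite normrM ne ne' mulr1; split=> //; left.
  rewrite (image_circles_comp _ m1 m1'); congr image_circles.
  by apply/funext => -[z|] //=; congr Some; ring.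
- exists (e' * e^*), (e' * t^* + t'); rewrite normrM norm_conjC ne ne' mulr1;
  split=> //; right.
  rewrite (image_circles_comp _ m1 m2'); congr image_circles.
  by apply/funext => -[z|] //=; congr Some; rewrite !conjE; ring.
- exists (e' * e), (e' * t + t'); rewrite normrM ne ne' mulr1; split=> //; right.
  rewrite (image_circles_comp _ m2 m1'); congr image_circles.
  by apply/funext => -[z|] //=; congr Some; ring.
- exists (e' * e^*), (e' * t^* + t'); rewrite normrM norm_conjC ne ne' mulr1;
  split=> //; left.
  rewrite (image_circles_comp _ m2 m2'); congr image_circles.
  by apply/funext => -[z|] //=; congr Some; rewrite !conjE; ring.
Qed.

Lemma isometric_sym P Q : isometric P Q -> isometric Q P.
Proof.
move=> [e [t [ne hP]]]; have he : nsq e = 1 by apply/nsq_norm.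
have ne' : `|e^*| = 1 by rewrite norm_conjC.
have he' : nsq e^* = 1 by apply/nsq_norm.
have ee : e^* * e = 1 by rewrite mulrC -nsqE he.
have m1 := circle_map_simil t he; have m2 := simil_conj_map t he.
case: hP => ->.
  exists e^*, (- e^* * t); split=> //; left.
  rewrite (image_circles_comp _ m1 (circle_map_simil _ he')) -[LHS]image_circles_id.
  congr image_circles; apply/funext => -[z|] //=; congr Some; ring: ee.
exists e, (- e * t^*); split=> //; right.
rewrite (image_circles_comp _ m2 (simil_conj_map _ he)) -[LHS]image_circles_id.
congr image_circles; apply/funext => -[z|] //=; congr Some; rewrite !conjE;
  ring: ee.
Qed.

(** * Scaling, and the moves as isometries *)

Definition scl (r : R) P : set (ocircle R) :=
  image_circles (omap (fun z => r%:C * z)) P.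

Lemma scl_isometric r P Q : 0 < r -> isometric P Q -> isometric (scl r P) (scl r Q).
Proof.
move=> r0 [e [t [ne h]]]; have he : nsq e = 1 by apply/nsq_norm.
have m1 := circle_map_simil t he; have m2 := simil_conj_map t he.
have m1' := circle_map_simil (r%:C * t) he;
  have m2' := simil_conj_map (r%:C * t) he.
have mr := circle_map_scale r0.
exists e, (r%:C * t); split=> //; case: h => ->; [left|right].
  rewrite /scl (image_circles_comp _ m1 mr) (image_circles_comp _ mr m1');
    congr image_circles.
  by apply/funext => -[z|] //=; congr Some; ring.
rewrite /scl (image_circles_comp _ m2 mr) (image_circles_comp _ mr m2');
  congr image_circles.
by apply/funext => -[z|] //=; congr Some; rewrite !conjE; ring.
Qed.

Lemma sclK r P : 0 < r -> scl r^-1 (scl r P) = P.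
Proof.
move=> r0; have r0' : 0 < r^-1 by rewrite invr_gt0.
rewrite /scl (image_circles_comp _ (circle_map_scale r0) (circle_map_scale r0')).
rewrite -[RHS]image_circles_id; congr image_circles.
apply/funext => -[z|] //=; congr Some.
by rewrite mulrA -rmorphM mulVf ?mul1r // lt0r_neq0.
Qed.

Lemma scl_isometric_iff r P Q : 0 < r -> isometric (scl r P)
  (scl r Q) -> isometric P Q.
Proof.
move=> r0 h; rewrite -(sclK P r0) -(sclK Q r0).
by apply: scl_isometric h; rewrite invr_gt0.
Qed.

Lemma move_isometric f P : eisenpint_move f -> isometric P (image_circles
  (omap f) P).
Proof.
case=> [t ht||].
- exists 1, (2 * t); rewrite normr1; split=> //; left; congr image_circles.
  by apply/funext => -[z|] //=; rewrite mul1r.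
- exists (-1), 0; rewrite normrN1; split=> //; left; congr image_circles.
  by apply/funext => -[z|] //=; rewrite mulN1r addr0.
- exists (-1), 0; rewrite normrN1; split=> //; right; congr image_circles.
  by apply/funext => -[z|] //=; rewrite mulN1r addr0.
Qed.

Lemma eisenpint_equiv_isometric P Q : eisenpint_equiv P Q -> isometric P Q.
Proof.
elim=> [P1 P2 [f mf ->]|P1|P1 P2 P3 _ h1 _ h2].
- exact: move_isometric.
- exact: isometric_refl.
- exact: isometric_trans h1 h2.
Qed.

Lemma move_circle_map (f : R[i] -> R[i]) : eisenpint_move f -> exists A, circle_map (omap f) A.
Proof.
have n1 : nsq (-1 : R[i]) = 1 by rewrite /nsq /=; ring.
case=> [t _||].
- exists (simil 1 (2 * t)); apply: circle_map_ext (circle_map_simil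
  (2 * t) nsq1) => //.
  by case=> [z|] //=; rewrite mul1r.
- exists (simil (-1) 0); apply: circle_map_ext (circle_map_simil 0 n1) => //.
  by case=> [z|] //=; rewrite mulN1r addr0.
- exists (simil (-1) 0 \o conjv); apply: circle_map_ext (simil_conj_map 0 n1) => //.
  by case=> [z|] //=; rewrite mulN1r addr0.
Qed.

Lemma move_comp f g P : eisenpint_move f -> eisenpint_move g ->
  image_circles (omap g) (image_circles (omap f) P) = image_circles (omap
    (g \o f)) P.
Proof.
move=> /move_circle_map[A hA] /move_circle_map[B hB].
by rewrite (image_circles_comp _ hA hB); congr image_circles; apply/funext => -[].
Qed.

Lemma eisenpint_equiv_sym P Q : eisenpint_equiv P Q -> eisenpint_equiv Q P.
Proof.
elim=> [P1 P2 [f mf ->]|P1|P1 P2 P3 _ h1 _ h2]; last 2 first.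
- exact: rt_refl.
- exact: rt_trans h2 h1.
have back g : eisenpint_move g -> g \o f = id ->
    eisenpint_equiv (image_circles (omap f) P1) P1.
  move=> mg gf; apply: rt_step; exists g => //; rewrite move_comp // gf.
  by rewrite -[LHS]image_circles_id; congr image_circles; apply/funext => -[].
case: mf back => [t ht||] back.
- apply: (back (fun z => z + 2 * - t)); first by apply: Move_translation;
  exact: eisN.
  by apply/funext => z /=; ring.
- by apply: (back (fun z => - z)); [exact: Move_rotation | apply/funext => z /=;
  rewrite opprK].
- apply: (back (fun z => - z^*)); first exact: Move_reflection.
  by apply/funext => z /=; rewrite !conjE opprK.
Qed.

Lemma eisenpint_equiv_trans P Q S :
  eisenpint_equiv P Q -> eisenpint_equiv Q S -> eisenpint_equiv P S.
Proof. exact: rt_trans. Qed.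

(** The image of the real line gives e = a - i b sqrt 3 with a^2 + 3 b^2 = 1, hence a sign, and Im t
    = k sqrt 3; a second vector gives Re t = l. The image of [lat 1 0 0 0] has an even co-curvature
    coordinate, so l and k have the same parity, which is membership of t in twice the Eisenstein
    integers. *)
Lemma simil_Lat e t : nsq e = 1 -> (forall x, Lat x -> Lat (simil e t x)) ->
  (e = 1 \/ e = -1) /\ exists2 t', eisenstein_int t' & t = 2 * t'.
Proof.
move=> he hL.
have L m n b a : Lat (lat m n b a : 'rV[R]_4) by do 4 eexists.
have [m1 [n1 [b1 [a1 E1]]]] := hL _ (L 0 0 0 1).
have [m2 [n2 [b2 [a2 E2]]]] := hL _ (L 0 0 1 0).
have [m3 [n3 [b3 [a3 E3]]]] := hL _ (L 1 0 0 0).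
move: he E1 E2 E3; case: e {hL} => e1 e2; case: t => t1 t2 he E1 E2 E3.
have s0 := @s3_neq0 R.
have p1 := congr1 vp E1; have q1 := congr1 vq E1; have v1 := congr1 vv E1.
have v2 := congr1 vv E2; have v3 := congr1 vv E3.
rewrite /nsq /= in he.
rewrite !mkvE /nsq /= in p1 q1 v1 v2 v3; clear E1 E2 E3.
have e2E : e2 = - (s3 * b1%:~R).
  by rewrite -p1; ring.
have e1E : e1 = a1%:~R by rewrite -q1; ring.
have hq : qnorm 0 0 b1 a1 = 1.
  apply/(@qnorm_lat R); apply: etrans he; rewrite e1E e2E dotxx !mkvE; ring.
have b10 : b1 = 0.
  have := sqr_ge0 a1; have := sqr_ge0 b1; move: hq;
    rewrite /qnorm !expr2 => h1 h2 h3.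
  have /eqP : b1 * b1 = 0 by lia.
  by rewrite mulf_eq0 orbb => /eqP.
have ha1 : a1 = 1 \/ a1 = -1.
  have /eqP : a1 ^+ 2 = 1 by move: hq; rewrite /qnorm b10 expr2; lia.
  by rewrite sqrf_eq1 => /orP[]/eqP; [left|right].
rewrite b10 mulr0 oppr0 in e2E.
have hE : (e1 +i* e2 : R[i]) = a1%:~R.
  by rewrite e2E e1E -(rmorph_int (real_complex R)).
split; first by rewrite hE; case: ha1 => ->; [left|right].
have aa : a1%:~R * a1%:~R = 1 :> R by case: ha1 => ->;
  rewrite ?rmorphN1 ?mulrNN mulr1.
have t2E : t2 = s3 * (a1 * n1)%:~R.
  rewrite rmorphM /=.
  transitivity (a1%:~R * (2 * (t2 * a1%:~R)) / 2); first by field: aa.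
  have -> : 2 * (t2 * a1%:~R) = 2 * s3 * n1%:~R by rewrite -v1 e2E e1E; ring.
  by field.
have t1E : t1 = (a1 * n2)%:~R.
  rewrite rmorphM /=; apply: (mulfI s0).
  transitivity (a1%:~R * (2 * (t1 * (a1%:~R * s3))) / 2); first by field: aa.
  have -> : 2 * (t1 * (a1%:~R * s3)) = 2 * s3 * n2%:~R by rewrite -v2 e2E e1E; ring.
  by field.
set k := a1 * n1 in t2E; set l := a1 * n2 in t1E.
have par : l * l + 3 * (k * k) = 2 * n3.
  apply: (@intr_inj R); apply: (mulfI s0).
  transitivity (s3 * (t1 ^+ 2 + t2 ^+ 2)).
    by rewrite t1E t2E !(rmorphD, rmorphM) /=; ring: (@sqr_s3 R).
  by rewrite rmorphM /=; apply: etrans (_ : _ = 2 * s3 * n3%:~R) _; [rewrite -v3;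
    ring | ring].
have [h hh] : exists h, l = 2 * h + k.
  exists ((l - k) %/ 2)%Z.
  have [l' [lr [hl hlr]]] : exists q r, l = 2 * q + r /\ (r == 0) || (r == 1).
    by exists (l %/ 2)%Z, (l %% 2)%Z; split; lia.
  have [k' [kr [hk' hkr]]] : exists q r, k = 2 * q + r /\ (r == 0) || (r == 1).
    by exists (k %/ 2)%Z, (k %% 2)%Z; split; lia.
  suff : lr = kr by lia.
  move: par; rewrite hl hk'.
  have -> : (2 * l' + lr) * (2 * l' + lr) = 2 * (2 * l' * l' + 2 * l' * lr)
    + lr * lr by ring.
  have -> : (2 * k' + kr) * (2 * k' + kr) = 2 * (2 * k' * k' + 2 * k' * kr)
    + kr * kr by ring.
  set X := 2 * l' * l' + _; set Y := 2 * k' * k' + _.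
  by case/orP: hlr => /eqP ->; case/orP: hkr => /eqP ->; lia.
apply/eisenstein_int2; exists h, k; rewrite t1E t2E hh rmorphD rmorphM /=.
by congr (_ +i* _); ring.
Qed.

Lemma Lat_conjv x : Lat x -> Lat (conjv x).
Proof.
move=> [m [n [b [a ->]]]]; exists m, n, b, (- a).
by apply: vecP; rewrite !mkvE // rmorphN.
Qed.

Lemma conjvK x : conjv (conjv x) = x.
Proof. by apply: vecP; rewrite !mkvE // opprK. Qed.

Lemma isometric_equiv w w' : lwheel w -> lwheel w' ->
  isometric (packing w) (packing w') -> eisenpint_equiv (packing w) (packing w').
Proof.
move=> lw lw' [e [t [/nsq_norm he h]]]; have [gw _] := lw.
(* The wheel [w] spans the lattice and its images are circles of [packing w'], so [A] preserves the
   lattice. *)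
have LA f A : circle_map f A -> (forall x y, A (x + y) = A x + A y) ->
    packing w' = image_circles f (packing w) ->
    (forall (k : int) x, A (k%:~R *: x) = k%:~R *: A x) -> forall x, Lat x -> Lat (A x).
  move=> fA AD hP AZ x lx; apply: (Lat_lin (P := fun y => Lat (A y)) lw lx).
    by rewrite -(scale0r 0) (AZ 0) scale0r; exists 0, 0, 0, 0; apply: vecP;
      rewrite !vecE; ring.
  move=> k i y ly; rewrite AD AZ; apply: LatD => //; apply: LatZ.
  have [C eC] := vec_surj (gwheel_dot1 i gw).
  have [D eD] := circle_map_vec C fA.
  rewrite -eC -eD; apply: (packing_Lat lw'); rewrite hP (image_circlesP _ fA).
  by exists C => //; exists w; [exact: worbit0 | exists i].
have rot := Move_rotation R; have refl := Move_reflection R.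
have step f P : eisenpint_move f -> eisenpint_equiv P (image_circles (omap f) P).
  by move=> mf; apply: rt_step; exists f.
case: h => hP.
  have [he' [t' ht' et]] := simil_Lat he (LA _ _ (circle_map_simil t he)
    (similD e t) hP (fun k => similZ e t k%:~R)).
  have tr := Move_translation ht'.
  case: he' => ee.
    rewrite hP (_ : omap _ = omap (fun z => z + 2 * t')); first exact: step.
    by apply/funext => -[z|] //=; rewrite ee et mul1r.
  rewrite hP (_ : omap _ = omap ((fun z => z + 2 * t') \o -%R)); last first.
    by apply/funext => -[z|] //=; rewrite ee et mulN1r.
  by rewrite -move_comp //; apply: rt_trans (step _ _ rot) (step _ _ tr).
have AD x y : (simil e t \o conjv) (x + y) = (simil e t \o conjv) x
  + (simil e t \o conjv) y.
  by rewrite /= conjvD similD.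
have AZ (k : int) x : (simil e t \o conjv) (k%:~R *: x) = k%:~R *:
  (simil e t \o conjv) x.
  by rewrite /= conjvZ similZ.
have L x : Lat x -> Lat (simil e t x).
  move=> lx; rewrite -(conjvK x).
  exact: (LA _ _ (simil_conj_map t he) AD hP AZ _ (Lat_conjv lx)).
have [he' [t' ht' et]] := simil_Lat he L.
have tr := Move_translation ht'.
case: he' => ee; last first.
  rewrite hP (_ : omap _ = omap ((fun z => z + 2 * t') \o (fun z => - z^*)));
    last first.
    by apply/funext => -[z|] //=; rewrite ee et mulN1r.
  by rewrite -move_comp //; apply: rt_trans (step _ _ refl) (step _ _ tr).
rewrite hP (_ : omap _ = omap (((fun z => z
  + 2 * t') \o -%R) \o (fun z => - z^*))); last first.
  by apply/funext => -[z|] //=; rewrite ee et mul1r opprK.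
have -> : image_circles (omap ((fun z => z
  + 2 * t') \o -%R \o (fun z : R[i] => - z^*))) (packing w)
   = image_circles (omap (fun z => z + 2 * t')) (image_circles (omap -%R)
     (image_circles (omap (fun z : R[i] => - z^*)) (packing w))).
  have [A1 h1] := move_circle_map refl; have [A2 h2] := move_circle_map rot.
  have [A3 h3] := move_circle_map tr.
  rewrite (image_circles_comp _ h1 h2) (image_circles_comp _
    (circle_map_comp h1 h2) h3).
  by congr image_circles; apply/funext => -[].
by apply: rt_trans (rt_trans _ _ _ _ _ (step _ _ refl) (step _ _ rot))
  (step _ _ tr).
Qed.

End Isometries.

(** * The bijection *)

Section Bijection.
Context {R : realType}.
Implicit Types (x y z : 'rV[R]_4) (C D : ocircle R) (w v : 'I_4 -> 'rV[R]_4).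
Implicit Types (P Q : set (ocircle R)).

(** The linear map taking [w] to [v] is an isometry since the Gram matrices agree. Equal curvatures
    mean that it fixes the isotropic vector [n0] of infinity, so it comes from a Euclidean
    motion. *)
Lemma same_curv_isometric w v : gram w -> gram v -> (forall i, vu (w i) = vu
  (v i)) ->
  exists e t : R[i], nsq e = 1 /\
    ((forall i, v i = simil e t (w i)) \/ (forall i, v i = simil e t (conjv
      (w i)))).
Proof.
move=> gw gv huv.
pose A x := \sum_i coef w x i *: v i.
have hA x i : dot (A x) (v i) = dot x (w i).
  rewrite /A {2}(expand x gw) !dot_suml; apply: eq_bigr => j _.
  by rewrite !dotZl gv gw.
have Aw i : A (w i) = v i.
  by apply: (dot_inj gv) => j; rewrite hA gw gv.
have AD x y : A (x + y) = A x + A y.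
  by apply: (dot_inj gv) => j; rewrite hA !dotDl !hA.
have AZ a x : A (a *: x) = a *: A x.
  by apply: (dot_inj gv) => j; rewrite hA !dotZl !hA.
have Ad x y : dot (A x) (A y) = dot x y.
  rewrite {2}/A {2}(expand y gw) !dot_sumr; apply: eq_bigr => j _.
  by rewrite !dotZr hA.
pose n0 : 'rV[R]_4 := mkv 0 1 0 0; pose n1 : 'rV[R]_4 := mkv 1 0 0 0.
pose n2 : 'rV[R]_4 := mkv 0 0 1 0; pose n3 : 'rV[R]_4 := mkv 0 0 0 1.
have dn0 x : dot n0 x = - 2^-1 * vu x by rewrite /dot !mkvE; ring.
have An0 : A n0 = n0 by apply: (dot_inj gv) => j; rewrite hA !dn0 huv.
have Au x : vu (A x) = vu x.
  have := Ad n0 x; rewrite An0 !dn0; apply: mulfI.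
  by rewrite oppr_eq0 invr_eq0 pnatr_eq0.
have u1 := Au n1; have u2 := Au n2; have u3 := Au n3.
have d11 := Ad n1 n1; have d12 := Ad n1 n2; have d13 := Ad n1 n3.
have d22 := Ad n2 n2; have d23 := Ad n2 n3; have d33 := Ad n3 n3.
have Ax x : A x = vu x *: A n1 + vv x *: n0 + vp x *: A n2 + vq x *: A n3.
  rewrite -[in LHS](mkvK x) -An0 -!AZ -!AD; congr A.
  by apply: vecP; rewrite !vecE; ring.
move: (A n1) (A n2) (A n3) Ax u1 u2 u3 d11 d12 d13 d22 d23 d33 => a1 a2 a3 Ax.
rewrite /dot !mkvE => u1 u2 u3; rewrite u1 u2 u3 => d11 d12 d13 d22 d23 d33.
pose e := vp a2 +i* vq a2; pose t := vp a1 +i* vq a1.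
have he : vp a2 ^+ 2 + vq a2 ^+ 2 = 1 by lra.
(* The determinant of the planar part: 1 for a rotation, -1 for a reflection. *)
pose s := vp a2 * vq a3 - vq a2 * vp a3.
have orth : vp a2 * vp a3 + vq a2 * vq a3 = 0 by lra.
have n3n : vp a3 ^+ 2 + vq a3 ^+ 2 = 1 by lra.
have s2 : s ^+ 2 = 1.
  transitivity ((vp a2 ^+ 2 + vq a2 ^+ 2) * (vp a3 ^+ 2 + vq a3 ^+ 2)
    - (vp a2 * vp a3 + vq a2 * vq a3) ^+ 2); first by rewrite /s; ring.
  by rewrite he n3n orth; ring.
have p3 : vp a3 = - s * vq a2.
  transitivity ((vp a2 ^+ 2 + vq a2 ^+ 2) * vp a3
    - vp a2 * (vp a2 * vp a3 + vq a2 * vq a3)); first by rewrite he orth; ring.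
  by rewrite /s; ring.
have q3 : vq a3 = s * vp a2.
  transitivity ((vp a2 ^+ 2 + vq a2 ^+ 2) * vq a3
    - vq a2 * (vp a2 * vp a3 + vq a2 * vq a3)); first by rewrite he orth; ring.
  by rewrite /s; ring.
have v1 : vv a1 = vp a1 ^+ 2 + vq a1 ^+ 2 by lra.
have v2 : vv a2 = 2 * (vp a1 * vp a2 + vq a1 * vq a2) by lra.
have v3 : vv a3 = 2 * (vp a1 * vp a3 + vq a1 * vq a3) by lra.
exists e, t; split; first exact: he.
move/eqP: s2; rewrite sqrf_eq1 => /orP[]/eqP s1; rewrite s1 in p3 q3;
  [left|right] => i;
  rewrite -Aw Ax; apply: vecP;
  rewrite /simil /e /t /nsq /conjv !vecE /= ?u1 ?u2 ?u3 ?v1 ?v2 ?v3 ?p3 ?q3; ring.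
Qed.

Lemma isometric_packing w v : gwheel w -> gwheel v -> (forall i, vu (w i) = vu
  (v i)) ->
  isometric (packing w) (packing v).
Proof.
move=> gw gv huv; have [g1 _] := gw; have [g2 _] := gv.
have [e [t [he h]]] := same_curv_isometric g1 g2 huv.
exists e, t; split; first exact/nsq_norm.
case: h => h; [left|right].
  rewrite (packing_image (circle_map_simil t he) (similD e t) gw).
  by congr packing; apply/funext.
rewrite (packing_image (simil_conj_map t he) _ gw); last first.
  by move=> x y; rewrite /= conjvD similD.
by congr packing; apply/funext.
Qed.

Lemma scale_packing w : lwheel w ->
  gwheel (scalev s3 \o w) /\ scale_sqrt3 (packing w) = packing (scalev s3 \o w).
Proof.
move=> [[gw uw] _]; have s0 := @s3_gt0 R.
split; last exact: packing_image (circle_map_scale s0) (scalevD s3) _.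
split; first by move=> i j; have [_ _ h] := circle_map_scale s0; rewrite /= h gw.
have -> : sgm (scalev s3 \o w) = scalev s3 (sgm w) by rewrite /sgm !sum4 !scalevD.
by rewrite mkvE divr_gt0.
Qed.

Lemma curv_dvd w (d : nat) : gwheel w ->
  (forall i, exists k : int, vu (w i) = d%:R * k%:~R) ->
  forall C, packing w C -> exists k : int, curv C = d%:R * k%:~R.
Proof.
move=> gw h C [w' o1 [i eC]]; have -> : curv C = vu (w' i) by rewrite -eC mkvE.
elim: o1 i {eC} => // j w1 _ ih i; rewrite /gswap; case: ifP => _ //.
have [k0 h0] := ih i0; have [k1 h1] := ih i1.
have [k2 h2] := ih i2; have [k3 h3] := ih i3.
have [k' hn] : exists k : int, vu (nb w1 j) = d%:R * k%:~R.
  move: j; apply: ord4_ind; rewrite nbE vecE ?h0 ?h1 ?h2 ?h3 -mulrDr -rmorphD /=;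
    by eexists.
have [k hk] := ih j; exists (k' + k' - k); rewrite mulr2n !vecE hn hk.
by rewrite !rmorphD rmorphN /=; ring.
Qed.

Lemma packing_primitive w : lwheel w -> primitive (scale_sqrt3 (packing w)).
Proof.
move=> lw; have [gw' ->] := scale_packing lw; have [hw lat_w] := lw.
have s0 := @s3_neq0 R.
have hm i : exists k : int, vu ((scalev s3 \o w) i) = k%:~R.
  by have [m [n [b [a e]]]] := lat_w i; exists m; rewrite /= e !mkvE mulrC mulKf.
split=> [C PC|d hd].
  have [i|k ->] := @curv_dvd _ 1 gw' _ C PC; last by rewrite mul1r intr_int.
  by have [k hk] := hm i; exists k; rewrite mul1r.
have {}hd i : exists k : int, vu (w i) = s3 * (d%:R * k%:~R).
  have [gw _] := gw'; have [C eC] : exists C, vec C = (scalev s3 \o w) i.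
    by apply: vec_surj; exact: gwheel_dot1.
  have [|k hk] := hd C; first by exists (scalev s3 \o w); [exact: worbit0|exists i].
  exists k; rewrite -hk.
  have -> : curv C = vu (vec C) by rewrite mkvE.
  by rewrite eC /= mkvE mulrC divfK.
(* The lattice contains a vector of curvature sqrt 3, an integral combination of the wheel; a common
   divisor of the scaled curvatures therefore divides 1. *)
have : exists k : int, vu (lat 1 0 0 0) = s3 * (d%:R * k%:~R) :> R.
  apply: (Lat_lin (P := fun x => exists k : int, vu x = s3 * (d%:R * k%:~R)) lw).
  - by exists 1, 0, 0, 0.
  - by exists 0; rewrite vec0E !mulr0.
  - move=> k i y [k' hk']; have [l hl] := hd i; exists (k * l + k').
    by rewrite !vecE hl hk' rmorphD rmorphM /=; ring.
move=> [k]; rewrite mkvE => /(mulfI s0) e.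
have {}e : 1 = d%:Z * k by apply: (@intr_inj R); rewrite rmorphM.
have : (d %| 1)%Z by apply/dvdzP; exists k; rewrite mulrC.
by rewrite dvdz1 => /eqP.
Qed.

Lemma eisenpint_scale P : eisenpint_packing P ->
  primitive_eisenstein_packing (scale_sqrt3 P).
Proof.
move=> /eisenpint_packingP[w lw ->]; split; last exact: packing_primitive.
have [gw ->] := scale_packing lw.
by apply/eisenstein_packingP; exists (scalev s3 \o w).
Qed.

Lemma eisenpint_scale_surj Q : primitive_eisenstein_packing Q ->
  exists2 P, eisenpint_packing P & isometric (scale_sqrt3 P) Q.
Proof.
move=> [/eisenstein_packingP[v gv ->] [hint hgcd]].
have [gr uv] := gv.
have ha i : exists k : int, vu (v i) = k%:~R.
  have [C eC] : exists C, vec C = v i by apply: vec_surj; exact: gwheel_dot1.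
  have : curv C \is a Num.int by apply: hint; exists v; [exact: worbit0 | exists i].
  by move=> /intrP[k hk]; exists k; rewrite -hk -eC mkvE.
have [a {}ha] := choice ha.
have qa : quad a.
  (* The isotropic vector of infinity, whose products are the curvatures times - 1/2. *)
  pose n0 : 'rV[R]_4 := mkv 0 1 0 0.
  have := dot_expand n0 gr.
  have dn0 x : dot n0 x = - 2^-1 * vu x by rewrite /dot !mkvE; ring.
  rewrite !dn0 mkvE !ha /quad => h.
  apply: (@intr_inj R); rewrite !(rmorphD, rmorphM) /=.
  by move: h; set x := (a i0)%:~R; set y := (a i1)%:~R; set z := (a i2)%:~R;
    set t := (a i3)%:~R; lra.
have sa : 0 < \sum_i a i.
  by move: uv; rewrite vu_sum (eq_bigr _ (fun i _ => ha i)) -(ltr0z R) rmorph_sum.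
have ga (d : nat) : (forall i, (d %| a i)%Z) -> d = 1%N.
  move=> hd; apply: hgcd => C; apply: curv_dvd => // i.
  by have /dvdzP[k hk] := hd i; exists k; rewrite ha hk rmorphM /= mulrC.
have [w lw hw] := @curv_wheel_exists R a qa sa ga.
exists (packing w); first by apply/eisenpint_packingP; exists w.
have [gw ->] := scale_packing lw; apply: isometric_packing => // i.
by rewrite /= mkvE hw ha mulrC mulKf // s3_neq0.
Qed.

Lemma eisenpint_scale_inj P P' : eisenpint_packing P -> eisenpint_packing P' ->
  isometric (scale_sqrt3 P) (scale_sqrt3 P') -> eisenpint_equiv P P'.
Proof.
move=> /eisenpint_packingP[w lw ->] /eisenpint_packingP[w' lw' ->] h.
by apply: isometric_equiv => //; apply: scl_isometric_iff (@s3_gt0 R) h.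
Qed.

End Bijection.

Theorem theorem1p21 (R : realType) :
  (forall P : set (ocircle R), eisenpint_packing P ->
     primitive_eisenstein_packing (scale_sqrt3 P)) /\
  set_bij (eq_classes (@eisenpint_packing R) (@eisenpint_equiv R))
          (eq_classes (@primitive_eisenstein_packing R) (@isometric R))
          (fun K => [set Q | primitive_eisenstein_packing Q /\
                             exists2 P, K P & isometric (scale_sqrt3 P) Q]).
Proof.
split; first exact: eisenpint_scale.
(* Equivalent packings are isometric and scaling respects this, so the image of a class depends on
   one representative only. *)
have cls (P : set (ocircle R)) : eisenpint_packing P ->
    [set Q | primitive_eisenstein_packing Q /\
       exists2 P', (eisenpint_packing P' /\ eisenpint_equiv P P') &
         isometric (scale_sqrt3 P') Q] =
    [set Q | primitive_eisenstein_packing Q /\ isometric (scale_sqrt3 P) Q].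
  move=> eP; apply/seteqP; split=> Q [pQ].
    move=> [P' [_ /eisenpint_equiv_isometric h] h']; split=> //.
    by apply: isometric_trans h'; apply: scl_isometric h; exact: s3_gt0.
  by move=> h; split=> //; exists P => //; split=> //; exact: rt_refl.
split.
- move=> _ [P eP ->]; exists (scale_sqrt3 P); first exact: eisenpint_scale.
  exact: cls.
- move=> K K' /set_mem[P eP ->] /set_mem[P' eP' ->] /=;
  rewrite (cls _ eP) (cls _ eP').
  move/seteqP => [+ _]; move/(_ (scale_sqrt3 P)) => /=.
  case; first by split; [exact: eisenpint_scale | exact: isometric_refl].
  move=> _ /(eisenpint_scale_inj eP' eP) h.
  apply/seteqP; split=> Q [eQ hQ]; split=> //.
    exact: eisenpint_equiv_trans h hQ.
  exact: eisenpint_equiv_trans (eisenpint_equiv_sym h) hQ.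
- move=> _ [Q pQ ->]; have [P eP hP] := eisenpint_scale_surj pQ.
  exists [set P' | eisenpint_packing P' /\ eisenpint_equiv P P']; first by exists P.
  rewrite /= (cls _ eP); apply/seteqP; split=> Q' [pQ' h]; split=> //.
    exact: isometric_trans (isometric_sym hP) h.
  exact: isometric_trans hP h.
Qed.
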